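(* Let $w,\tau,v\in I_{d,n}$, and write $\mathrm{mult}_\tau X$ for the multiplicity of $X$ at the point $e_\tau$. (1) Suppose $w>\tau\ge v$. Then $$(\mathrm{mult}_\tau X_w^v)\,\deg_\tau(w)=\sum_{w'\in\partial_{w,\tau}^{v,+}}\mathrm{mult}_\tau X_{w'}^v .$$ (2) Suppose $w\ge\tau>v$. Then $$(\mathrm{mult}_\tau X_w^v)\,\deg_\tau(v)=\sum_{v'\in\partial_{w,\tau}^{v,-}}\mathrm{mult}_\tau X_w^{v'} .$$ (3) $\mathrm{mult}_\tau X_\tau^\tau=1$.
   Context: $K$ is an algebraically closed field of arbitrary characteristic, $1\le d<n$, and $G_{d,n}$ is the Grassmannian of $d$-dimensional subspaces of $K^n$. $I_{d,n}=\{(i_1,\dots,i_d)\in\mathbb{N}^d: 1\le i_1<\dots<i_d\le n\}$, partially ordered by $\underline i\ge\underline j\iff i_t\ge j_t$ for all $t$; it is identified with the set $W^P$ of minimal length coset representatives of $S_n/(S_d\times S_{n-d})$ ($\underline i$ corresponds to the permutation $(i_1,\dots,i_d,j_1,\dots,j_{n-d})$ with the $j$'s the complement in increasing order), and $l(\underline i)$ is the length of this permutation. For $\tau\in I_{d,n}$, $e_\tau\in G_{d,n}$ is the span of $e_{\tau_1},\dots,e_{\tau_d}$. With $V_t=\langle e_1,\dots,e_t\rangle$ and $V^t=\langle e_n,\dots,e_{n-t+1}\rangle$, the Schubert variety is $X_{\underline i}=\{U: \dim(U\cap V_{i_t})\ge t,\ 1\le t\le d\}$, the opposite Schubert variety is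 $X^{\underline i}=\{U:\dim(U\cap V^{n-i_{(d-t+1)}+1})\ge t,\ 1\le t\le d\}$, and the Richardson variety is $X_w^v=X_w\cap X^v$; it is nonempty iff $w\ge v$, and then reduced and irreducible. One has $e_\tau\in X_w^v\iff w\ge\tau\ge v$. Multiplicity: for a point $P$ on a variety $X$ with local ring $(A,\mathfrak m)$, $\mathrm{mult}_P(X)$ is the degree of $\mathrm{Proj}(\mathrm{gr}(A,\mathfrak m))$, where if the Hilbert polynomial of a standard graded $K$-algebra has degree $r$ and leading coefficient $c/r!$, its degree is $c$. (When $\dim X=0$ the multiplicity of a reduced point is $1$.) $\deg_\tau(\theta)$: on the affine open neighbourhood of $e_\tau$ where the Plücker coordinate $p_\tau\ne0$, each point is the column span of a unique $n\times d$ matrix whose rows $\tau_1,\dots,\tau_d$ form the identity matrix, and the remaining $d(n-d)$ entries are affine coordinates. For $\theta\in I_{d,n}$, $f_{\theta,\tau}=p_\theta/p_\tau$ is a homogeneous polynomial in these coordinates and $\deg_\tau(\theta)$ is its degree; explicitly $\deg_\tau(\theta)=d-\#(\{\tau_1,\dots,\tau_d\}\cap\{\theta_1,\dots,\theta_d\})$. If $w>\tau\ge v$: $\partial_{w,\tau}^{v,+}=\{w'\in I_{d,n}: w>w'\ge\tau\ge v,\ l(w')=l(w)-1\}$. If $w\ge\tau>v$: $\partial_{w,\tau}^{v,-}=\{v'\in I_{d,n}: w\ge\tau\ge v'>v,\ l(v')=l(v)+1\}$. *)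

(* Defs.v *)
From HB Require Import structures.
From mathcomp Require Import all_boot all_order all_algebra perm.
From mathcomp Require Import boolp.
From mathcomp Require Import mpoly.
From mathcomp Require Import ring.

Set Implicit Arguments.
Unset Strict Implicit.
Unset Printing Implicit Defensive.

Import GRing.Theory.
Local Open Scope quotient_scope.
Local Open Scope ring_scope.

(* The local ring at P of the reduced affine algebraic set X in K^N.  It is
   built in one step as the localization at P of K[x]/I(X): fractions f/g with
   g(P) != 0, where f/g = f'/g' iff h (f g' - f' g) vanishes on X for some h
   with h(P) != 0.  It is the zero ring when X is closed and P is not in X. *)
Module LocalRing.
Section LocalRing.

Variables (K : fieldType) (N : nat).
Variables (X : ('I_N -> K) -> Prop) (P : 'I_N -> K).

Local Notation poly := {mpoly K[N]}.

Record frac := Frac { fpair :> poly * poly; _ : fpair.2.@[P] != 0 }.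

HB.instance Definition _ := [isSub for fpair].
HB.instance Definition _ := [Choice of frac by <:].

Definition equivf (x y : frac) : bool :=
  `[< exists h : poly, h.@[P] != 0 /\
        forall z, X z -> (h * (x.1 * y.2 - y.1 * x.2)).@[z] = 0 >].

Lemma equivf_refl : reflexive equivf.
Proof.
move=> x; apply/asboolP; exists 1; rewrite meval1 oner_neq0; split=> // z _.
by rewrite subrr mulr0 meval0.
Qed.

Lemma equivf_symm x y : equivf x y -> equivf y x.
Proof.
move=> /asboolP [h [hP hX]]; apply/asboolP; exists h; split=> // z /hX hz.
by rewrite -opprB mulrN mevalN hz oppr0.
Qed.

Lemma equivf_sym : ssrbool.symmetric equivf.
Proof. by move=> x y; apply/idP/idP; apply: equivf_symm. Qed.

Lemma equivf_trans : transitive equivf.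
Proof.
move=> y x z /asboolP [h [hP hX]] /asboolP [k [kP kX]]; apply/asboolP.
exists (h * k * y.2); split.
  by rewrite !mevalM !mulf_neq0 //; case: (y).
move=> t Xt.
have -> : h * k * y.2 * (x.1 * z.2 - z.1 * x.2) =
  (k * z.2) * (h * (x.1 * y.2 - y.1 * x.2)) +
  (h * x.2) * (k * (y.1 * z.2 - z.1 * y.2)) by ring.
by rewrite mevalD [X in X + _]mevalM [X in _ + X]mevalM hX // kX // !mulr0 addr0.
Qed.

Canonical equivf_equiv := EquivRel equivf equivf_refl equivf_sym equivf_trans.

Definition type := {eq_quot equivf}.

HB.instance Definition _ : EqQuotient _ equivf type := EqQuotient.on type.
HB.instance Definition _ := Choice.on type.

Lemma frac1_subproof : (1 : poly).@[P] != 0.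
Proof. by rewrite meval1 oner_neq0. Qed.

Definition frac0 : frac := @Frac (0, 1) frac1_subproof.

(* The class of f/g; the class of 0/1 when g(P) = 0. *)
Definition germ (f g : poly) : type := \pi_type (insubd frac0 (f, g) : frac).

Lemma germE (f g : poly) (gP : g.@[P] != 0) :
  germ f g = \pi_type (@Frac (f, g) gP).
Proof. by rewrite /germ /insubd insubT. Qed.

Lemma germP (a : type) : exists f g, g.@[P] != 0 /\ a = germ f g.
Proof.
elim/quotW: a => -[[f g] gP]; exists f, g; split=> //.
by rewrite (germE _ gP).
Qed.

Lemma germ_eqP (f g f' g' : poly) : g.@[P] != 0 -> g'.@[P] != 0 ->
  germ f g = germ f' g' <->
  exists h : poly, h.@[P] != 0 /\
    forall z, X z -> (h * (f * g' - f' * g)).@[z] = 0.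
Proof.
move=> gP gP'; rewrite (germE _ gP) (germE _ gP').
split=> [/eqmodP/asboolP //|H].
by apply/eqmodP/asboolP.
Qed.

Lemma germ_eq (f g f' g' : poly) : g.@[P] != 0 -> g'.@[P] != 0 ->
  f * g' = f' * g -> germ f g = germ f' g'.
Proof.
move=> gP gP' e; apply/germ_eqP => //; exists 1; rewrite meval1 oner_neq0.
by split=> // z _; rewrite e subrr mulr0 meval0.
Qed.

Definition num (a : type) : poly := (repr a : frac).1.
Definition den (a : type) : poly := (repr a : frac).2.

Lemma denP a : (den a).@[P] != 0.
Proof. by rewrite /den; case: (repr a). Qed.

Lemma germK a : germ (num a) (den a) = a.
Proof.
rewrite (germE _ (denP a)) -[RHS]reprK; congr \pi.
by apply: val_inj; rewrite /num /den /=; case: (fpair _).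
Qed.

Definition add a b := germ (num a * den b + num b * den a) (den a * den b).
Definition opp a := germ (- num a) (den a).
Definition mul a b := germ (num a * num b) (den a * den b).
Definition const (c : K) := germ c%:MP 1.

Lemma mP (g g' : poly) : g.@[P] != 0 -> g'.@[P] != 0 -> (g * g').@[P] != 0.
Proof. by move=> *; rewrite mevalM mulf_neq0. Qed.

Lemma germD (f g f' g' : poly) : g.@[P] != 0 -> g'.@[P] != 0 ->
  add (germ f g) (germ f' g') = germ (f * g' + f' * g) (g * g').
Proof.
move=> gP gP'.
have [h [hP hX]] := (germ_eqP _ _ (denP _) gP).1 (germK (germ f g)).
have [k [kP kX]] := (germ_eqP _ _ (denP _) gP').1 (germK (germ f' g')).
rewrite /add; set a := num _ in hX *; set b := den _ in hX *.
set c := num _ in kX *; set d := den _ in kX *.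
apply/germ_eqP; rewrite ?mP ?denP //.
exists (h * k); split; first exact: mP.
move=> z Xz.
have -> : h * k * ((a * d + c * b) * (g * g') - (f * g' + f' * g) * (b * d)) =
  (k * d * g') * (h * (a * g - f * b)) +
  (h * b * g) * (k * (c * g' - f' * d)) by ring.
by rewrite mevalD [X in X + _]mevalM [X in _ + X]mevalM hX // kX // !mulr0 addr0.
Qed.

Lemma germN (f g : poly) : g.@[P] != 0 -> opp (germ f g) = germ (- f) g.
Proof.
move=> gP.
have [h [hP hX]] := (germ_eqP _ _ (denP _) gP).1 (germK (germ f g)).
rewrite /opp; set a := num _ in hX *; set b := den _ in hX *.
apply/germ_eqP; rewrite ?denP //; exists h; split=> // z Xz.
have -> : h * (- a * g - - f * b) = - (h * (a * g - f * b)) by ring.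
by rewrite mevalN hX // oppr0.
Qed.

Lemma germM (f g f' g' : poly) : g.@[P] != 0 -> g'.@[P] != 0 ->
  mul (germ f g) (germ f' g') = germ (f * f') (g * g').
Proof.
move=> gP gP'.
have [h [hP hX]] := (germ_eqP _ _ (denP _) gP).1 (germK (germ f g)).
have [k [kP kX]] := (germ_eqP _ _ (denP _) gP').1 (germK (germ f' g')).
rewrite /mul; set a := num _ in hX *; set b := den _ in hX *.
set c := num _ in kX *; set d := den _ in kX *.
apply/germ_eqP; rewrite ?mP ?denP //.
exists (h * k); split; first exact: mP.
move=> z Xz.
have -> : h * k * (a * c * (g * g') - f * f' * (b * d)) =
  (k * c * g') * (h * (a * g - f * b)) +
  (h * f * b) * (k * (c * g' - f' * d)) by ring.
by rewrite mevalD [X in X + _]mevalM [X in _ + X]mevalM hX // kX // !mulr0 addr0.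
Qed.

Lemma addA : associative add.
Proof.
move=> a b c; have [f [g [gP ->]]] := germP a.
have [f' [g' [gP' ->]]] := germP b; have [f2 [g2 [gP2 ->]]] := germP c.
rewrite !germD ?mP //; apply: germ_eq; rewrite ?mP //; ring.
Qed.

Lemma addC : commutative add.
Proof.
move=> a b; have [f [g [gP ->]]] := germP a.
have [f' [g' [gP' ->]]] := germP b.
rewrite !germD ?mP //; apply: germ_eq; rewrite ?mP //; ring.
Qed.

Lemma add0l : left_id (const 0) add.
Proof.
move=> a; have [f [g [gP ->]]] := germP a.
rewrite germD ?frac1_subproof // mpolyC0.
apply: germ_eq; rewrite ?mP ?frac1_subproof //; ring.
Qed.

Lemma addNl : left_inverse (const 0) opp add.
Proof.
move=> a; have [f [g [gP ->]]] := germP a.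
rewrite germN // germD // /const mpolyC0.
apply: germ_eq; rewrite ?mP ?frac1_subproof //; ring.
Qed.

HB.instance Definition _ := GRing.isZmodule.Build type addA addC add0l addNl.

Lemma mulA : associative mul.
Proof.
move=> a b c; have [f [g [gP ->]]] := germP a.
have [f' [g' [gP' ->]]] := germP b; have [f2 [g2 [gP2 ->]]] := germP c.
rewrite !germM ?mP //; apply: germ_eq; rewrite ?mP //; ring.
Qed.

Lemma mulC : commutative mul.
Proof.
move=> a b; have [f [g [gP ->]]] := germP a.
have [f' [g' [gP' ->]]] := germP b.
rewrite !germM ?mP //; apply: germ_eq; rewrite ?mP //; ring.
Qed.

Lemma mul1l : left_id (const 1) mul.
Proof.
move=> a; have [f [g [gP ->]]] := germP a.
rewrite germM ?frac1_subproof // mpolyC1.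
apply: germ_eq; rewrite ?mP ?frac1_subproof //; ring.
Qed.

Lemma mulDl : left_distributive mul add.
Proof.
move=> a b c; have [f [g [gP ->]]] := germP a.
have [f' [g' [gP' ->]]] := germP b; have [f2 [g2 [gP2 ->]]] := germP c.
rewrite !(germM, germD) ?mP //; apply: germ_eq; rewrite ?mP //; ring.
Qed.

HB.instance Definition _ :=
  GRing.Zmodule_isComPzRing.Build type mulA mulC mul1l mulDl.

Definition scale (c : K) (a : type) : type := const c * a.

Lemma constM c d : const (c * d) = const c * const d.
Proof.
rewrite /const [RHS]germM ?frac1_subproof // mpolyCM.
by apply: germ_eq; rewrite ?mP ?frac1_subproof // mulr1.
Qed.

Lemma constD c d : const (c + d) = const c + const d.
Proof.
rewrite /const [RHS]germD ?frac1_subproof // mpolyCD.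
by apply: germ_eq; rewrite ?mP ?frac1_subproof // !mulr1.
Qed.

Lemma scaleA c d a : scale c (scale d a) = scale (c * d) a.
Proof. by rewrite /scale constM mulrA. Qed.

Lemma scale1 : left_id 1 scale.
Proof. by move=> a; exact: mul1r. Qed.

Lemma scaleDr : right_distributive scale +%R.
Proof. by move=> c a b; rewrite /scale mulrDr. Qed.

Lemma scaleDl a : {morph scale^~ a : c d / c + d}.
Proof. by move=> c d; rewrite /scale constD mulrDl. Qed.

HB.instance Definition _ :=
  GRing.Zmodule_isLmodule.Build K type scaleA scale1 scaleDr scaleDl.

End LocalRing.
End LocalRing.
Export (canonicals) LocalRing.

Notation local_ring := LocalRing.type.

Section Multiplicity.

Definition nonunits (A : comPzRingType) (a : A) : Prop :=
  ~ exists b, a * b = 1.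

Definition ideal_prod (A : comPzRingType) (I J : A -> Prop) (a : A) : Prop :=
  exists r (x y : 'I_r -> A),
    (forall k, I (x k) /\ J (y k)) /\ a = \sum_(k < r) x k * y k.

Fixpoint ideal_pow (A : comPzRingType) (I : A -> Prop) (k : nat) : A -> Prop :=
  if k is k'.+1 then ideal_prod I (ideal_pow I k') else fun=> True.

(* dim_K (V / W) = r, for subspaces W of V: the classes of the b_i form a
   basis of V / W. *)
Definition quotient_dim (K : fieldType) (E : lmodType K) (V W : E -> Prop)
    (r : nat) : Prop :=
  exists b : 'I_r -> E,
    [/\ forall i, V (b i),
        forall x, V x -> exists c : 'I_r -> K, W (x - \sum_i c i *: b i)
      & forall c : 'I_r -> K, W (\sum_i c i *: b i) -> forall i, c i = 0].

(* H is the Hilbert function k |-> dim_K m^k / m^(k+1) of gr(A, m), with A the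
   local ring of X at P and m its maximal ideal. *)
Definition hilbert_function (K : fieldType) (N : nat)
    (X : ('I_N -> K) -> Prop) (P : 'I_N -> K) (H : nat -> nat) : Prop :=
  let m := @nonunits (local_ring X P) in
  forall k, quotient_dim (ideal_pow m k) (ideal_pow m k.+1) (H k).

(* c is the degree of Proj of a standard graded algebra with Hilbert function
   H.  When the Hilbert polynomial is 0 the algebra has finite length (and Proj
   is empty); then c is that length, which is 1 for the local ring K of an
   isolated point of a reduced variety. *)
Definition graded_degree (H : nat -> nat) (c : rat) : Prop :=
  exists (p : {poly rat}) (k0 : nat),
    (forall k, (k0 <= k)%N -> p.[k%:R] = (H k)%:R) /\
    c = if p == 0 then (\sum_(k < k0) H k)%N%:R
        else lead_coef p * ((size p).-1)`!%:R.

Definition is_mult (K : fieldType) (N : nat)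
    (X : ('I_N -> K) -> Prop) (P : 'I_N -> K) (c : rat) : Prop :=
  exists H, hilbert_function X P H /\ graded_degree H c.

(* By Hilbert's theorem some c with is_mult X P c exists, and it is unique, so
   the default value 0 is never used. *)
Definition mult (K : fieldType) (N : nat)
    (X : ('I_N -> K) -> Prop) (P : 'I_N -> K) : rat :=
  if pselect (exists c, is_mult X P c) is left h then sval (cid h) else 0.

End Multiplicity.

Section Indices.

Variables d n : nat.

(* Entries lie in 'I_n: the entry i_t of the mathematical tuple is the value
   of tnth i (t - 1), plus one. *)
Record grindex := GrIndex {
  index_tuple :> d.-tuple 'I_n;
  _ : sorted ltn [seq val k | k <- index_tuple] }.

HB.instance Definition _ := [isSub for index_tuple].
HB.instance Definition _ := [Finite of grindex by <:].

Definition leI (i j : grindex) : bool := [forall t, (tnth i t <= tnth j t)%N].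
Definition ltI (i j : grindex) : bool := (i != j) && leI i j.

Definition index_word (i : grindex) : seq 'I_n :=
  i ++ [seq j <- enum 'I_n | j \notin (i : seq 'I_n)].

Lemma index_uniq (i : grindex) : uniq i.
Proof.
case: i => i /= hi; rewrite -(map_inj_uniq val_inj).
by apply: sorted_uniq hi; [exact: ltn_trans | exact: ltnn].
Qed.

Lemma index_word_uniq i : uniq (index_word i).
Proof.
rewrite cat_uniq index_uniq filter_uniq ?enum_uniq // andbT.
by apply/hasPn => j; rewrite mem_filter => /andP[].
Qed.

Lemma size_index_word i : size (index_word i) = n.
Proof.
rewrite -[RHS]card_ord -(card_uniqP (index_word_uniq i)); apply: eq_card => j.
by rewrite mem_cat mem_filter mem_enum !inE andbT orbN.
Qed.

Lemma index_perm_inj i : injective (fun k : 'I_n => nth k (index_word i) k).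
Proof.
move=> k l; rewrite (set_nth_default k l) ?size_index_word // => /eqP.
by rewrite nth_uniq ?size_index_word ?index_word_uniq // => /eqP /val_inj.
Qed.

(* The minimal length coset representative (i_1, .., i_d, j_1, .., j_(n-d)),
   in one-line notation. *)
Definition index_perm (i : grindex) : 'S_n := perm (@index_perm_inj i).

Definition perm_length (s : 'S_n) : nat :=
  #|[set p : 'I_n * 'I_n | (p.1 < p.2)%N && (s p.2 < s p.1)%N]|.

Definition index_length (i : grindex) : nat := perm_length (index_perm i).

Definition bdry_plus (w tau v : grindex) : {set grindex} :=
  [set w' | [&& ltI w' w, leI tau w', leI v tau
              & index_length w' == (index_length w - 1)%N]].

Definition bdry_minus (w tau v : grindex) : {set grindex} :=
  [set v' | [&& leI tau w, leI v' tau, ltI v v'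
              & index_length v' == (index_length v + 1)%N]].

End Indices.

Section Grassmannian.

Variables (K : fieldType) (d n : nat).

Local Notation space := {vspace 'cV[K]_n}.
Local Notation e_ i := (delta_mx i 0 : 'cV[K]_n).

Definition V_low (t : nat) : space :=
  <<[seq e_ i | i : 'I_n <- enum 'I_n & (i < t)%N]>>%VS.

Definition V_high (t : nat) : space :=
  <<[seq e_ i | i : 'I_n <- enum 'I_n & (n - t <= i)%N]>>%VS.

Definition grassmannian (U : space) : Prop := \dim U = d.

Definition schubert (i : grindex d n) (U : space) : Prop :=
  grassmannian U /\
  forall t : 'I_d, (t.+1 <= \dim (U :&: V_low (tnth i t).+1))%N.

(* rev_ord t is the position d - t + 1 when counted from 1, and the exponent
   n - i_(d - t + 1) + 1 is n - (tnth i (rev_ord t)). *)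
Definition opp_schubert (i : grindex d n) (U : space) : Prop :=
  grassmannian U /\
  forall t : 'I_d,
    (t.+1 <= \dim (U :&: V_high (n - tnth i (rev_ord t))))%N.

Definition richardson (w v : grindex d n) (U : space) : Prop :=
  schubert w U /\ opp_schubert v U.

Definition coord_point (tau : grindex d n) : space :=
  <<[seq e_ i | i <- tau]>>%VS.

(* The positions of the d (n - d) free entries of the normalized matrices. *)
Definition chart_pos (tau : grindex d n) : finType :=
  ({i : 'I_n | i \notin (tau : seq 'I_n)} * 'I_d)%type.

Definition chart_dim (tau : grindex d n) : nat := #|chart_pos tau|.

Definition chart_mx (R : pzRingType) (tau : grindex d n)
    (x : 'I_(chart_dim tau) -> R) : 'M[R]_(n, d) :=
  \matrix_(i, c) match insub i : option {i | i \notin (tau : seq 'I_n)} with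
                 | Some i' => x (enum_rank ((i', c) : chart_pos tau))
                 | None => (i == tnth tau c)%:R
                 end.

Definition col_span (M : 'M[K]_(n, d)) : space :=
  <<[seq col c M | c <- enum 'I_d]>>%VS.

(* The affine chart p_tau != 0 of the Grassmannian. *)
Definition chart (tau : grindex d n) (x : 'I_(chart_dim tau) -> K) : space :=
  col_span (chart_mx x).

Lemma chart_origin (tau : grindex d n) :
  chart (fun _ : 'I_(chart_dim tau) => 0) = coord_point tau.
Proof.
rewrite /chart /col_span /coord_point -[in RHS](map_tnth_enum tau).
congr <<_>>%VS; rewrite -[RHS]map_comp; apply: eq_map => c /=; apply/matrixP => i j.
rewrite !mxE (ord1 j) eqxx andbT; case: insubP => //= u iNtau _.
by case: eqP => // ei; rewrite ei mem_tnth in iNtau.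
Qed.

(* The multiplicity at e_tau of a subvariety X of the Grassmannian, computed
   on the open neighbourhood p_tau != 0 of e_tau. *)
Definition mult_at (tau : grindex d n) (X : space -> Prop) : rat :=
  mult (fun x : 'I_(chart_dim tau) -> K => X (chart x)) (fun=> 0).

Definition plucker (R : comPzRingType) (theta : grindex d n)
    (M : 'M[R]_(n, d)) : R :=
  \det (rowsub (tnth theta) M).

Definition generic_mx (tau : grindex d n) : 'M[{mpoly K[chart_dim tau]}]_(n, d) :=
  chart_mx (fun k => 'X_k).

Lemma plucker_generic (tau : grindex d n) : plucker tau (generic_mx tau) = 1.
Proof.
rewrite /plucker -[RHS](det1 _ d); congr (\det _).
apply/matrixP => i j; rewrite !mxE; case: insubP => [u|_].
  by rewrite mem_tnth.
by rewrite (inj_eq (tuple_uniqP _ (index_uniq tau))).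
Qed.

(* f_(theta, tau) = p_theta / p_tau, whose denominator is 1 by
   plucker_generic. *)
Definition plucker_poly (theta tau : grindex d n) : {mpoly K[chart_dim tau]} :=
  plucker theta (generic_mx tau).

Definition plucker_deg (tau theta : grindex d n) : nat :=
  (msize (plucker_poly theta tau)).-1.

End Grassmannian.

(* Main.v *)
(* On the chart p_tau = 1 around e_tau the Richardson variety X_w^v is a cone Y,
   so its multiplicity at e_tau is the degree of the graded ring K[Y].  The
   monomials in the f_theta, theta running over the multichains of [v, w] that
   avoid tau and are comparable with tau, form a basis of K[Y]: they span by
   straightening, after multiplication by a high power of p_tau, and they are
   independent already on the matrices with support v_c <= i <= w_c in column c,
   where the diagonal term of each minor dominates.  Hence the Hilbert function h_w
   of K[Y] counts multichains weighted by deg_tau, and splitting off the factors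
   f_w gives
     h_w(k) - h_w(k - deg_tau(w)) = sum of the h_w'(k) - error,
   where w' runs over the boundary and the error, coming from the multichains that lie
   below two different w', grows with smaller degree.  Comparing leading
   coefficients of the cumulative Hilbert polynomials proves (1); (2) is the same
   argument for the opposite order. *)

From HB Require Import structures.
From mathcomp Require Import all_boot all_order all_algebra fingroup perm action.
From mathcomp Require Import boolp mpoly ring zify.
From mathcomp Require polyrcf.
Require Import Defs.

Set Implicit Arguments.
Unset Strict Implicit.
Unset Printing Implicit Defensive.

Import Order.TTheory GRing.Theory Num.Theory.
Local Open Scope ring_scope.

(** * Polynomials and Hilbert functions *)

Section EventuallyPolynomial.

Implicit Types (p q : {poly rat}) (h : nat -> nat).

(** Cumulative Hilbert polynomials are used because at an isolated point the Hilbert polynomial is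
    zero and the degree is a length instead. If the cumulative polynomial Q of X_w^v has degree s +
    1, its difference with step deg_tau(w) has leading coefficient deg_tau(w) (s + 1) lc(Q); the
    factor s + 1 turns s! into (s + 1)!, and deg_tau(w) is what remains on the left of (1). The
    comparison needs the degree of Q to grow by exactly one with each step of rank: then the
    boundary terms have equal degrees, their positive leading coefficients add up, and the error has
    smaller degree. This growth is proved in the same induction as the identity itself. That the
    counts are eventually polynomial is drawn from the ideal of the cone, through initial monomials
    and Dickson's lemma. The characteristic is arbitrary, while the antisymmetrized exchange
    identity repeats each term as often as the order of a stabilizer; the division takes place for a
    generic integer matrix, and coefficients 1 and -1 remain. Of the equations of Y, spanning uses
    only the vanishing of f_theta for theta outside [v, w]. *)

Lemma eq_poly_large p q k0 :
  (forall k, (k0 <= k)%N -> p.[k%:R] = q.[k%:R]) -> p = q.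
Proof.
move=> e; apply/eqP; rewrite -subr_eq0; apply/negPn/negP.
set r := p - q => rN0.
have rs : all (root r) [seq k%:R | k <- iota k0 (size r)].
  apply/allP => x /mapP [k]; rewrite mem_iota => /andP [k0k _] ->.
  by rewrite /root !hornerE e // subrr.
have := max_poly_roots rN0 rs; rewrite map_inj_uniq ?iota_uniq; last by move=> a b /eqP;
  rewrite eqr_nat => /eqP.
by rewrite size_map size_iota ltnn => /(_ isT).
Qed.

Lemma poly_gt0_large p : 0 < lead_coef p ->
  exists k0, forall k, (k0 <= k)%N -> 0 < p.[k%:R].
Proof.
move=> lp; have [x hx] := polyrcf.poly_pinfty_gt_lc lp.
exists (Num.bound `|x|) => k bk; apply: lt_le_trans lp (hx _ _).
apply: le_trans (ler_norm x) (ltW _).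
by apply: lt_le_trans (archi_boundP (normr_ge0 x)) _; rewrite ler_nat.
Qed.

Lemma lead_coef_gt0_large p k0 : p != 0 ->
  (forall k, (k0 <= k)%N -> 0 <= p.[k%:R]) -> 0 < lead_coef p.
Proof.
move=> pN0 pge0; rewrite lt_def lead_coef_eq0 pN0 leNgt; apply/negP => lp.
have [|k1 hk1] := @poly_gt0_large (- p); first by rewrite lead_coefN oppr_gt0.
have := hk1 (maxn k0 k1) (leq_maxr _ _); rewrite hornerN oppr_gt0 ltNge.
by rewrite pge0 // leq_maxl.
Qed.

Lemma size_poly_le_large p q k0 :
  (forall k, (k0 <= k)%N -> 0 <= p.[k%:R] <= q.[k%:R]) ->
  (size p <= size q)%N.
Proof.
move=> h; rewrite leqNgt; apply/negP => sqp.
have pN0 : p != 0 by rewrite -size_poly_gt0; apply: leq_ltn_trans sqp.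
have lp : 0 < lead_coef p.
  by apply: (lead_coef_gt0_large (k0 := k0)) => // k /h /andP[].
have ss : size (q - p) = size p by rewrite addrC size_polyDl size_polyN.
have : 0 < lead_coef (q - p).
  apply: (lead_coef_gt0_large (k0 := k0)) => [|k /h /andP[_]].
    by rewrite -size_poly_gt0 ss size_poly_gt0.
  by rewrite !hornerE subr_ge0.
rewrite addrC lead_coefDl ?size_polyN // lead_coefN oppr_gt0.
by move=> /(lt_trans lp); rewrite ltxx.
Qed.

(** Step 1 inverts the passage to cumulative sums; the step deg_tau(w) comes from splitting off one
    factor f_w. *)
Definition backward_diff (c : rat) p := p - (p \Po ('X - c%:P)).

Lemma backward_diffE c p x : (backward_diff c p).[x] = p.[x] - p.[x - c].
Proof. by rewrite /backward_diff !hornerE horner_comp !hornerE. Qed.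

Lemma size_backward_diff_lt c p : p != 0 -> (size (backward_diff c p) < size p)%N.
Proof.
move=> pN0; rewrite /backward_diff.
have sc : size (p \Po ('X - c%:P)) = size p by rewrite size_comp_poly2 // size_XsubC.
have spos : (0 < size p)%N by rewrite size_poly_gt0.
rewrite -(ltn_predK spos) ltnS; apply/leq_sizeP => j.
rewrite leq_eqVlt => /predU1P [<-|jp].
  rewrite coefB -/(lead_coef p) -[in X in _ - X]sc -/(lead_coef _).
  by rewrite lead_coef_comp ?size_XsubC // lead_coefXsubC expr1n mulr1 subrr.
have {}jp : (size p <= j)%N by rewrite -(ltn_predK spos).
by rewrite coefB !nth_default ?sc ?subr0.
Qed.

(** The difference of two (s + 1)-st powers factors as c times a sum of s + 1 monic polynomials of
    degree s. *)
Lemma coef_backward_diff_Xn c s : (backward_diff c 'X^(s.+1))`_s = c * s.+1%:R.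
Proof.
rewrite /backward_diff comp_Xn_poly subrXX.
have -> : 'X - ('X - c%:P) = c%:P by rewrite opprB addrC subrK.
rewrite coefCM coef_sum; congr (_ * _).
rewrite (eq_bigr (fun=> 1)) ?sumr_const ?card_ord // => i _.
have mi : 'X^(s.+1.-1 - i) * ('X - c%:P) ^+ i \is monic.
  by rewrite monicMr ?monicXn // monic_exp // monicXsubC.
have si : size ('X^(s.+1.-1 - i) * ('X - c%:P) ^+ i) = s.+1.
  rewrite size_monicM ?monicXn ?monic_neq0 ?monic_exp ?monicXsubC //.
  by rewrite size_polyXn size_exp_XsubC addSn addnS /= subnK // -ltnS.
by move: mi; rewrite monicE lead_coefE si => /eqP.
Qed.

(** Only the leading monomial reaches degree s: the remainder [r] has size at most s + 1, and a
    difference lowers the size again. *)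
Lemma size_lead_backward_diff c p s : c != 0 -> size p = s.+2 ->
  size (backward_diff c p) = s.+1 /\
  lead_coef (backward_diff c p) = c * s.+1%:R * lead_coef p.
Proof.
move=> cN0 sp.
have pN0 : p != 0 by rewrite -size_poly_gt0 sp.
have slt := size_backward_diff_lt c pN0; rewrite sp ltnS in slt.
have cf : (backward_diff c p)`_s = c * s.+1%:R * lead_coef p.
  pose r := p - lead_coef p *: 'X^(s.+1).
  have er : p = lead_coef p *: 'X^(s.+1) + r by rewrite addrC subrK.
  have -> : backward_diff c p =
      lead_coef p *: backward_diff c 'X^(s.+1) + backward_diff c r.
    rewrite {1}er /backward_diff comp_polyD comp_polyZ scalerBr opprD addrACA.
    by [].
  rewrite coefD coefZ coef_backward_diff_Xn mulrC.
  rewrite [X in _ + X]nth_default ?addr0 //.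
  have [-> |rN0] := eqVneq r 0; first by rewrite /backward_diff comp_poly0 subr0 size_poly0.
  rewrite -ltnS; apply: leq_trans (size_backward_diff_lt c rN0) _.
  apply/leq_sizeP => j; rewrite leq_eqVlt => /predU1P [<-|js].
    by rewrite coefB coefZ coefXn eqxx mulr1 lead_coefE sp subrr.
  by rewrite coefB coefZ coefXn (gtn_eqF js) mulr0 subr0 nth_default // sp.
have sN : (backward_diff c p)`_s != 0.
  by rewrite cf !mulf_neq0 // ?pnatr_eq0 // lead_coef_eq0.
have ss : size (backward_diff c p) = s.+1.
  apply/eqP; rewrite eqn_leq slt ltnNge; apply/negP => h.
  by rewrite nth_default ?eqxx in sN.
by split=> //; rewrite lead_coefE ss.
Qed.

(** Induction on the size: the monomial [q0] is scaled so that its difference has the leading term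
    of [p]. *)
Lemma antidifference p : exists q, backward_diff 1 q = p.
Proof.
have [n] := ubnP (size p); elim: n p => // n IH p; rewrite ltnS => sp.
have [->|pN0] := eqVneq p 0.
  by exists 0; rewrite /backward_diff comp_poly0 subrr.
have := size_poly_eq0 p; rewrite (negPf pN0); case e : (size p) => [//|s] _.
pose q0 := (lead_coef p / s.+1%:R) *: 'X^(s.+1) : {poly rat}.
have c0 : lead_coef p / s.+1%:R != 0.
  by rewrite mulf_neq0 ?invr_eq0 ?pnatr_eq0 ?lead_coef_eq0.
have sq0 : size q0 = s.+2 by rewrite size_scale // size_polyXn.
have lq0 : lead_coef q0 = lead_coef p / s.+1%:R.
  by rewrite lead_coefZ lead_coefXn mulr1.
have [sd ld] := size_lead_backward_diff (oner_neq0 _) sq0.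
have [q hq] : exists q, backward_diff 1 q = p - backward_diff 1 q0.
  apply: IH; apply: leq_trans sp; rewrite e ltnS; apply/leq_sizeP => j.
  rewrite leq_eqVlt => /predU1P [<-|js]; last by rewrite coefB !nth_default ?subrr ?e ?sd.
  rewrite coefB; have := ld; rewrite lead_coefE sd /= => ->.
  by rewrite lq0 lead_coefE e /= mul1r mulrC divfK ?subrr // pnatr_eq0.
exists (q + q0); move: hq; rewrite /backward_diff comp_polyD => hq.
by rewrite opprD addrACA hq subrK.
Qed.

Definition eventually_poly h :=
  exists p k0, forall k, (k0 <= k)%N -> p.[k%:R] = (h k)%:R.

Definition cumulative h (q : {poly rat}) := exists k0,
  forall k, (k0 <= k)%N -> q.[k%:R] = (\sum_(i < k.+1) h i)%N%:R.

Lemma cumulative_exists h : eventually_poly h -> exists q, cumulative h q.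
Proof.
move=> [p [k0 hp]]; have [q hq] := antidifference p.
(* The values of [h] before k0 need not follow p; the constant fits the antidifference to the true
   sum at k0. *)
pose c : rat := (\sum_(i < k0.+1) h i)%N%:R - q.[k0%:R].
exists (q + c%:P), k0 => k /subnKC <-; elim: (k - k0)%N => [|j IH].
  by rewrite addn0 hornerD hornerC /c addrC subrK.
rewrite addnS big_ord_recr natrD /= -IH !hornerD !hornerC -hp ?leqW ?leq_addr //.
rewrite -hq backward_diffE -natr1 addrK; ring.
Qed.

Lemma cumulative_uniq h q q' : cumulative h q -> cumulative h q' -> q = q'.
Proof.
move=> [k0 hq] [k1 hq']; apply: (@eq_poly_large _ _ (maxn k0 k1)) => k.
by rewrite geq_max => /andP [k0k k1k]; rewrite hq ?hq'.
Qed.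

(* Both cases of [graded_degree] read the same in terms of the cumulative
   Hilbert polynomial. *)
Definition cumulative_degree (q : {poly rat}) : rat :=
  lead_coef q * ((size q).-1)`!%:R.

Lemma graded_degree_cumulative h q :
  cumulative h q -> graded_degree h (cumulative_degree q).
Proof.
(* The threshold moves to k0 + 1 because [h k] is the difference of the sums up to k and up to k -
   1. *)
move=> [k0 hq]; exists (backward_diff 1 q), k0.+1; split=> [[//|k] k0k|].
  rewrite ltnS in k0k; have k0k1 := leqW k0k.
  rewrite backward_diffE -{2}natr1 addrK !hq //.
  by rewrite big_ord_recr natrD addrC addKr.
(* A constant [q] is the case of finite length, and the constant is that length. Otherwise the
   difference gains the factor by which the two factorials differ. *)
case e : (size q) => [|[|s]].
- move/eqP: e; rewrite size_poly_eq0 => /eqP q0.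
  have := hq k0 (leqnn _); rewrite q0 horner0 => <-.
  by rewrite /backward_diff comp_poly0 subrr eqxx /cumulative_degree lead_coef0 mul0r.
- have [a q0] : exists a, q = a%:P.
    by exists q`_0; apply: size1_polyC; rewrite e.
  rewrite /cumulative_degree e mulr1 q0 /backward_diff comp_polyC subrr eqxx.
  by rewrite -(hq k0) // q0 hornerC lead_coefC.
have [sd ld] := size_lead_backward_diff (oner_neq0 _) e.
have /negPf -> : backward_diff 1 q != 0 by rewrite -size_poly_eq0 sd.
rewrite ld sd /cumulative_degree e /= factS natrM; ring.
Qed.

Lemma graded_degree_uniq h c c' :
  graded_degree h c -> graded_degree h c' -> c = c'.
Proof.
move=> [p [k0 [hp ->]]] [p' [k1 [hp' ->]]].
have e : p = p'.
  apply: (@eq_poly_large _ _ (maxn k0 k1)) => k.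
  by rewrite geq_max => /andP [k0k k1k]; rewrite hp ?hp'.
rewrite -e; case: eqP => // p0; congr _%:R.
have h0 k : (k0 <= k)%N -> h k = 0%N.
  by move=> /hp; rewrite p0 horner0 => /esym/eqP; rewrite pnatr_eq0 => /eqP.
have h1 k : (k1 <= k)%N -> h k = 0%N.
  by move=> /hp'; rewrite -e p0 horner0 => /esym/eqP; rewrite pnatr_eq0 => /eqP.
have trunc a b : (forall k, (a <= k)%N -> h k = 0%N) -> (a <= b)%N ->
    (\sum_(k < b) h k = \sum_(k < a) h k)%N.
  move=> ha ab; rewrite -!(big_mkord xpredT) (big_cat_nat (n := a)) //=.
  rewrite -[RHS]addn0; congr (_ + _)%N.
  by rewrite big_nat_cond big1 // => i /andP[/andP[/ha]].
by case: (leqP k0 k1) => [/(trunc _ _ h0)|/ltnW/(trunc _ _ h1)] ->.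
Qed.

End EventuallyPolynomial.

(** * Counting the monomials outside a monomial ideal *)

Section MonomialCount.

Lemma eventually_poly_ext h h' k0 :
  (forall k, (k0 <= k)%N -> h k = h' k) -> eventually_poly h -> eventually_poly h'.
Proof.
move=> e [p [k1 hp]]; exists p, (maxn k0 k1) => k.
by rewrite geq_max => /andP [k0k k1k]; rewrite hp // e.
Qed.

Lemma eventually_polyD h h' :
  eventually_poly h -> eventually_poly h' ->
  eventually_poly (fun k => h k + h' k)%N.
Proof.
move=> [p [k0 hp]] [q [k1 hq]]; exists (p + q), (maxn k0 k1) => k.
by rewrite geq_max => /andP [k0k k1k]; rewrite hornerD hp // hq // natrD.
Qed.

Lemma eventually_poly0 : eventually_poly (fun=> 0%N).
Proof. by exists 0, 0%N => k _; rewrite horner0. Qed.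

Lemma eventually_poly_sum (h : nat -> nat -> nat) n :
  (forall a, eventually_poly (h a)) ->
  eventually_poly (fun k => \sum_(a < n) h a k)%N.
Proof.
move=> hh; elim: n => [|n IH].
  by apply: eventually_poly_ext eventually_poly0 => k _; rewrite big_ord0.
apply: eventually_poly_ext (eventually_polyD IH (hh n)) => k _.
by rewrite big_ord_recr.
Unshelve. all: exact: 0%N.
Qed.

Lemma eventually_poly_shift h a :
  eventually_poly h -> eventually_poly (fun k => h (k - a)%N).
Proof.
move=> [p [k0 hp]]; exists (p \Po ('X - a%:R%:P)), (k0 + a)%N => k ak.
have ak' : (a <= k)%N by apply: leq_trans ak; rewrite leq_addl.
rewrite horner_comp !hornerE -natrB // hp //.
by rewrite leq_subRL // addnC.
Qed.

Lemma eventually_poly_cumulative h :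
  eventually_poly h -> eventually_poly (fun k => \sum_(i < k.+1) h i)%N.
Proof. by move=> /cumulative_exists [q [k0 hq]]; exists q, k0. Qed.

Lemma nat_seq_argmin (g : nat -> nat) j :
  exists i, (j <= i)%N /\ forall i', (j <= i')%N -> (g i <= g i')%N.
Proof.
suff H v i : (j <= i)%N -> (g i < v)%N ->
    exists i, (j <= i)%N /\ forall i', (j <= i')%N -> (g i <= g i')%N.
  by apply: (H (g j).+1 j).
elim: v i => // v IH i ji; rewrite ltnS => gi.
have [[i' [ji' gi']]|no] := pselect (exists i', (j <= i')%N /\ (g i' < g i)%N).
  by apply: (IH i') => //; apply: leq_trans gi.
exists i; split=> // i' ji'; rewrite leqNgt; apply/negP => gi'.
by apply: no; exists i'.
Qed.

(** Each index minimizes g on the tail that starts after the previous index, so later values cannot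
    be smaller. *)
Lemma nondecreasing_subseq (g : nat -> nat) : exists phi : nat -> nat,
  (forall k, phi k < phi k.+1)%N /\ forall k, (g (phi k) <= g (phi k.+1))%N.
Proof.
have [A hA] := choice (nat_seq_argmin g).
pose phi := fix phi k := if k is k'.+1 then A (phi k').+1 else A 0%N.
have le_phi k : (phi k < phi k.+1)%N by have [] := hA (phi k).+1.
exists phi; split=> // -[|k] /=; first by apply: (hA 0%N).2.
have [_ h] := hA (phi k).+1; apply: h.
by apply: leq_trans (le_phi k) (ltnW (le_phi k.+1)).
Qed.

(** One coordinate at a time: a subsequence monotone in the head is thinned out to one that is also
    monotone in the tail. *)
Lemma dickson N (f : nat -> seq nat) : (forall i, size (f i) = N) ->
  exists phi : nat -> nat, (forall k, phi k < phi k.+1)%N /\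
    forall k, all2 leq (f (phi k)) (f (phi k.+1)).
Proof.
elim: N f => [|N IH] f sf.
  by exists id; split=> // k; rewrite (size0nil (sf k)) (size0nil (sf k.+1)).
have [phi [phi_inc le_phi]] := nondecreasing_subseq (fun i => head 0%N (f i)).
have [|psi [psi_inc le_psi]] := IH (fun i => behead (f (phi i))).
  by move=> i; rewrite size_behead sf.
have homo_phi : {homo phi : i j / (i < j)%N} by apply: homo_ltn => //; apply: ltn_trans.
exists (phi \o psi); split=> k /=; first exact: homo_phi.
have := le_psi k; have : (head 0 (f (phi (psi k))) <= head 0 (f (phi (psi k.+1))))%N.
  apply: (@homo_leq _ (fun i => head 0%N (f (phi i))) leq) => //.
    exact: leq_trans.
  exact: ltnW.
move: (sf (phi (psi k))) (sf (phi (psi k.+1))).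
by case: (f _) => // a s _; case: (f _) => // b t _ /= -> ->.
Qed.

Fixpoint exponents (N k : nat) : seq (seq nat) :=
  if N is N'.+1 then
    flatten [seq [seq a :: s | s <- exponents N' (k - a)%N] | a <- iota 0 k.+1]
  else if k == 0%N then [:: [::]] else [::].

Lemma exponentsS N k : exponents N.+1 k =
  flatten [seq [seq a :: s | s <- exponents N (k - a)%N] | a <- iota 0 k.+1].
Proof. by []. Qed.

Lemma mem_exponents N k s :
  (s \in exponents N k) = (size s == N) && (sumn s == k).
Proof.
elim: N k s => [|N IH] k s; last rewrite exponentsS.
  by case: s k => [|a s] [|k].
apply/flatten_mapP/andP.
  move=> [a]; rewrite mem_iota add0n ltnS => /= ak /mapP [t].
  by rewrite IH => /andP[/eqP st /eqP ht] -> /=; rewrite st ht eqxx subnKC.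
case: s => [[]//|a s] [/eqP [ss] /eqP]; rewrite [sumn _]/= => <-; exists a.
  by rewrite mem_iota /= add0n ltnS leq_addr.
by apply/mapP; exists s => //; rewrite IH ss addKn !eqxx.
Qed.

Lemma exponents_uniq N k : uniq (exponents N k).
Proof.
elim: N k => [|N IH] k; first by rewrite /=; case: eqP.
rewrite exponentsS.
have : uniq (iota 0 k.+1) by rewrite iota_uniq.
elim: (iota _ _) => //= a r IHr /andP [ar ur].
rewrite cat_uniq IHr // map_inj_uniq ?IH; last by move=> s t [].
rewrite andbT; apply/hasPn => s /flatten_mapP [b br] /mapP [t _ ->].
apply/negP => /mapP [t' _ [ba _]]; by rewrite -ba br in ar.
Qed.

(** [D] is the complement of a monomial ideal. Its slices by the first exponent decrease and are
    constant from some a0 on; the slices before a0 give shifted counts, the others a cumulative sum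
    of a single count. *)
Lemma count_exponents_poly N (D : pred (seq nat)) :
  (forall s t, size t = N -> all2 leq s t -> D t -> D s) ->
  eventually_poly (fun k => count D (exponents N k)).
Proof.
elim: N D => [|N IH] D downD.
  by exists 0, 1%N => -[|k] // _; rewrite horner0.
have down_cons a s t : size t = N -> all2 leq s t -> D (a :: t) -> D (a :: s).
  by move=> st le_st; apply: downD; rewrite /= ?st // leqnn.
(* If the slices never became constant, each level [al k] would have a witness that is lost at level
   [al k.+1]. Dickson's lemma finds a witness below a later one, and downward closure keeps it at
   the level where it was lost. *)
have [a0 stable] : exists a0, forall a s, (a0 <= a)%N -> size s = N ->
    D (a0 :: s) -> D (a :: s).
  apply: contrapT => /forallNP no.
  have step a0 : exists u : nat * seq nat,
      [/\ (a0 <= u.1)%N, size u.2 = N, D (a0 :: u.2) & ~~ D (u.1 :: u.2)].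
    have := no a0; move=> /existsNP [a /existsNP [s /not_implyP [a0a]]].
    by move=> /not_implyP [ss] /not_implyP [Da0 /negP Da]; exists (a, s).
  have [u hu] := choice step.
  pose al := fix al k := if k is k'.+1 then (u (al k')).1 else 0%N.
  have al_inc : {homo al : i j / (i <= j)%N}.
    apply: (@homo_leq _ al leq) => [//|j i l|k]; first exact: leq_trans.
    by have [] := hu (al k).
  have [|phi [phi_inc le_phi]] := @dickson N (fun k => (u (al k)).2).
    by move=> k; have [] := hu (al k).
  have le0 := le_phi 0%N; have lt0 := phi_inc 0%N.
  have [_ _ _ /negP] := hu (al (phi 0%N)); apply.
  have [_ s1 D1 _] := hu (al (phi 1%N)).
  apply: downD D1; first by rewrite /= s1.
  by rewrite /= le0 andbT -/(al (phi 0%N).+1) al_inc.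
have ev : eventually_poly (fun k =>
    \sum_(a < a0) count (fun s => D (val a :: s)) (exponents N (k - a)) +
    \sum_(j < (k - a0).+1) count (fun s => D (a0 :: s)) (exponents N j))%N.
  apply: eventually_polyD.
    apply: (@eventually_poly_sum
      (fun a k => count (fun s => D (a :: s)) (exponents N (k - a)))) => a.
    by apply: (@eventually_poly_shift (fun k => count _ (exponents N k)));
      apply: IH => s t; apply: down_cons.
  apply: (@eventually_poly_shift (fun k =>
    \sum_(j < k.+1) count (fun s => D (a0 :: s)) (exponents N j))%N).
  by apply: (eventually_poly_cumulative (IH _ _)) => s t; apply: down_cons.
apply: (eventually_poly_ext (k0 := a0) _ ev) => k a0k.
rewrite exponentsS count_flatten sumnE !big_map -/(index_iota 0 k.+1).
rewrite (@big_cat_nat _ _ _ a0) //=; last by rewrite leqW.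
rewrite [in RHS]big_mkord; congr (_ + _)%N.
  by apply: eq_bigr => a _; rewrite count_map.
rewrite -[X in (\sum_(X <= _ < _) _)%N]add0n big_addn subSn // big_mkord.
rewrite [RHS](reindex_inj rev_ord_inj) /=.
apply: eq_bigr => j _; rewrite count_map.
have -> : (k - (k - a0 - j + a0) = j)%N by have := ltn_ord j; lia.
apply: eq_in_count => s; rewrite mem_exponents => /andP [/eqP ss _] /=.
apply/idP/idP; first by apply: stable; rewrite ?leq_addl.
by apply: downD; rewrite /= ?ss // leq_addl /=; elim: (s) => //= a t ->; rewrite leqnn.
Qed.

End MonomialCount.

(** * Existence of the Hilbert polynomial *)

Section QuotientDim.

Variables (K : fieldType) (E : lmodType K).

Lemma quotient_dim_le (V W : E -> Prop) r r' :
  W 0 -> (forall x y, W x -> W y -> W (x + y)) ->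
  (forall c x, W x -> W (c *: x)) ->
  quotient_dim V W r -> quotient_dim V W r' -> (r' <= r)%N.
Proof.
move=> W0 WD WZ [b [_ span_b _]] [b' [Vb' _ free_b']]; rewrite leqNgt; apply/negP => rr'.
have [C hC] := choice (fun j => span_b (b' j) (Vb' j)).
(* With r < r' the rows of [A] are dependent, and a left kernel vector is a nontrivial relation
   among the [b'] modulo W. *)
pose A : 'M[K]_(r', r) := \matrix_(j, i) C j i.
have : (0 < \rank (kermx A))%N by rewrite mxrank_ker subn_gt0 (leq_ltn_trans (rank_leq_col A)).
rewrite lt0n mxrank_eq0 => /rowV0Pn [u /sub_kermxP uA uN0].
case/eqP: uN0; apply/rowP => j; rewrite mxE; apply: free_b' j.
have -> : \sum_j u 0 j *: b' j = \sum_j u 0 j *: (b' j - \sum_i C j i *: b i).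
  under [RHS]eq_bigr do rewrite scalerBr scaler_sumr.
  rewrite sumrB -[LHS]subr0; congr (_ - _); rewrite exchange_big big1 //= => i _.
  transitivity ((u *m A) 0 i *: b i); last by rewrite uA mxE scale0r.
  rewrite mxE scaler_suml; apply: eq_bigr => j _.
  by rewrite scalerA mxE.
by apply: (big_ind W) => // j _; apply: WZ.
Qed.

Lemma quotient_dim_uniq (V W : E -> Prop) r r' :
  W 0 -> (forall x y, W x -> W y -> W (x + y)) ->
  (forall c x, W x -> W (c *: x)) ->
  quotient_dim V W r -> quotient_dim V W r' -> r = r'.
Proof.
move=> W0 WD WZ h h'; apply/eqP; rewrite eqn_leq.
by rewrite (quotient_dim_le W0 WD WZ h' h) (quotient_dim_le W0 WD WZ h h').
Qed.

End QuotientDim.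

Section HilbertPolynomial.

Variables (K : fieldType) (N : nat).
Implicit Types (f g : {mpoly K[N]}) (I : {mpoly K[N]} -> Prop).

Definition homogeneous_ideal I := [/\ I 0,
  forall f g, I f -> I g -> I (f + g),
  forall f g, I g -> I (f * g)
  & forall k f, I f -> I (pihomog mdeg k f)].

Lemma mcoeff_pihomog k f m :
  (pihomog mdeg k f)@_m = if mdeg m == k then f@_m else 0.
Proof.
rewrite pihomogE linear_sum /=; case: ifP => mk.
  have [ms|ms] := boolP (m \in msupp f).
    rewrite big_mkcond (bigD1_seq m) ?msupp_uniq //= mk mcoeffZ mcoeffX eqxx mulr1.
    rewrite big1 ?addr0 // => m' /negPf m'm; case: ifP => // _.
    by rewrite mcoeffZ mcoeffX m'm mulr0.
  rewrite (memN_msupp_eq0 ms) big_seq_cond big1 // => m' /andP [m's _].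
  rewrite mcoeffZ mcoeffX; case: eqP => [e|]; last by rewrite mulr0.
  by rewrite e (negPf ms) in m's.
rewrite big1 // => m' /eqP m'k; rewrite mcoeffZ mcoeffX; case: eqP => [e|].
  by rewrite -e m'k eqxx in mk.
by rewrite mulr0.
Qed.

Definition initial_monomial I (m : 'X_{1..N}) :=
  exists f, [/\ I f, f != 0 & mlead f = m].

Definition exponent_mnm (s : seq nat) : 'X_{1..N} := [multinom nth 0%N s i | i < N].

Lemma exponent_mnmK (m : 'X_{1..N}) : exponent_mnm (val m) = m.
Proof. by apply/mnmP => i; rewrite mnmE (mnm_nth 0%N). Qed.

Lemma mdeg_exponent_mnm s : size s = N -> mdeg (exponent_mnm s) = sumn s.
Proof.
move=> ss; rewrite mdegE sumnE (big_nth 0%N) ss big_mkord.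
by apply: eq_bigr => i _; rewrite mnmE.
Qed.

Lemma exponent_mnm_inj s t :
  size s = N -> size t = N -> exponent_mnm s = exponent_mnm t -> s = t.
Proof.
move=> ss st /mnmP e; apply: (eq_from_nth (x0 := 0%N)); rewrite ss ?st // => i iN.
by have := e (Ordinal iN); rewrite !mnmE.
Qed.

Definition standard_exponent I (s : seq nat) : bool :=
  `[< ~ initial_monomial I (exponent_mnm s) >].

(* Macaulay: the monomials outside the initial ideal form a basis of the quotient. *)
Lemma initial_quotient_dim I k : homogeneous_ideal I ->
  quotient_dim (fun f => f \is k.-homog) I
    (count (standard_exponent I) (exponents N k)).
Proof.
move=> [I0 ID IM Ih].
have IZ c f : I f -> I (c *: f) by rewrite -mul_mpolyC; apply: IM.
pose s := [seq t <- exponents N k | standard_exponent I t].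
have us : uniq s by rewrite filter_uniq // exponents_uniq.
have ms t : (t \in s) = [&& standard_exponent I t, size t == N & sumn t == k].
  by rewrite mem_filter mem_exponents.
rewrite -size_filter -/s.
pose mn (i : 'I_(size s)) := exponent_mnm (nth [::] s i).
have mnI : injective mn.
  move=> i j; have := mem_nth [::] (ltn_ord i); have := mem_nth [::] (ltn_ord j).
  rewrite !ms => /and3P [_ /eqP sj _] /and3P [_ /eqP si _] /exponent_mnm_inj e.
  by apply/val_inj/eqP; rewrite /= -(nth_uniq [::] _ _ us) // e.
have mnP i : ~ initial_monomial I (mn i).
  by have := mem_nth [::] (ltn_ord i); rewrite ms => /and3P [/asboolP].
have mn_deg i : mdeg (mn i) = k.
  have := mem_nth [::] (ltn_ord i); rewrite ms => /and3P [_ /eqP si /eqP <-].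
  by rewrite mdeg_exponent_mnm.
have mn_onto m : mdeg m = k -> ~ initial_monomial I m -> exists i, m = mn i.
  move=> mk nI; have sm : (val m : seq nat) \in s.
    rewrite ms.
    have -> : standard_exponent I (val m) by apply/asboolP; rewrite exponent_mnmK.
    by rewrite size_tuple eqxx -mk -{2}[m]exponent_mnmK mdeg_exponent_mnm ?size_tuple ?eqxx.
  have im : (index (val m : seq nat) s < size s)%N by rewrite index_mem.
  by exists (Ordinal im); rewrite /mn /= nth_index // exponent_mnmK.
exists (fun i => 'X_[mn i]); split=> [i|f fk|c cI].
- by rewrite dhomogX; apply/eqP/mn_deg.
- suff H m0 g : g \is k.-homog -> (forall m, g@_m != 0 -> (m <= m0)%O) ->
      exists c, I (g - \sum_i c i *: 'X_[mn i]).
    apply: (H (mlead f)) => // m; rewrite -mcoeff_msupp.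
    exact: msupp_le_mlead.
  elim/(well_founded_ind (@ltom_wf N)): m0 g => m0 IH g gk gm0.
  (* It suffices to find an already reduced [u] with the same coefficient at m0, since [g - u] then
     has a smaller leading monomial. The choices are 0 if m0 has the wrong degree, the degree k part
     of an element of I if m0 is initial, and a multiple of the monomial m0 if it is standard. *)
  have reduce (u : {mpoly K[N]}) c0 : I (u - \sum_i c0 i *: 'X_[mn i]) ->
      u \is k.-homog -> u@_m0 = g@_m0 -> (forall m, u@_m != 0 -> (m <= m0)%O) ->
      exists c, I (g - \sum_i c i *: 'X_[mn i]).
    move=> Iu uk um0 ule; pose g' := g - u.
    have g'k : g' \is k.-homog by rewrite rpredB.
    have [c hc] : exists c, I (g' - \sum_i c i *: 'X_[mn i]).
      have [->|g'N0] := eqVneq g' 0.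
        by exists (fun=> 0); rewrite big1 ?subr0 // => i _; apply: scale0r.
      apply: (IH (mlead g')) => // [|m]; last first.
        by rewrite -mcoeff_msupp; apply: msupp_le_mlead.
      have := mlead_supp g'N0; rewrite mcoeff_msupp lt_neqAle => cN0.
      have -> : (mlead g' <= m0)%O.
        move: cN0; rewrite mcoeffB; have [g0|/gm0 //] := eqVneq g@_(mlead g') 0.
        by rewrite g0 sub0r oppr_eq0 => /ule.
      rewrite andbT; apply: contraNneq cN0 => ->.
      by rewrite mcoeffB um0 subrr.
    exists (fun i => c0 i + c i); under eq_bigr do rewrite scalerDl.
    have -> : g - \sum_i (c0 i *: 'X_[mn i] + c i *: 'X_[mn i]) =
      (u - \sum_i c0 i *: 'X_[mn i]) + (g' - \sum_i c i *: 'X_[mn i]).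
      by rewrite big_split /= /g'; ring.
    exact: ID.
  have [m0k|/eqP m0k] := eqVneq (mdeg m0) k; last first.
    apply: (reduce 0 (fun=> 0)); rewrite ?rpred0 ?mcoeff0 //; last first.
    - by move=> m; rewrite mcoeff0 eqxx.
    - by rewrite (dhomog_nemf_coeff gk) //; apply/eqP.
    by rewrite big1 ?subr0 // => i _; apply: scale0r.
  have [[u [Iu uN0 um0]]|nI] := pselect (initial_monomial I m0).
    pose c := g@_m0 / u@_m0; pose v := c *: pihomog mdeg k u.
    have um0N0 : u@_m0 != 0 by rewrite -um0 mleadc_eq0.
    apply: (reduce v (fun=> 0)).
    - rewrite big1 ?subr0 => [|i _]; last exact: scale0r.
      by apply: IZ; apply: Ih.
    - by rewrite rpredZ // pihomogP.
    - by rewrite mcoeffZ mcoeff_pihomog m0k eqxx divfK.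
    move=> m; rewrite mcoeffZ mcoeff_pihomog; case: ifP; last by rewrite mulr0 eqxx.
    rewrite mulf_eq0 negb_or => _ /andP [_]; rewrite -mcoeff_msupp -um0.
    exact: msupp_le_mlead.
  have [i0 mi0] := mn_onto _ m0k nI.
  apply: (reduce (g@_m0 *: 'X_[m0]) (fun i => g@_m0 * (i == i0)%:R)).
  - rewrite (bigD1 i0) //= eqxx mulr1 -mi0 big1 ?addr0 ?subrr // => i /negPf ->.
    by rewrite mulr0 scale0r.
  - by rewrite rpredZ // dhomogX; apply/eqP.
  - by rewrite mcoeffZ mcoeffX eqxx mulr1.
  move=> m; rewrite mcoeffZ mcoeffX; case: (m0 =P m) => [<-//|_].
  by rewrite mulr0 eqxx.
(* Independence: the leading monomial of a nonzero element of I is initial, while all monomials of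
   [g] are standard. *)
set g := \sum_i _ in cI.
have cg i : g@_(mn i) = c i.
  rewrite linear_sum /= (bigD1 i) //= mcoeffZ mcoeffX eqxx mulr1 big1 ?addr0 // => j ji.
  by rewrite mcoeffZ mcoeffX (inj_eq mnI) (negPf ji) mulr0.
suff g0 : g = 0 by move=> i; rewrite -cg g0 mcoeff0.
apply/eqP/negPn/negP => gN0.
have := mlead_supp gN0; rewrite mcoeff_msupp; case/negP; apply/eqP.
rewrite linear_sum /= big1 // => i _; rewrite mcoeffZ mcoeffX.
case: eqP => [e|]; last by rewrite mulr0.
by case: (mnP i); exists g.
Qed.

(** Multiples of initial monomials are initial, so the standard exponents are downward closed and
    their count is eventually polynomial. *)
Lemma hilbert_poly_exists I (h : nat -> nat) : homogeneous_ideal I ->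
  (forall k, quotient_dim (fun f => f \is k.-homog) I (h k)) ->
  eventually_poly h.
Proof.
move=> hI hq; have [I0 ID IM Ih] := hI.
have IZ c f : I f -> I (c *: f) by rewrite -mul_mpolyC; apply: IM.
have : eventually_poly (fun k => count (standard_exponent I) (exponents N k)).
  apply: count_exponents_poly => s t st le_st /asboolP nI; apply/asboolP.
  move=> [f [If fN0 fs]]; apply: nI; exists ('X_[exponent_mnm t - exponent_mnm s] * f).
  have XN0 : 'X_[exponent_mnm t - exponent_mnm s] != 0 :> {mpoly K[N]}.
    by rewrite -msize_poly_eq0 msizeX.
  split; [exact: IM|by rewrite mulf_neq0|].
  rewrite mleadM // mleadXm fs submK //; apply/mnm_lepP => i; rewrite !mnmE.
  elim: s t (val i) le_st {st fs XN0 f If fN0} => [|a s IH] [|b t] [|j] //=.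
    by case/andP.
  by case/andP => _; apply: IH.
apply: (eventually_poly_ext (k0 := 0%N)) => k _.
by apply: quotient_dim_uniq (initial_quotient_dim k hI) (hq k).
Qed.

End HilbertPolynomial.

(** * Multiplicity at the vertex of a cone *)

Section ConeMultiplicity.

Variables (K : closedFieldType) (N : nat) (X : ('I_N -> K) -> Prop).
Hypothesis X0 : X (fun=> 0).
Hypothesis X_cone : forall t z, t != 0 -> X z -> X (fun i => t * z i).

Implicit Types (f g : {mpoly K[N]}) (k : nat).

Definition vanishing f := forall z, X z -> f.@[z] = 0.

Local Notation P := (fun _ : 'I_N => (0 : K)).
Local Notation A := (local_ring X P).
Local Notation germ := (@LocalRing.germ K N X P).
Local Notation maxid := (@nonunits A).

(** Along the line through z, f is a polynomial in t whose coefficients are the values at z of its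
    homogeneous components; over an infinite field it is zero once it vanishes for all t != 0. *)
Lemma vanishing_homogeneous : homogeneous_ideal vanishing.
Proof.
split.
- by move=> z _; rewrite meval0.
- by move=> f g hf hg z Xz; rewrite mevalD hf ?hg // addr0.
- by move=> f g hg z Xz; rewrite mevalM hg // mulr0.
move=> k f hf z Xz.
pose p : {poly K} :=
  \sum_(m <- msupp f) (f@_m * \prod_i z i ^+ m i) *: 'X^(mdeg m).
have pE t : p.[t] = f.@[fun i => t * z i].
  rewrite /p horner_sum mevalE; apply: eq_bigr => m _.
  rewrite hornerZ hornerXn -mulrA; congr (_ * _); rewrite mdegE -prodrXr -big_split.
  by apply: eq_bigr => i _ /=; rewrite exprMn mulrC.
have p0 : p = 0.
  apply/eqP/negPn/negP => pN0.
  (* The factor ['X] forces the nonroot t to be nonzero, as the cone property demands. *)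
  have /closed_nonrootP [t] : 'X * p != 0 by rewrite mulf_neq0 // polyX_eq0.
  rewrite /root hornerM hornerX pE; case/eqP.
  by have [->|tN0] := eqVneq t 0; rewrite ?mul0r // hf ?mulr0 //; apply: X_cone.
have := congr1 (fun q : {poly K} => q`_k) p0.
rewrite /p coef_sum coef0 => <-; rewrite pihomogE linear_sum /= big_mkcond.
apply: eq_bigr => m _; rewrite coefZ coefXn eq_sym.
by case: eqP => _; rewrite ?mulr0 // mulr1 mevalZ mevalX.
Qed.

Definition order_ge k f := forall m, (mdeg m < k)%N -> f@_m = 0.

Lemma order_geD k f g : order_ge k f -> order_ge k g -> order_ge k (f + g).
Proof. by move=> hf hg m mk; rewrite mcoeffD hf ?hg ?addr0. Qed.

Lemma order_geM k l f g : order_ge k f -> order_ge l g -> order_ge (k + l) (f * g).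
Proof.
move=> hf hg m mkl; apply: contrapT => /eqP; rewrite -mcoeff_msupp.
move=> /msuppM_le /allpairsP [[m1 m2] /= []]; rewrite !mcoeff_msupp => f1 g2 e.
have [h1|h1] := ltnP (mdeg m1) k; first by rewrite hf ?eqxx in f1.
have [h2|h2] := ltnP (mdeg m2) l; first by rewrite hg ?eqxx in g2.
by move: mkl; rewrite e mdegD ltnNge leq_add.
Qed.

Lemma order_ge0 f : order_ge 0 f. Proof. by []. Qed.

Lemma mnm_neq0_ex (m : 'X_{1..N}) : m != 0%MM -> exists i, m i != 0%N.
Proof.
move=> mN0; apply: contrapT => no; case/eqP: mN0; apply/mnmP => i.
by rewrite mnm0E; apply/eqP/negPn/negP => mi; apply: no; exists i.
Qed.

Lemma meval_origin f : f.@[P] = f@_0%MM.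
Proof.
rewrite [in RHS](mpolyE f) linear_sum mevalE /=; apply: eq_bigr => m _.
rewrite mcoeffZ mcoeffX; congr (_ * _).
have [->|/mnm_neq0_ex [i mi]] := eqVneq m 0%MM.
  by rewrite big1 // => i _; rewrite mnm0E expr0.
by rewrite (bigD1 i) //= expr0n (negPf mi) mul0r.
Qed.

Lemma order_ge1 f : f.@[P] = 0 -> order_ge 1 f.
Proof. by rewrite meval_origin => f0 m; rewrite ltnS leqn0 mdeg_eq0 => /eqP ->. Qed.

(** The sum of the ideal of X and the k-th power of the ideal of the variables: by [ideal_pow_germ],
    the numerators of the elements of m^k. *)
Definition low_vanishing k f :=
  exists f1 f2, [/\ f = f1 + f2, vanishing f1 & order_ge k f2].

Lemma low_vanishingD k f g :
  low_vanishing k f -> low_vanishing k g -> low_vanishing k (f + g).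
Proof.
have [_ ID _ _] := vanishing_homogeneous.
move=> [f1 [f2 [-> hf1 hf2]]] [g1 [g2 [-> hg1 hg2]]].
exists (f1 + g1), (f2 + g2); split; [by rewrite addrACA|exact: ID|exact: order_geD].
Qed.

Lemma low_vanishingM k l f g :
  order_ge k f -> low_vanishing l g -> low_vanishing (k + l) (f * g).
Proof.
have [_ _ IM _] := vanishing_homogeneous.
move=> hf [g1 [g2 [-> hg1 hg2]]]; exists (f * g1), (f * g2).
by split; [rewrite mulrDr|exact: IM|exact: order_geM].
Qed.

Lemma low_vanishing_cancel k u f :
  u.@[P] != 0 -> low_vanishing k (u * f) -> low_vanishing k f.
Proof.
move=> uN0 huf; pose c := u.@[P].
(* The geometric series inverts u modulo (x)^k. *)
pose e := 1 - c^-1 *: u; pose u' := c^-1 *: \sum_(i < k) e ^+ i.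
have ek : order_ge k (e ^+ k).
  have e1 : order_ge 1 e.
    by apply: order_ge1; rewrite mevalB meval1 mevalZ mulVf // subrr.
  elim: k {huf u'} => [|j IH]; first exact: order_ge0.
  by rewrite exprS -add1n; apply: order_geM.
have -> : f = u' * (u * f) + e ^+ k * f.
  have -> : e ^+ k = 1 - u' * u.
    have := subrX1 e k => /eqP; rewrite subr_eq => /eqP ->.
    have -> : e - 1 = - (c^-1 *: u) by rewrite /e addrC addKr.
    by rewrite mulNr addrC /u' -!scalerAl [u * _]mulrC.
  ring.
apply: low_vanishingD.
  by rewrite -[k]add0n; apply: low_vanishingM huf; exact: order_ge0.
exists 0, (e ^+ k * f); split; first by rewrite add0r.
- by move=> z _; rewrite meval0.
- by rewrite -[X in order_ge X]addn0; apply: order_geM.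
Qed.

Lemma germ_low_vanishing k f g f' g' : g.@[P] != 0 -> g'.@[P] != 0 ->
  germ f g = germ f' g' -> low_vanishing k f -> low_vanishing k f'.
Proof.
move=> gP gP' /(LocalRing.germ_eqP _ _ _ gP gP') [h [hP hX]] hf.
apply: (@low_vanishing_cancel _ (h * g)); first by rewrite mevalM mulf_neq0.
have -> : h * g * f' = (h * g') * f - h * (f * g' - f' * g) by ring.
apply: low_vanishingD; first by rewrite -[k]add0n; apply: low_vanishingM hf;
  exact: order_ge0.
exists (- (h * (f * g' - f' * g))), 0; split; first by rewrite addr0.
- by move=> z /hX; rewrite mevalN => ->; rewrite oppr0.
- by move=> m _; rewrite mcoeff0.
Qed.

Lemma one_evalP : (1 : {mpoly K[N]}).@[P] != 0.
Proof. by rewrite meval1 oner_neq0. Qed.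

Lemma germDE f g f' g' : g.@[P] != 0 -> g'.@[P] != 0 ->
  germ f g + germ f' g' = germ (f * g' + f' * g) (g * g') :> A.
Proof. exact: LocalRing.germD. Qed.

Lemma germME f g f' g' : g.@[P] != 0 -> g'.@[P] != 0 ->
  germ f g * germ f' g' = germ (f * f') (g * g') :> A.
Proof. exact: LocalRing.germM. Qed.

Lemma germ1E : (1 : A) = germ 1 1.
Proof. by rewrite -mpolyC1. Qed.

Lemma germ0E : (0 : A) = germ 0 1.
Proof. by rewrite -mpolyC0. Qed.

(** The origin lies on X, so an identity in the local ring may be evaluated there. *)
Lemma nonunit_germ f g : g.@[P] != 0 -> maxid (germ f g) <-> f.@[P] = 0.
Proof.
move=> gP; split=> [nu|f0 [b]].
  apply/eqP/negPn/negP => fP; apply: nu; exists (germ g f).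
  rewrite germME // germ1E; apply: LocalRing.germ_eq; rewrite ?one_evalP //.
    by rewrite mevalM mulf_neq0.
  by rewrite mulr1 mul1r mulrC.
have [f' [g' [gP' ->]]] := LocalRing.germP b.
rewrite germME // germ1E.
have gg : (g * g').@[P] != 0 by rewrite mevalM mulf_neq0.
move=> /(LocalRing.germ_eqP _ _ _ gg one_evalP) [h [hP /(_ _ X0)]];
  rewrite mevalM mevalB !mevalM f0 meval1.
by move/eqP;
  rewrite mul0r mul0r mul1r sub0r mulrN oppr_eq0 !mulf_eq0 (negPf hP) (negPf gP) (negPf gP').
Qed.

Lemma ideal_prodD (R : comPzRingType) (I J : R -> Prop) a b :
  ideal_prod I J a -> ideal_prod I J b -> ideal_prod I J (a + b).
Proof.
move=> [r [x [y [hxy ->]]]] [s [x' [y' [hxy' ->]]]].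
exists (r + s)%N, (fun i => match split i with inl j => x j | inr j => x' j end),
  (fun i => match split i with inl j => y j | inr j => y' j end); split.
  by move=> i; case: (split i).
rewrite big_split_ord /=; congr (_ + _); apply: eq_bigr => i _.
  by rewrite (unsplitK (inl i)).
by rewrite (unsplitK (inr i)).
Qed.

Lemma ideal_powD (R : comPzRingType) (I : R -> Prop) k a b :
  ideal_pow I k a -> ideal_pow I k b -> ideal_pow I k (a + b).
Proof. by case: k => // k; apply: ideal_prodD. Qed.

Lemma ideal_pow_sum (R : comPzRingType) (I : R -> Prop) k
    (T : eqType) (r : seq T) (F : T -> R) :
  (forall i, i \in r -> ideal_pow I k (F i)) -> ideal_pow I k (\sum_(i <- r) F i).
Proof.
move=> h; rewrite big_seq; apply: (big_ind (ideal_pow I k)) => //.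
- case: k {h} => // k; exists 0%N, (fun=> 0), (fun=> 0).
  by split=> [[]//|]; rewrite big_ord0.
- exact: ideal_powD.
Qed.

Lemma ideal_powM (R : comPzRingType) (I : R -> Prop) k a b :
  ideal_pow I k b -> ideal_pow I k (a * b).
Proof.
elim: k b => // k IH b [r [x [y [hxy ->]]]]; rewrite mulr_sumr.
exists r, x, (fun i => a * y i); split; last first.
  by apply: eq_bigr => i _; rewrite mulrCA.
by move=> i; have [hx hy] := hxy i; split=> //; apply: IH.
Qed.

Lemma germ_mnm_pow k (m : 'X_{1..N}) : (k <= mdeg m)%N ->
  ideal_pow maxid k (germ 'X_[m] 1).
Proof.
elim: k m => // k IH m km.
have [i mi] : exists i, m i != 0%N.
  by apply: mnm_neq0_ex; apply: contraTneq km => ->; rewrite mdeg0.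
have em : m = (U_(i) + (m - U_(i)))%MM.
  by rewrite addmC submK //; apply/mnm_lepP => j; rewrite mnm1E; case: eqP => // <-;
    rewrite lt0n.
have km' : (k <= mdeg (m - U_(i)))%N.
  by move: km; rewrite {1}em mdegD mdeg1.
exists 1%N, (fun=> germ 'X_i 1), (fun=> germ 'X_[m - U_(i)] 1); split.
  move=> _; split; last exact: IH.
  by apply/(nonunit_germ _ one_evalP); rewrite mevalXU.
by rewrite big_ord1 germME ?one_evalP // -mpolyXD -em mulr1.
Qed.

(** Forwards, [germ_low_vanishing] makes the choice of the representing fraction harmless.
    Backwards, the summand in the ideal of X has zero germ, and the other is a combination of
    monomials of degree at least k. *)
Lemma ideal_pow_germ k f g : g.@[P] != 0 ->
  ideal_pow maxid k (germ f g) <-> low_vanishing k f.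
Proof.
move=> gP; split.
  suff H a : ideal_pow maxid k a -> exists f g,
      [/\ g.@[P] != 0, a = germ f g & low_vanishing k f].
    by move=> /H [f' [g' [gP' e hf']]]; apply: germ_low_vanishing hf'; last exact: esym e.
  elim: k a => [|k IH] a.
    have [f' [g' [gP' ->]]] := LocalRing.germP a; exists f', g'; split=> //.
    exists 0, f'; split; [by rewrite add0r| |exact: order_ge0].
    by move=> z _; rewrite meval0.
  move=> [r [x [y [hxy ->]]]].
  apply: (big_ind (fun a : A => exists f g,
      [/\ g.@[P] != 0, a = germ f g & low_vanishing k.+1 f])).
  - exists 0, 1; split; [exact: one_evalP|exact: germ0E|].
    by exists 0, 0; split=> [|z _|m _]; rewrite ?addr0 ?meval0 ?mcoeff0.
  - move=> _ _ [f1 [g1 [g1P -> h1]]] [f2 [g2 [g2P -> h2]]].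
    exists (f1 * g2 + f2 * g1), (g1 * g2); split; first by rewrite mevalM mulf_neq0.
      exact: germDE.
    by apply: low_vanishingD; rewrite mulrC -[k.+1]add0n; apply: low_vanishingM => //;
      exact: order_ge0.
  move=> i _; have [] := hxy i; have [f1 [g1 [g1P ->]]] := LocalRing.germP (x i).
  move=> /(nonunit_germ _ g1P) f1P /IH [f2 [g2 [g2P -> h2]]].
  exists (f1 * f2), (g1 * g2); split; first by rewrite mevalM mulf_neq0.
    exact: germME.
  by rewrite -add1n; apply: low_vanishingM => //; apply: order_ge1.
move=> [f1 [f2 [-> hf1 hf2]]].
have -> : germ (f1 + f2) g = germ 1 g * germ f2 1 :> A.
  rewrite germME ?one_evalP // mul1r mulr1; apply/LocalRing.germ_eqP => //.
  exists 1; split; first exact: one_evalP.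
  by move=> z Xz; rewrite mul1r mevalB !mevalM mevalD hf1 // add0r subrr.
apply: ideal_powM.
have -> : germ f2 1 = \sum_(m <- msupp f2) germ (f2@_m)%:MP 1 * germ 'X_[m] 1.
  rewrite {1}[f2]mpolyE; elim: (msupp f2) => [|m s IH].
    by rewrite !big_nil -germ0E.
  rewrite !big_cons -IH germME ?one_evalP // germDE ?mevalM ?mulf_neq0 ?one_evalP //.
  by rewrite !mulr1 mul_mpolyC.
apply: ideal_pow_sum => m ms; apply: ideal_powM; apply: germ_mnm_pow.
rewrite leqNgt; apply/negP => mk; move: ms; rewrite mcoeff_msupp hf2 ?eqxx //.
Qed.

Lemma germ_sum r (c : 'I_r -> K) (b : 'I_r -> {mpoly K[N]}) :
  \sum_i c i *: (germ (b i) 1 : A) = germ (\sum_i c i *: b i) 1.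
Proof.
elim/big_rec2: _ => [|i x y _ ->]; first exact: esym germ0E.
rewrite -mul_mpolyC.
have -> : c i *: (germ (b i) 1 : A) = germ (c i)%:MP 1 * germ (b i) 1 by [].
by rewrite germME ?one_evalP // germDE ?mulr1 ?one_evalP.
Qed.

Lemma dhomog_order_ge k f : f \is k.-homog -> order_ge k f.
Proof. by move=> fk m mk; rewrite (dhomog_nemf_coeff fk) // ltn_eqF. Qed.

(** The associated graded ring at the vertex is the coordinate ring of the cone itself: a basis of
    its degree k part is a basis of m^k / m^(k+1). *)
Lemma cone_quotient_dim k r :
  quotient_dim (fun f => f \is k.-homog) vanishing r ->
  quotient_dim (ideal_pow maxid k) (ideal_pow maxid k.+1) r.
Proof.
have [I0 ID IM Ih] := vanishing_homogeneous.
move=> [b [bk span_b free_b]]; exists (fun i => germ (b i) 1); split.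
- move=> i; apply/(ideal_pow_germ _ _ one_evalP); exists 0, (b i).
  by rewrite add0r; split=> //; apply: dhomog_order_ge.
- move=> x; have [f [g [gP ->]]] := LocalRing.germP x.
  move=> /(ideal_pow_germ _ _ gP) [f1 [f2 [-> hf1 hf2]]].
  have [c hc] := span_b (pihomog mdeg k f2) (pihomogP _ _ _).
  (* Modulo the maximal ideal the denominator is the constant g(0), hence the division. *)
  exists (fun i => c i / g.@[P]); rewrite germ_sum.
  set s := \sum_i _ *: _.
  have sk : s \is k.-homog by apply: rpred_sum => i _; rewrite rpredZ.
  have gs : g.@[P] *: s = \sum_i c i *: b i.
    rewrite /s scaler_sumr; apply: eq_bigr => i _.
    by rewrite scalerA mulrC divfK.
  have -> : germ (f1 + f2) g - germ s 1 = germ (f1 + f2 - g * s) g :> A.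
    have -> : - (germ s 1 : A) = germ (- s) 1 by exact: LocalRing.germN one_evalP.
    by rewrite germDE ?one_evalP // !mulr1 mulNr [s * g]mulrC.
  apply/(ideal_pow_germ _ _ gP).
  exists (f1 + (pihomog mdeg k f2 - \sum_i c i *: b i)),
    (f2 - pihomog mdeg k f2 + (g.@[P]%:MP - g) * s).
  split; [|exact: ID|].
    by rewrite mulrBl mul_mpolyC gs; ring.
  apply: order_geD.
    move=> m; rewrite ltnS leq_eqVlt mcoeffB mcoeff_pihomog => /predU1P [->|mk].
      by rewrite eqxx subrr.
    by rewrite hf2 // (ltn_eqF mk) subr0.
  rewrite -add1n; apply: order_geM; last exact: dhomog_order_ge.
  by apply: order_ge1; rewrite mevalB mevalC subrr.
move=> c; rewrite germ_sum => /(ideal_pow_germ _ _ one_evalP) [f1 [f2 [e hf1 hf2]]].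
apply: free_b; rewrite -(@pihomog_dE _ _ mdeg k (\sum_i _)); last first.
  by apply: rpred_sum => i _; rewrite rpredZ.
rewrite e raddfD /=.
have -> : pihomog mdeg k f2 = 0.
  apply/mpolyP => m; rewrite mcoeff_pihomog mcoeff0; case: eqP => // mk.
  by rewrite hf2 // mk.
by rewrite addr0; apply: Ih.
Qed.

(** [mult] takes its value by choice; uniqueness of the quotient dimensions and of the degree pins
    it down. *)
Lemma mult_cone (h : nat -> nat) c :
  (forall k, quotient_dim (fun f => f \is k.-homog) vanishing (h k)) ->
  graded_degree h c -> mult X P = c.
Proof.
move=> hh hc.
have hX : hilbert_function X P h by move=> k; apply: cone_quotient_dim.
rewrite /mult; case: pselect => [ex|[]]; last by exists c, h.
case: (cid ex) => c' [h' [hX' hc']] /=; apply: graded_degree_uniq hc' _.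
suff -> : h' = h by [].
apply/funext => k; apply: quotient_dim_uniq (hX' k) (hX k).
- rewrite -(big_nil 0 +%R xpredT (fun x : A => x)).
  by apply: ideal_pow_sum.
- exact: ideal_powD.
- by move=> a x; apply: ideal_powM.
Qed.

Lemma cone_eventually_poly (h : nat -> nat) :
  (forall k, quotient_dim (fun f => f \is k.-homog) vanishing (h k)) ->
  eventually_poly h.
Proof. exact: hilbert_poly_exists vanishing_homogeneous. Qed.

End ConeMultiplicity.

(** * Counting multichains *)

Section Multichains.

Variables (T : finType) (le : rel T) (tau : T) (low : pred T).
Variables (rk : T -> nat) (delta : T -> nat).
Hypotheses (le_refl : reflexive le) (le_anti : antisymmetric le)
  (le_trans : transitive le).
Hypothesis rk_mono : forall u w, le u w -> u != w -> (rk u < rk w)%N.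
Hypothesis coverP : forall u w, le u w -> u != w ->
  exists w', [/\ le u w', le w' w, w' != w & (rk w').+1 = rk w].
Hypothesis delta_gt0 : forall u, u != tau -> (0 < delta u)%N.

Implicit Types (a : {ffun T -> nat}) (u w : T).

(** [a] gives multiplicities. Only the upper bound w varies in the recursion, so the lower bound is
    a fixed predicate [low]; with the reversed order the same definition serves for part (2). *)
Definition multichain w a : bool :=
  [forall u, (a u != 0%N) ==>
     (u != tau) && (le u tau && low u || le tau u && le u w)] &&
  [forall u, forall u', (a u != 0%N) && (a u' != 0%N) ==> le u u' || le u' u].

Lemma multichainP w a : reflect
  ((forall u, a u != 0%N -> u != tau /\ (le u tau /\ low u \/ le tau u /\ le u w)) /\
   (forall u u', a u != 0%N -> a u' != 0%N -> le u u' \/ le u' u))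
  (multichain w a).
Proof.
apply: (iffP andP) => [[/forallP h1 /forallP h2]|[h1 h2]]; split.
- move=> u /(implyP (h1 u)) /andP [uN /orP [/andP [? ?]|/andP [? ?]]]; split=> //.
    by left.
  by right.
- move=> u u' au au'; have /forallP/(_ u')/implyP := h2 u.
  by rewrite au au' => /(_ isT) /orP.
- apply/forallP => u; apply/implyP => /h1 [-> [[-> ->]|[-> ->]]] //.
  by rewrite orbT.
- apply/forallP => u; apply/forallP => u'; apply/implyP => /andP [au au'].
  exact/orP/h2.
Qed.

Definition weight a : nat := (\sum_u a u * delta u)%N.

(** Bounding the multiplicities by k loses nothing, as every element other than tau has weight at
    least 1. *)
Definition multichains w k : seq {ffun T -> nat} :=
  [seq a <- [seq [ffun u => val (b u)] | b : {ffun T -> 'I_k.+1}] |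
    multichain w a && (weight a == k)].

Lemma mem_multichains w k a :
  (a \in multichains w k) = multichain w a && (weight a == k).
Proof.
rewrite mem_filter andbC; case e : (multichain w a && _); rewrite ?andbF // andbT;
  move/andP: e => [ca /eqP wa].
have ak u : (a u < k.+1)%N.
  have [->//|au] := eqVneq (a u) 0%N.
  have [/(_ u au) [/delta_gt0 du _] _] := multichainP _ _ ca.
  rewrite ltnS -wa /weight (bigD1 u) //=; apply: leq_trans (leq_addr _ _).
  by rewrite leq_pmulr.
apply/mapP; exists [ffun u => Ordinal (ak u)]; first by rewrite mem_enum.
by apply/ffunP => u; rewrite !ffunE.
Qed.

Lemma multichains_uniq w k : uniq (multichains w k).
Proof.
rewrite filter_uniq // map_inj_uniq ?enum_uniq // => b b' /ffunP e.
by apply/ffunP => u; have := e u; rewrite !ffunE => /val_inj.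
Qed.

Definition multichain_count w k := size (multichains w k).

Definition incr w a : {ffun T -> nat} := [ffun u => a u + (u == w)]%N.

Lemma weight_incr w a : weight (incr w a) = (weight a + delta w)%N.
Proof.
rewrite /weight; under eq_bigr do rewrite ffunE mulnDl.
rewrite big_split /=; congr (_ + _)%N; rewrite (bigD1 w) //= eqxx mul1n big1 ?addn0 //.
by move=> u /negPf ->.
Qed.

Lemma multichain_incr w a : le tau w -> w != tau ->
  multichain w (incr w a) = multichain w a.
Proof.
move=> tw wN.
have supp u : (incr w a u != 0%N) = (a u != 0%N) || (u == w).
  by rewrite ffunE addn_eq0 negb_and eqb0 negbK.
apply/multichainP/multichainP => -[h1 h2]; split.
- by move=> u au; apply: h1; rewrite supp au.
- by move=> u u' au au'; apply: h2; rewrite supp ?au ?au'.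
- move=> u; rewrite supp => /orP [/h1//|/eqP ->]; split=> //; by right.
have le_w u : a u != 0%N -> le u w.
  by move=> /h1 [_ [[ut _]|[]//]]; apply: le_trans ut tw.
move=> u u'; rewrite !supp => /orP [au|/eqP ->] /orP [au'|/eqP ->].
- exact: h2.
- by left; apply: le_w.
- by right; apply: le_w.
- by left.
Qed.

(** The bound w is comparable with every element of a multichain, so adding a copy of w is a
    bijection onto the multichains that contain w. *)
Lemma multichain_count_rec w k : le tau w -> w != tau ->
  multichain_count w k =
  (count (fun a => a w == 0%N) (multichains w k) +
   (if delta w <= k then multichain_count w (k - delta w) else 0))%N.
Proof.
move=> tw wN; rewrite /multichain_count -(count_predC (fun a => a w == 0%N)).
congr (_ + _)%N; case: leqP => wk; last first.
  apply/eqP; rewrite -leqn0 leqNgt -has_count; apply/hasPn => a.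
  rewrite mem_multichains => /andP [_ /eqP wa] /=; rewrite negbK.
  rewrite eqn0Ngt; apply/negP => aw; move: wk; rewrite -wa ltnNge.
  by rewrite /weight (bigD1 w) //= (leq_trans _ (leq_addr _ _)) // leq_pmull.
rewrite -size_filter -[RHS](size_map (incr w)); apply: perm_size; apply: uniq_perm.
- by rewrite filter_uniq // multichains_uniq.
- rewrite map_inj_uniq ?multichains_uniq // => a b /ffunP e.
  by apply/ffunP => u; have := e u; rewrite !ffunE => /addIn.
move=> a; rewrite mem_filter /=; apply/andP/mapP.
  rewrite mem_multichains => -[aw /andP [ca /eqP wa]];
    pose b : {ffun T -> nat} := [ffun u => a u - (u == w)]%N.
  have ab : a = incr w b.
    apply/ffunP => u; rewrite !ffunE subnK //.
    by case: eqP => // ->; rewrite lt0n.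
  exists b => //; rewrite mem_multichains -(multichain_incr b tw wN) -ab ca /=.
  by rewrite -wa ab weight_incr addnK.
move=> [b]; rewrite mem_multichains => /andP [cb /eqP wb] ->.
by rewrite mem_multichains ffunE eqxx addn1 multichain_incr // cb weight_incr wb subnK //=.
Qed.

(** [u] is the largest element of the support above tau, or tau if there is none; it is the least
    upper bound from which [a] is admissible. *)
Lemma multichain_top w a : le tau w -> multichain w a -> a w = 0%N -> w != tau ->
  exists u, [/\ le tau u, le u w, u != w, multichain u a
    & forall w', le tau w' -> multichain w' a -> le u w'].
Proof.
move=> tw ca aw wN; have [h1 h2] := multichainP _ _ ca.
have [|no] := pickP [pred u | (a u != 0%N) && le tau u].
  move=> u0 u0P; case: (arg_maxnP rk u0P) => u /= /andP [au tu] max_u.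
  have u_not_low : ~ le u tau.
    by move=> ut; have [/eqP[]] := h1 u au; apply: le_anti; rewrite ut.
  exists u; split=> //.
  - by have [_ [[]|[]]] := h1 u au.
  - by apply: contraNneq au => ->; rewrite aw.
  - apply/multichainP; split=> // u1 au1; have [u1N h] := h1 u1 au1; split=> //.
    case: h => [|[tu1 _]]; [by left|right; split=> //].
    have [//|uu1] := h2 u1 u au1 au.
    have [->//|/negP uN] := eqVneq u1 u; have := max_u u1; rewrite au1 tu1 => /(_ isT).
    by rewrite leqNgt rk_mono // eq_sym; apply/negP.
  move=> w' tw' /multichainP [h1' _]; have [_ [[]//|[]//]] := h1' u au.
exists tau; split=> //; first by rewrite eq_sym.
apply/multichainP; split=> // u au; have [uN [?|[tu _]]] := h1 u au; split=> //;
  first by left.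
by have := no u; rewrite /= au tu.
Qed.

Lemma multichain_le u w a : le u w -> multichain u a -> multichain w a.
Proof.
move=> uw /multichainP [h1 h2]; apply/multichainP; split=> // u' /h1 [u'N h]; split=> //.
by case: h => [|[tu' u'u]]; [left|right; split=> //; apply: le_trans uw].
Qed.

Definition lower_covers w : {set T} :=
  [set w' | [&& le w' w, w' != w, le tau w' & (rk w').+1 == rk w]].

Definition deep_below w : {set T} := [set u | le tau u & (rk u).+2 <= rk w]%N.

(** Double counting of the pairs of an element of B and a multichain that it bounds; such a
    multichain is also bounded by w and avoids w. *)
Lemma sum_multichain_count w (B : {set T}) k :
  (forall u, u \in B -> le u w /\ u != w) -> le tau w -> w != tau ->
  (forall u, u \in B -> le tau u) ->
  (\sum_(u in B) multichain_count u k =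
   \sum_(a <- multichains w k | a w == 0) #|[set u in B | multichain u a]|)%N.
Proof.
move=> hB tw wN tB; under [RHS]eq_bigr do rewrite -sum1dep_card.
rewrite [RHS](exchange_big_dep (fun u => u \in B)) /=; last by move=> a u _ /andP[].
apply: eq_bigr => u uB; have [uw uwN] := hB u uB.
rewrite /multichain_count -sum1_size -[RHS]big_filter; apply: perm_big.
apply: uniq_perm; [exact: multichains_uniq|by rewrite filter_uniq // multichains_uniq|].
move=> a; rewrite [in RHS]mem_filter !mem_multichains uB /=.
case ca : (multichain u a); rewrite ?andbF //= (multichain_le uw ca) andbT.
suff -> : a w == 0%N by [].
apply/negPn/negP => aw; have [/(_ w aw) [_ [[wt _]|[_ wu]]] _] := multichainP _ _ ca.
  by case/eqP: wN; apply: le_anti; rewrite wt.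
by case/eqP: uwN; apply: le_anti; rewrite uw.
Qed.

(* A multichain avoiding [w] is counted once for each lower cover of [w] above its
   top; it is counted more than once only if that top has corank at least two. *)
Lemma multichain_count_cover w k : le tau w -> w != tau ->
  (count (fun a => a w == 0) (multichains w k)
     <= \sum_(w' in lower_covers w) multichain_count w' k
     <= count (fun a => a w == 0) (multichains w k)
        + #|T| * \sum_(u in deep_below w) multichain_count u k)%N.
Proof.
move=> tw wN; set g := count _ _.
pose deep := [set u in deep_below w | le u w].
have deepP u : u \in deep -> le u w /\ u != w.
  rewrite !inE => /andP [/andP [_ ru] uw]; split=> //.
  by apply: contraTneq ru => ->; rewrite -ltnNge.
have deep_le : (\sum_(u in deep) multichain_count u k <=
    \sum_(u in deep_below w) multichain_count u k)%N.
  rewrite [X in (_ <= X)%N](bigID (fun u => le u w)) /=; apply: leq_trans (leq_addr _ _).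
  by rewrite (eq_bigl _ _ (fun u => in_set _ u)).
rewrite (@sum_multichain_count w) //; first last.
- by move=> u; rewrite inE => /and4P[].
- by move=> u; rewrite inE => /and4P[].
apply/andP; split.
  rewrite /g -sum1_count big_seq_cond [X in (_ <= X)%N]big_seq_cond; apply: leq_sum => a.
  rewrite mem_multichains => /andP [/andP [ca _] /eqP aw].
  have [u [tu uw uwN cu _]] := multichain_top tw ca aw wN.
  have [w' [uw' w'w w'N rw']] := coverP uw uwN.
  apply/card_gt0P; exists w'; rewrite !inE w'w w'N rw' eqxx (le_trans tu uw') /=.
  exact: multichain_le cu.
apply: leq_trans (_ : g + #|T| * \sum_(u in deep) multichain_count u k <= _)%N; last first.
  by rewrite leq_add2l leq_mul2l deep_le orbT.
rewrite (@sum_multichain_count w deep) //; last first.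
  by move=> u; rewrite !inE => /andP [/andP[]].
rewrite /g -sum1_count big_distrr -big_split /=.
rewrite big_seq_cond [X in (_ <= X)%N]big_seq_cond; apply: leq_sum => a.
rewrite mem_multichains => /andP [/andP [ca _] /eqP aw].
have [u [tu uw uwN cu min_u]] := multichain_top tw ca aw wN.
(* A deep top is charged to the error, at most [#|T|] lower covers lying above it. Otherwise the top
   has corank one, and by rank the only lower cover above it is itself. *)
have [ru|ru] := leqP (rk u).+2 (rk w).
  have : (0 < #|[set u in deep | multichain u a]|)%N.
    by apply/card_gt0P; exists u; rewrite !inE tu ru uw cu.
  case: #|[set u in deep | _]| => // j _; rewrite mulnS addnA.
  apply: leq_trans (leq_addr _ _); apply: leq_trans (leq_addl _ _); exact: max_card.
apply: leq_trans (leq_addr _ _); rewrite -(cards1 u); apply: subset_leq_card.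
apply/subsetP => w'; rewrite !inE => /andP [/and4P [w'w w'N tw' /eqP rw'] cw'].
apply: contraTT ru => w'u; rewrite -leqNgt -rw' ltnS rk_mono ?min_u //.
by rewrite eq_sym.
Qed.

Variable Q : T -> {poly rat}.
Hypothesis Q_cumul : forall u, le tau u -> cumulative (multichain_count u) (Q u).

Lemma multichain_count0 u : (0 < multichain_count u 0)%N.
Proof.
rewrite /multichain_count lt0n size_eq0; apply/eqP => e.
have : [ffun=> 0%N] \in multichains u 0.
  rewrite mem_multichains; apply/andP; split.
    by apply/multichainP; split=> v; rewrite ffunE eqxx.
  by apply/eqP; rewrite /weight big1 // => v _; rewrite ffunE.
by rewrite e.
Qed.

Lemma cumulative_lead_gt0 u : le tau u -> 0 < lead_coef (Q u).
Proof.
move=> tu; have [k0 hk0] := Q_cumul tu.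
apply: (lead_coef_gt0_large (k0 := k0)) => [|k kk0]; last by rewrite hk0 // ler0n.
apply/eqP => Q0; have := hk0 k0 (leqnn _); rewrite Q0 horner0 => /esym/eqP.
by rewrite pnatr_eq0 big_ord_recl /= addn_eq0 => /andP [/eqP h _];
  have := multichain_count0 u; rewrite h.
Qed.

Lemma size_lead_sum (B : {set T}) s : B != set0 ->
  (forall u, u \in B -> 0 < lead_coef (Q u) /\ size (Q u) = s.+1) ->
  size (\sum_(u in B) Q u) = s.+1 /\
  lead_coef (\sum_(u in B) Q u) = \sum_(u in B) lead_coef (Q u).
Proof.
move=> /set0Pn [u0 u0B] hB.
have cs : (\sum_(u in B) Q u)`_s = \sum_(u in B) lead_coef (Q u).
  by rewrite coef_sum; apply: eq_bigr => u /hB [_ su]; rewrite lead_coefE su.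
have cN0 : (\sum_(u in B) Q u)`_s != 0.
  rewrite cs (bigD1 u0) //= gt_eqF // ltr_pwDl //; first exact: (hB u0 u0B).1.
  by apply: sumr_ge0 => u /andP [/hB [/ltW]].
have ss : size (\sum_(u in B) Q u) = s.+1.
  apply/eqP; rewrite eqn_leq; apply/andP; split.
    by apply: leq_trans (size_sum _ _ _) _; apply/bigmax_leqP => u /hB [_ ->].
  by rewrite ltnNge; apply: contra cN0 => h; rewrite nth_default.
by rewrite lead_coefE ss.
Qed.

Lemma sum_cumulative (h : nat -> nat) (m k : nat) : (m <= k)%N ->
  (\sum_(i < k.+1) (if m <= i then h (i - m) else 0) = \sum_(i < (k - m).+1) h i)%N.
Proof.
move=> mk; rewrite -[RHS](big_mkord xpredT h).
rewrite -(big_mkord xpredT (fun i => if m <= i then h (i - m) else 0)%N).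
rewrite (@big_cat_nat _ _ _ m) ?leqW //=.
have -> : (\sum_(0 <= i < m) (if m <= i then h (i - m) else 0) = 0)%N.
  by rewrite big_nat big1 // => i /andP [_ im]; rewrite leqNgt im.
rewrite add0n.
rewrite -[X in (\sum_(X <= _ < _) _)%N]add0n big_addn subSn //.
by apply: eq_bigr => i _; rewrite leq_addl addnK.
Qed.

(** The size equation says that the degree of Q grows with the rank, written without subtraction.
    For smaller ranks it gives equal degrees on the lower covers and a smaller degree for the error;
    comparing leading terms then gives it for w as well. *)
Lemma multichain_step w : le tau w -> w != tau ->
  (forall u, le tau u -> (rk u < rk w)%N ->
     (size (Q u) + rk tau = size (Q tau) + rk u)%N) ->
  (size (Q w) + rk tau = size (Q tau) + rk w)%N /\
  cumulative_degree (Q w) * (delta w)%:R =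
    \sum_(w' in lower_covers w) cumulative_degree (Q w').
Proof.
move=> tw wN IH; set B := lower_covers w.
have tauN : tau != w by rewrite eq_sym.
have BP u : u \in B -> [/\ le u w, u != w, le tau u & (rk u).+1 = rk w].
  by rewrite inE => /and4P [? ? ? /eqP].
have [w0 [tw0 w0w w0N rw0]] := coverP tw tauN.
have w0B : w0 \in B by rewrite inE w0w w0N tw0 rw0 eqxx.
have Qpos u : le tau u -> (0 < size (Q u))%N.
  by move=> tu; rewrite size_poly_gt0 -lead_coef_eq0 gt_eqF // cumulative_lead_gt0.
case s_def : (size (Q w0)) (Qpos w0 tw0) => [//|s] _.
have sB u : u \in B -> 0 < lead_coef (Q u) /\ size (Q u) = s.+1.
  move=> /BP [_ _ tu ru]; split; first exact: cumulative_lead_gt0.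
  have e : rk w0 = rk u by apply: succn_inj; rewrite ru rw0.
  move: (IH w0 tw0) (IH u tu); rewrite s_def -ru e ltnSn => /(_ isT) + /(_ isT).
  by clear; lia.
have BN0 : B != set0 by apply/set0Pn; exists w0.
have [sS lS] := size_lead_sum BN0 sB.
set S := \sum_(u in B) Q u in sS lS.
pose D := backward_diff (delta w)%:R (Q w).
pose F := #|T|%:R *: \sum_(u in deep_below w) Q u.
have deepP u : u \in deep_below w -> le tau u by rewrite inE => /andP[].
have [k0 hk0] : exists k0, forall u, le tau u -> forall k, (k0 <= k)%N ->
    (Q u).[k%:R] = (\sum_(i < k.+1) multichain_count u i)%N%:R.
  have Qc u : exists k0, le tau u -> forall k, (k0 <= k)%N ->
      (Q u).[k%:R] = (\sum_(i < k.+1) multichain_count u i)%N%:R.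
    by case tu : (le tau u); [have [k0 ?] := Q_cumul tu; exists k0|exists 0%N].
  have [f hf] := choice Qc; exists (\max_u f u)%N => u tu k hk.
  by apply: hf => //; apply: leq_trans hk; apply: (@leq_bigmax _ f).
have horner_sumQ (A : {set T}) k : (forall u, u \in A -> le tau u) -> (k0 <= k)%N ->
    (\sum_(u in A) Q u).[k%:R] =
    (\sum_(i < k.+1) \sum_(u in A) multichain_count u i)%N%:R.
  move=> hA kk0; rewrite horner_sum exchange_big natr_sum.
  by apply: eq_bigr => u /hA tu; rewrite hk0.
(* The covering estimate summed over all degrees up to k: [D] counts the multichains avoiding w, [S]
   counts them with repetition, and [F] bounds the excess. The threshold makes k - delta w large
   enough too. *)
have squeeze k : (k0 + delta w <= k)%N -> 0 <= (S - D).[k%:R] <= F.[k%:R].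
  move=> kk; have kd : (delta w <= k)%N by apply: leq_trans kk; apply: leq_addl.
  have kk0 : (k0 <= k)%N by apply: leq_trans kk; apply: leq_addr.
  have kk1 : (k0 <= k - delta w)%N by rewrite leq_subRL // addnC.
  rewrite hornerD hornerN hornerZ backward_diffE -natrB // !hk0 // !horner_sumQ //;
    last first.
    by move=> u /BP[].
  set X := (\sum_(i < k.+1) \sum_(u in B) _)%N;
    set Y := (\sum_(i < k.+1) \sum_(u in _) _)%N.
  have cov i := multichain_count_cover i tw wN.
  pose g i := count (fun a => a w == 0%N) (multichains w i).
  have -> : (\sum_(i < k.+1) multichain_count w i)%N =
      (\sum_(i < k.+1) g i + \sum_(i < (k - delta w).+1) multichain_count w i)%N.
    rewrite -sum_cumulative // -big_split /=.
    by apply: eq_bigr => i _; exact: multichain_count_rec.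
  rewrite natrD addrK -natrM subr_ge0 lerBlDr -natrD !ler_nat; apply/andP; split.
    by apply: leq_sum => i _; have /andP[] := cov i.
  rewrite /X /Y big_distrr /= -big_split /=; apply: leq_sum => i _.
  by rewrite addnC; have /andP[] := cov i.
have sF : (size F < s.+1)%N.
  apply: leq_ltn_trans (size_scale_leq _ _) _; rewrite ltnS.
  apply: leq_trans (size_sum _ _ _) _; apply/bigmax_leqP => u; rewrite inE => /andP [tu ru].
  have uw : (rk u < rk w)%N by apply: ltn_trans ru.
  have w0w' : (rk w0 < rk w)%N by rewrite -rw0.
  by move: (IH u tu uw) (IH w0 tw0 w0w') ru; rewrite s_def -rw0; clear; lia.
have sSD : (size (S - D)%R < size S)%N.
  by rewrite sS; apply: leq_ltn_trans sF; apply: size_poly_le_large squeeze.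
have eD : D = S + - (S - D) by rewrite opprB addrC subrK.
have sD : size D = s.+1 by rewrite eD size_polyDl ?size_polyN.
have lD : lead_coef D = \sum_(u in B) lead_coef (Q u).
  by rewrite eD lead_coefDl ?size_polyN.
(* A constant [Q w] would have difference 0, but [D] has positive size. *)
have [t st] : exists t, size (Q w) = t.+2.
  case st : (size (Q w)) => [|[|t]]; last by exists t.
    by have := Qpos w tw; rewrite st.
  have [c Qc] : exists c, Q w = c%:P by exists (Q w)`_0; apply: size1_polyC; rewrite st.
  by move: sD; rewrite /D Qc /backward_diff comp_polyC subrr size_poly0.
have dN0 : (delta w)%:R != 0 :> rat by rewrite pnatr_eq0 -lt0n delta_gt0.
have [sD' lD'] := size_lead_backward_diff dN0 st.
have ts : t = s by move: sD; rewrite /D sD' => -[].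
split.
  move: (IH w0 tw0); rewrite s_def st ts -rw0 ltnSn => /(_ isT); clear; lia.
rewrite /cumulative_degree st ts /= factS natrM.
transitivity (lead_coef D * s`!%:R); first by rewrite /D lD' ts; ring.
rewrite lD mulr_suml; by apply: eq_bigr => u /sB [_ ->].
Qed.

Lemma multichain_degree_rec w : le tau w -> w != tau ->
  cumulative_degree (Q w) * (delta w)%:R =
    \sum_(w' in lower_covers w) cumulative_degree (Q w').
Proof.
move=> tw wN; apply: (multichain_step tw wN _).2 => u.
have [m] := ubnP (rk u); elim: m u => // m IH u; rewrite ltnS => um tu ru.
have [->|uN] := eqVneq u tau; first by [].
apply: (multichain_step tu uN _).1 => v tv rv; apply: IH => //.
  exact: leq_trans um.
exact: ltn_trans ru.
Qed.

End Multichains.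

(** * The poset of indices *)

Section IndexPoset.

Variables d n : nat.
Implicit Types (u v w : grindex d n) (s t : 'I_d).

Lemma tnth_ltn u s t : (s < t)%N -> (tnth u s < tnth u t)%N.
Proof.
move=> st; have := valP u => /= su.
have sz : size [seq val k | k <- u] = d by rewrite size_map size_tuple.
have := sorted_ltn_nth ltn_trans 0%N su s t; rewrite !inE sz !ltn_ord => /(_ isT isT st).
by rewrite !(nth_map (tnth u s)) ?size_tuple // -!tnth_nth.
Qed.

Lemma tnth_leq u s t : (s <= t)%N -> (tnth u s <= tnth u t)%N.
Proof. by rewrite leq_eqVlt => /predU1P [/val_inj ->//|/tnth_ltn /ltnW]. Qed.

Lemma tnth_inj u : injective (tnth u).
Proof. exact/tuple_uniqP/index_uniq. Qed.

Lemma grindexP u v : (forall t, tnth u t = tnth v t) -> u = v.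
Proof. by move=> e; apply/val_inj/eq_from_tnth. Qed.

Lemma mkindex_subproof (f : 'I_d -> 'I_n) : (forall s t, (s < t)%N -> (f s < f t)%N) ->
  sorted ltn [seq val k | k <- [tuple f t | t < d]].
Proof.
move=> hf; apply/(sortedP 0%N) => k; rewrite size_map size_tuple => kd.
have kd' : (k < d)%N by apply: ltnW.
rewrite -[k.+1]/(val (Ordinal kd)) -[k]/(val (Ordinal kd')).
rewrite !(nth_map (f (Ordinal kd))) ?size_tuple //.
by rewrite -!tnth_nth !tnth_mktuple; apply: hf => /=.
Qed.

Definition mkindex f hf : grindex d n := GrIndex (@mkindex_subproof f hf).

Lemma tnth_mkindex f hf t : tnth (@mkindex f hf) t = f t.
Proof. exact: tnth_mktuple. Qed.

Lemma leIP u v : reflect (forall t, (tnth u t <= tnth v t)%N) (leI u v).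
Proof. exact: forallP. Qed.

Lemma leI_refl : reflexive (@leI d n).
Proof. by move=> u; apply/leIP. Qed.

Lemma leI_anti : antisymmetric (@leI d n).
Proof.
move=> u v /andP [/leIP uv /leIP vu]; apply: grindexP => t.
by apply/val_inj/eqP; rewrite /= eqn_leq uv vu.
Qed.

Lemma leI_trans : transitive (@leI d n).
Proof. by move=> v u w /leIP uv /leIP vw; apply/leIP => t; apply: leq_trans (vw t). Qed.

Lemma leI_neq_ex u w : leI u w -> u != w -> exists t, (tnth u t < tnth w t)%N.
Proof.
move=> /leIP uw uwN; apply: contrapT => no; case/eqP: uwN; apply: grindexP => t.
apply/val_inj/eqP; rewrite /= eqn_leq uw /= leqNgt; apply/negP => h.
by apply: no; exists t.
Qed.

Definition index_sum u : nat := (\sum_t tnth u t)%N.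

Lemma index_sum_lt u w : leI u w -> u != w -> (index_sum u < index_sum w)%N.
Proof.
move=> uw /(leI_neq_ex uw) [t ut]; move/leIP: uw => uw.
rewrite /index_sum (bigD1 t) // [X in (_ < X)%N](bigD1 t) //= -addSn leq_add //.
by apply: leq_sum => s _.
Qed.

Lemma index_sum_le u : (index_sum u <= d * n)%N.
Proof.
rewrite /index_sum -[X in (_ <= X * _)%N]card_ord -sum1_card big_distrl /=.
by apply: leq_sum => t _; rewrite mul1n ltnW.
Qed.

(** The smallest position t at which u is strictly below w is lowered in w. Earlier entries of w
    agree with u and so stay below u_t <= w_t - 1, which keeps the word increasing. *)
Lemma index_lower_cover u w : leI u w -> u != w -> exists w',
  [/\ leI u w', leI w' w, w' != w & (index_sum w').+1 = index_sum w].
Proof.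
move=> uw /(leI_neq_ex uw) [t0 ut0]; move/leIP: uw => uw.
case: (@arg_minnP _ t0 (fun t => tnth u t < tnth w t)%N val ut0) => t ut t_min.
pose f s : 'I_n := if s == t then Ordinal (leq_ltn_trans (leq_pred _) (ltn_ord (tnth w s)))
  else tnth w s.
have ft : val (f t) = (tnth w t).-1 by rewrite /f eqxx.
have fN s : s != t -> f s = tnth w s by rewrite /f => /negPf ->.
have wt : (0 < tnth w t)%N by apply: leq_ltn_trans ut.
have hf s s' : (s < s')%N -> (f s < f s')%N.
  move=> ss; have [e|sN] := eqVneq s t.
    rewrite e in ss *; rewrite ft fN; last by rewrite neq_ltn ss orbT.
    by rewrite prednK // ltnW // tnth_ltn.
  have [e|sN'] := eqVneq s' t; last by rewrite !fN // tnth_ltn.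
  rewrite e in ss *; rewrite ft fN //.
  have e' : tnth w s = tnth u s :> nat.
    apply/eqP; rewrite eqn_leq uw andbT leqNgt; apply/negP => /t_min.
    by rewrite leqNgt ss.
  rewrite e'; have := tnth_ltn u ss; move: ut; case: (val (tnth w t)) => //= m.
  by rewrite ltnS => h1 h2; apply: leq_trans h2 h1.
have [w' hw'] : exists w', forall s, tnth w' s = f s.
  by exists (mkindex hf) => s; apply: tnth_mkindex.
exists w'; split.
- apply/leIP => s; rewrite hw'; have [->|sN] := eqVneq s t; last by rewrite fN.
  by rewrite ft -ltnS prednK.
- apply/leIP => s; rewrite hw'; have [->|sN] := eqVneq s t; last by rewrite fN.
  by rewrite ft leq_pred.
- apply/eqP => e; have := congr1 (fun v => val (tnth v t)) e.
  by rewrite hw' ft => /= h; have := ltn_predL (tnth w t); rewrite h ltnn wt.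
rewrite /index_sum (bigD1 t) // [RHS](bigD1 t) //= hw' ft -addSn prednK //.
by congr (_ + _)%N; apply: eq_bigr => s sN; rewrite hw' fN.
Qed.

(** Dually, the largest position at which v is strictly below u is raised; the later entries of v
    agree with u. *)
Lemma index_upper_cover v u : leI v u -> v != u -> exists v',
  [/\ leI v v', leI v' u, v' != v & index_sum v' = (index_sum v).+1].
Proof.
move=> vu /(leI_neq_ex vu) [t0 ut0]; move/leIP: vu => vu.
case: (@arg_maxnP _ t0 (fun t => tnth v t < tnth u t)%N val ut0) => t ut t_max.
have vtn : ((tnth v t).+1 < n)%N by apply: leq_ltn_trans (ltn_ord (tnth u t)).
pose f s : 'I_n := if s == t then Ordinal vtn else tnth v s.
have ft : val (f t) = (tnth v t).+1 by rewrite /f eqxx.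
have fN s : s != t -> f s = tnth v s by rewrite /f => /negPf ->.
have hf s s' : (s < s')%N -> (f s < f s')%N.
  move=> ss; have [e|sN'] := eqVneq s' t.
    rewrite e in ss *; rewrite ft fN; last by rewrite neq_ltn ss.
    by apply: ltn_trans (tnth_ltn v ss) _.
  have [e|sN] := eqVneq s t; last by rewrite !fN // tnth_ltn.
  rewrite e in ss *; rewrite ft fN //.
  have e' : tnth v s' = tnth u s' :> nat.
    apply/eqP; rewrite eqn_leq vu leqNgt; apply/negP => /t_max h.
    by move: (h : (s' <= t)%N); rewrite leqNgt ss.
  by rewrite e'; apply: leq_ltn_trans ut (tnth_ltn u ss).
have [w' hw'] : exists w', forall s, tnth w' s = f s.
  by exists (mkindex hf) => s; apply: tnth_mkindex.
exists w'; split.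
- apply/leIP => s; rewrite hw'; have [->|sN] := eqVneq s t; last by rewrite fN.
  by rewrite ft.
- apply/leIP => s; rewrite hw'; have [->|sN] := eqVneq s t; last by rewrite fN.
  by rewrite ft.
- apply/eqP => e; have := congr1 (fun v => val (tnth v t)) e.
  by rewrite hw' ft => /esym/n_Sn.
rewrite /index_sum (bigD1 t) // [in RHS](bigD1 t) //= hw' ft -addSn.
by congr (_ + _)%N; apply: eq_bigr => s sN; rewrite hw' fN.
Qed.

Lemma grindex_leq u : (d <= n)%N.
Proof.
by rewrite -[X in (_ <= X)%N]card_ord -{1}(size_tuple u) -(card_uniqP (index_uniq u)) max_card.
Qed.

Lemma index_perm_head u t (k : 'I_n) : k = t :> nat -> index_perm u k = tnth u t.
Proof.
move=> kt; rewrite permE /index_word nth_cat size_tuple kt ltn_ord.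
by rewrite (tnth_nth k).
Qed.

Lemma index_perm_tail u (k l : 'I_n) : (d <= k)%N -> (k < l)%N ->
  (index_perm u k < index_perm u l)%N.
Proof.
move=> dk kl; have dl : (d <= l)%N by apply: leq_trans (ltnW kl).
rewrite !permE /index_word !nth_cat size_tuple (ltnNge k) (ltnNge l) dk dl /=.
set r := [seq j <- _ | _].
have sr : sorted ltn [seq val j | j <- r].
  have -> : [seq val j | j <- r] = [seq j <- iota 0 n | j \notin [seq val i | i <- u]].
    rewrite -val_enum_ord filter_map; congr (map _ _); apply: eq_filter => j /=.
    by rewrite mem_map //; exact: val_inj.
  by apply: sorted_filter; [exact: ltn_trans|exact: iota_ltn_sorted].
have sz : (d + size r = n)%N.
  by rewrite -[RHS](size_index_word u) size_cat size_tuple.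
have kr : (k - d < size r)%N by have := ltn_ord k; clear -sz dk; lia.
have lr : (l - d < size r)%N by have := ltn_ord l; clear -sz dl; lia.
have := sorted_ltn_nth ltn_trans 0%N sr (k - d)%N (l - d)%N.
rewrite !inE size_map kr lr => /(_ isT isT); rewrite !(nth_map k) //.
rewrite [nth l r _](set_nth_default k) //; apply.
by rewrite ltn_sub2r //; apply: leq_ltn_trans kl.
Qed.

Lemma card_ord_ltn m (k : 'I_m) : #|[set l : 'I_m | (l < k)%N]| = k.
Proof.
rewrite -sum1dep_card -(big_ord_widen m (fun=> 1%N)); last exact: ltnW.
by rewrite sum1_card card_ord.
Qed.

(** Inversions start only in the first d positions. The values below the entry at position t stand
    either later, as inversions, or at the t earlier positions. Thus [index_sum] can serve as rank
    function instead of the length. *)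
Lemma index_lengthE u : (index_length u + \sum_(t < d) t = index_sum u)%N.
Proof.
have dn := grindex_leq u; set s := index_perm u.
pose inv (p : 'I_n) := #|[set q : 'I_n | (p < q)%N && (s q < s p)%N]|.
have -> : index_length u = (\sum_p inv p)%N.
  rewrite /index_length /perm_length -sum1dep_card.
  rewrite -(pair_big_dep xpredT (fun p q : 'I_n => (p < q)%N && (s q < s p)%N)
    (fun _ _ => 1%N)) /=.
  by apply: eq_bigr => p _; rewrite sum1dep_card.
have inv_tail (p : 'I_n) : (d <= p)%N -> inv p = 0%N.
  move=> dp; apply/eqP; rewrite cards_eq0; apply/eqP/setP => q; rewrite !inE.
  by apply/negP => /andP [pq]; rewrite ltnNge ltnW // index_perm_tail.
have inv_head (t : 'I_d) (p : 'I_n) : p = t :> nat -> (inv p + t = tnth u t)%N.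
  move=> pt; have sp : s p = tnth u t := index_perm_head u pt.
  transitivity #|[set q : 'I_n | (s q < s p)%N]|; last first.
    rewrite -sp -[RHS]card_ord_ltn -[RHS](card_preimset _ (@perm_inj _ s)).
    by apply: eq_card => q; rewrite !inE.
  rewrite -(cardsID [set q : 'I_n | (p < q)%N]); congr (_ + _)%N.
    by rewrite /inv; apply: eq_card => q; rewrite !inE andbC.
  rewrite -pt -[LHS](card_ord_ltn p); apply: eq_card => q.
  rewrite !inE -leqNgt [(q <= p)%N]leq_eqVlt.
  have [e|qp] := eqVneq (q : nat) p; first by rewrite (val_inj e) !ltnn andbF.
  case qp' : (q < p)%N; rewrite //=.
  have qd : (q < d)%N by rewrite (ltn_trans qp') // pt.
  by rewrite sp /s (@index_perm_head u (Ordinal qd) q) // tnth_ltn //= -pt.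
rewrite (bigID (fun p : 'I_n => (p < d)%N)) /= [X in (_ + X + _)%N]big1 ?addn0; last first.
  by move=> p; rewrite -leqNgt => /inv_tail.
pose F k := if insub k is Some p then inv p else 0%N.
rewrite (eq_bigr (fun p : 'I_n => F (val p))); last by move=> p _; rewrite /F valK.
rewrite -(big_ord_widen n F dn) -big_split; apply: eq_bigr => t _ /=.
have tn : (t < n)%N by apply: leq_trans dn.
by rewrite /F insubT; apply: inv_head.
Qed.


End IndexPoset.

(** * Straightening *)

Section Straightening.

Variables d n : nat.

(** Arbitrary words are allowed, because an exchange may repeat letters or break their order. *)
Definition minor (R : comNzRingType) (M : 'M[R]_(n, d)) (c : 'I_d -> 'I_n) : R :=
  \det (rowsub c M).

Lemma minor_perm (R : comNzRingType) (M : 'M[R]_(n, d)) c (s : 'S_d) :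
  minor M (c \o s) = (-1) ^+ s * minor M c.
Proof.
rewrite /minor; have -> : rowsub (c \o s) M = row_perm s (rowsub c M).
  by apply/matrixP => i j; rewrite !mxE.
by rewrite row_permE det_mulmx det_perm.
Qed.

Lemma eq_minor (R : comNzRingType) (M : 'M[R]_(n, d)) c c' :
  c =1 c' -> minor M c = minor M c'.
Proof. by move=> e; congr (\det _); apply/matrixP => i j; rewrite !mxE e. Qed.

Lemma minor_map (R S : comNzRingType) (f : {rmorphism R -> S}) (M : 'M[R]_(n, d)) c :
  minor (map_mx f M) c = f (minor M c).
Proof. by rewrite /minor -det_map_mx; congr (\det _); apply/matrixP => i j;
  rewrite !mxE. Qed.

(** The d + 1 letters are shared out: positions above t, shifted by one, feed the end of the left
    word, and positions up to t feed the beginning of the right word. *)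
Lemma blockP (t : 'I_d) (j : 'I_d.+1) :
  (exists2 k : 'I_d, j = lift ord0 k & (t <= k)%N) \/
  (exists2 k : 'I_d, j = lift ord_max k & (k <= t)%N).
Proof.
have [tj|jt] := ltnP t j.
  have [k jk|j0] := unliftP ord0 j; last by move: tj; rewrite j0.
  by left; exists k => //; move: tj; rewrite jk /= /bump.
have [k jk|jm] := unliftP ord_max j; last first.
  by move: jt; rewrite jm leqNgt ltn_ord.
by right; exists k => //; move: jt; rewrite jk lift_max.
Qed.

Lemma big_block (T : Type) (idx : T) (op : Monoid.com_law idx) (t : 'I_d)
    (F : 'I_d.+1 -> T) :
  \big[op/idx]_j F j =
  op (\big[op/idx]_(k : 'I_d | (t <= k)%N) F (lift ord0 k))
     (\big[op/idx]_(k : 'I_d | (k <= t)%N) F (lift ord_max k)).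
Proof.
rewrite (bigID (fun j : 'I_d.+1 => (t < j)%N)) /=; congr (op _ _).
  rewrite big_mkcond big_ord_recl /= Monoid.mul1m -big_mkcond.
  by apply: eq_bigl => k.
rewrite big_mkcond big_ord_recr /= ltn_ord Monoid.mulm1 -big_mkcond.
apply: eq_big => k; first by rewrite -leqNgt.
by move=> _; congr F; apply: val_inj; rewrite /= /bump leqNgt ltn_ord.
Qed.

Section Exchange.

Variables (theta phi : grindex d n) (t : 'I_d) (b : 'I_d.+1 -> 'I_n).

(* The last [d - t] indices of [theta] and the first [t + 1] indices of [phi] are
   replaced by the letters of [b], permuted by [s]. *)
Definition left_word (s : 'S_d.+1) (k : 'I_d) : 'I_n :=
  if (t <= k)%N then b (s (lift ord0 k)) else tnth theta k.

Definition right_word (s : 'S_d.+1) (k : 'I_d) : 'I_n :=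
  if (k <= t)%N then b (s (lift ord_max k)) else tnth phi k.

Definition exchange_term (R : comNzRingType) (M : 'M[R]_(n, d)) (s : 'S_d.+1) : R :=
  (-1) ^+ s * (minor M (left_word s) * minor M (right_word s)).

(* Expanding both minors turns the sum into determinants of size [d + 1] whose
   rows are taken among the [d] columns of [M]. *)
Lemma exchange_sum (R : comNzRingType) (M : 'M[R]_(n, d)) :
  \sum_s exchange_term M s = 0.
Proof.
(* The column paired with the letter at position j, taken from [p] in the upper block and from [q]
   in the lower one. The fallbacks [k] and [t] are never reached. *)
pose r (p q : 'S_d) (j : 'I_d.+1) : 'I_d :=
  match unlift ord0 j with
  | Some k => if (t <= k)%N then p k else
      if unlift ord_max j is Some k' then q k' else k
  | None => if unlift ord_max j is Some k' then q k' else t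
  end.
have r0 p q (k : 'I_d) : (t <= k)%N -> r p q (lift ord0 k) = p k.
  by move=> tk; rewrite /r liftK tk.
have r1 p q (k : 'I_d) : (k <= t)%N -> r p q (lift ord_max k) = q k.
  move=> kt; rewrite /r; case: unliftP => [k' e|_]; last by rewrite liftK.
  have kk' : k'.+1 = k by have := congr1 val e; rewrite /= /bump [(d <= k)%N]leqNgt ltn_ord.
  by rewrite leqNgt -ltnS kk' ltnS kt /= liftK.
have regroup (s0 p0 q0 A B x y : R) :
    s0 * (p0 * (A * x) * (q0 * (B * y))) = p0 * q0 * (x * y) * (s0 * (A * B)) by ring.
pose m1 (p : 'S_d) := \prod_(k : 'I_d | ~~ (t <= k)%N) M (tnth theta k) (p k).
pose m2 (q : 'S_d) := \prod_(k : 'I_d | ~~ (k <= t)%N) M (tnth phi k) (q k).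
transitivity (\sum_(p : 'S_d) \sum_(q : 'S_d)
    ((-1) ^+ p * (-1) ^+ q * (m1 p * m2 q)) *
    \det (\matrix_(j < d.+1, i < d.+1) M (b i) (r p q j))).
  rewrite /exchange_term /minor /determinant.
  under eq_bigr do rewrite big_distrlr /= mulr_sumr.
  rewrite exchange_big; apply: eq_bigr => p _ /=.
  under eq_bigr do rewrite mulr_sumr.
  rewrite exchange_big; apply: eq_bigr => q _ /=.
  rewrite mulr_sumr; apply: eq_bigr => s _.
  have -> : \prod_i (rowsub (left_word s) M) i (p i) =
      \prod_(k : 'I_d | (t <= k)%N) M (b (s (lift ord0 k))) (p k) * m1 p.
    rewrite (bigID (fun k : 'I_d => (t <= k)%N)) /=; congr (_ * _).
      by apply: eq_bigr => k tk; rewrite !mxE /left_word tk.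
    by apply: eq_bigr => k /negPf tk; rewrite !mxE /left_word tk.
  have -> : \prod_i (rowsub (right_word s) M) i (q i) =
      \prod_(k : 'I_d | (k <= t)%N) M (b (s (lift ord_max k))) (q k) * m2 q.
    rewrite (bigID (fun k : 'I_d => (k <= t)%N)) /=; congr (_ * _).
      by apply: eq_bigr => k tk; rewrite !mxE /right_word tk.
    by apply: eq_bigr => k /negPf tk; rewrite !mxE /right_word tk.
  rewrite (big_block _ t) /=.
  under [X in _ = _ * (_ * (X * _))]eq_bigr => k tk do rewrite !mxE r0 //.
  under [X in _ = _ * (_ * (_ * X))]eq_bigr => k tk do rewrite !mxE r1 //.
  exact: regroup.
rewrite big1 // => p _; rewrite big1 // => q _.
have /injectivePn [j [j' jj' e]] : ~~ injectiveb (r p q).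
  apply/negP => /injectiveP /leq_card; by rewrite !card_ord ltnn.
rewrite (@determinant_alternate _ _ _ j j') ?mulr0 // => i.
by rewrite !mxE e.
Qed.

Definition same_block (i j : 'I_d.+1) := (i <= t)%N == (j <= t)%N.

(** A transposition within a block swaps two rows of one minor, and this sign cancels the sign of
    the permutation. *)
Lemma exchange_term_tperm (R : comNzRingType) (M : 'M[R]_(n, d)) x y s :
  x != y -> same_block x y ->
  exchange_term M (tperm x y * s)%g = exchange_term M s.
Proof.
move=> xy /eqP sxy; rewrite /exchange_term odd_permM odd_tperm xy.
have lift_inj0 : injective (lift (@ord0 d)) by exact: lift_inj.
have lift_injm : injective (lift (@ord_max d)) by exact: lift_inj.
have [[k1 ex tk1]|[k1 ex k1t]] := blockP t x.
  have tx : (x <= t)%N = false by rewrite ex leqNgt /= ltnS tk1.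
  have [[k2 ey tk2]|[k2 ey k2t]] := blockP t y; last first.
    by move: sxy; rewrite tx ey lift_max k2t.
  have -> : minor M (left_word (tperm x y * s)) =
      minor M (left_word s \o tperm k1 k2).
    apply: eq_minor => k /=; rewrite /left_word permM ex ey.
    case: (leqP t k) => tk; last first.
      rewrite tpermD; first by rewrite leqNgt tk.
        by apply: contraTneq tk => <-; rewrite -leqNgt.
      by apply: contraTneq tk => <-; rewrite -leqNgt.
    rewrite -(inj_tperm _ _ _ lift_inj0).
    by case: tpermP => [_|_|_ _]; rewrite ?tk1 ?tk2 ?tk.
  have -> : minor M (right_word (tperm x y * s)) = minor M (right_word s).
    apply: eq_minor => k; rewrite /right_word permM; case: ifP => // kt.
    rewrite tpermD //; apply: contraTneq kt => e.
      by rewrite -(lift_max k) -e tx.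
    by rewrite -(lift_max k) -e -sxy tx.
  rewrite minor_perm odd_tperm -(inj_eq lift_inj0) -ex -ey xy.
  by rewrite addTb signrN expr1 mulN1r [- _ * minor _ _]mulNr mulrNN.
have tx : (x <= t)%N by rewrite ex lift_max.
have [[k2 ey tk2]|[k2 ey k2t]] := blockP t y.
  by move: sxy; rewrite tx ey leqNgt /= ltnS tk2.
have -> : minor M (right_word (tperm x y * s)) =
    minor M (right_word s \o tperm k1 k2).
  apply: eq_minor => k /=; rewrite /right_word permM ex ey.
  case: (leqP k t) => tk; last first.
    rewrite tpermD; first by rewrite leqNgt tk.
      by apply: contraTneq tk => <-; rewrite -leqNgt.
    by apply: contraTneq tk => <-; rewrite -leqNgt.
  rewrite -(inj_tperm _ _ _ lift_injm).
  by case: tpermP => [_|_|_ _]; rewrite ?k1t ?k2t ?tk.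
have -> : minor M (left_word (tperm x y * s)) = minor M (left_word s).
  apply: eq_minor => k; rewrite /left_word permM; case: ifP => // tk.
  have nt : (lift ord0 k <= t)%N = false by rewrite leqNgt /= ltnS tk.
  by rewrite tpermD //; apply/eqP => e; move: nt; rewrite -e -?sxy tx.
rewrite minor_perm odd_tperm -(inj_eq lift_injm) -ex -ey xy.
by rewrite addTb signrN expr1 mulN1r [minor _ _ * - _]mulrN mulrNN.
Qed.

(** The setwise stabilizer of the lower block, a product of two symmetric groups. Permutations
    compose from left to right, so [h * s] first permutes positions, and the exchange term depends
    only on the right coset of [s]. *)
Definition block_stab : {group 'S_d.+1} :=
  'N([set j : 'I_d.+1 | (j <= t)%N] | 'P)%G.

Lemma block_stabP (s : 'S_d.+1) :
  reflect (forall j, (s j <= t)%N = (j <= t)%N) (s \in block_stab).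
Proof.
apply: (iffP idP) => [sH j|h].
  by have := astabs_act j sH; rewrite !inE /= apermE.
rewrite inE; apply/andP; split; first by rewrite inE.
by rewrite inE; apply/subsetP => j; rewrite !inE /= apermE h.
Qed.

Lemma exchange_term_stab (R : comNzRingType) (M : 'M[R]_(n, d)) h s :
  h \in block_stab -> exchange_term M (h * s)%g = exchange_term M s.
Proof.
have [m] := ubnP #|[set x | h x != x]|; elim: m h s => // m IH h s.
rewrite ltnS => hm /block_stabP hP.
have [|] := set_0Vmem [set x | h x != x].
  move=> h1; have -> : h = 1%g; last by rewrite mul1g.
  apply/permP => x; rewrite perm1; apply/eqP/negPn.
  by have := in_set0 x; rewrite -h1 inE => ->.
(* [h * tau] fixes x and every fixed point of h, so fewer points are moved. *)
move=> [x]; rewrite inE => hx; pose tau := tperm x (h x).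
have txh : same_block x (h x) by rewrite /same_block hP.
have -> : (h * s = (h * tau) * (tau * s))%g.
  by rewrite mulgA -(mulgA h) tperm2 mulg1.
rewrite IH ?exchange_term_tperm //; first by rewrite eq_sym.
  apply: leq_trans hm; apply: proper_card; apply/properP; split.
    apply/subsetP => y; rewrite !inE permM; apply: contraNneq => hy.
    rewrite hy tpermD //; first by apply: contraNneq hx => ->; apply/eqP.
    by apply: contraNneq hx => e; apply/eqP; apply: (@perm_inj _ h); rewrite e.
  by exists x; rewrite !inE ?hx // permM tpermR eqxx.
apply/block_stabP => j; rewrite permM -[RHS]hP; case: tpermP => [-> |->|//].
  by rewrite hP.
by rewrite hP.
Qed.

Lemma card_exchange_sum (R : comNzRingType) (M : 'M[R]_(n, d)) :
  (\sum_(C in rcosets block_stab [set: 'S_d.+1]) exchange_term M (repr C))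
    *+ #|block_stab| = 0.
Proof.
rewrite -[RHS](exchange_sum M) -sumrMnl.
have part := rcosets_partition (subsetT block_stab).
transitivity (\sum_(s in [set: 'S_d.+1]) exchange_term M s); last first.
  by apply: eq_bigl => s; rewrite inE.
rewrite (set_partition_big _ part) /=.
apply: eq_bigr => C /rcosetsP [s _ ->].
rewrite -(card_rcoset block_stab s) -sumr_const; apply: eq_bigr => u.
move: (mem_repr_rcoset block_stab s) => /rcosetP [h hH ->].
by case/rcosetP => h' hH' ->; rewrite !exchange_term_stab.
Qed.

(* Division by the order of [block_stab] takes place over the integers. *)
Lemma exchange_relation (R : comNzRingType) (M : 'M[R]_(n, d)) :
  \sum_(C in rcosets block_stab [set: 'S_d.+1]) exchange_term M (repr C) = 0.
Proof.
pose G : 'M[{mpoly int[n * d]}]_(n, d) :=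
  \matrix_(i, j) 'X_(mxvec_index i j).
have G0 : \sum_(C in rcosets block_stab [set: 'S_d.+1]) exchange_term G (repr C) = 0.
  have := card_exchange_sum G; rewrite -mulr_natr => /eqP; rewrite mulf_eq0.
  case/orP => [/eqP //|]; rewrite -mpolyC_nat mpolyC_eq0 pnatr_eq0.
  by rewrite (gtn_eqF (cardG_gt0 _)).
pose ev : {rmorphism {mpoly int[n * d]} -> R} :=
  mmap (intmul 1) (fun k => mxvec M 0 k).
have MG : M = map_mx ev G.
  by apply/matrixP => i j; rewrite !mxE /ev /= mmapX mmap1U mxvecE.
have eM c : minor M c = ev (minor G c) by rewrite MG minor_map.
have key s : exchange_term M s = ev (exchange_term G s).
  by rewrite /exchange_term !eM 2!rmorphM /= rmorph_sign.
by under eq_bigr do rewrite key; rewrite -(rmorph_sum ev) G0 rmorph0.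
Qed.

End Exchange.
End Straightening.

(** * Rewriting products of Plücker coordinates as standard monomials *)

Section StandardMonomials.

Variables d n : nat.

(** As many positions leave the top block as enter it; those entering carry values at most b t,
    those leaving at least b t + 1. This serves both for the termination of straightening and for
    the rearrangement inequality. *)
Lemma sum_top m (b : 'I_m -> nat) (t : 'I_m) (s : 'S_m) :
  (forall i j : 'I_m, (i < j)%N -> (b i < b j)%N) ->
  (\sum_(j : 'I_m | t < j) b (s j) + #|[set j : 'I_m | (t < j) && (s j <= t)]|
     <= \sum_(j : 'I_m | t < j) b j)%N.
Proof.
move=> b_inc; pose P (i : 'I_m) := (t < i)%N; pose P' (i : 'I_m) := (t < (s^-1)%g i)%N.
have -> : (\sum_(j : 'I_m | t < j) b (s j) = \sum_(i | P' i) b i)%N.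
  rewrite [RHS](reindex_inj (@perm_inj _ s)) /=; apply: eq_bigl => j.
  by rewrite /P' permK.
have -> : #|[set j : 'I_m | (t < j)%N && (s j <= t)%N]| = #|[set i | P' i && ~~ P i]|.
  rewrite -[RHS](card_preimset _ (@perm_inj _ s)).
  by apply: eq_card => j; rewrite !inE /P' /P permK -leqNgt.
have cardPP' : #|[set i | P' i && ~~ P i]| = #|[set i | P i && ~~ P' i]|.
  have cP : #|[set i | P' i]| = #|[set i | P i]|.
    rewrite -(card_preimset _ (@perm_inj _ s)).
    by apply: eq_card => j; rewrite !inE /P' permK.
  have := cardsID [set i | P i] [set i | P' i].
  rewrite cP -(cardsID [set i | P' i] [set i | P i]) [in X in _ = X -> _]setIC.
  have -> : [set i | P' i] :\: [set i | P i] = [set i | P' i && ~~ P i].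
    by apply/setP => i; rewrite !inE andbC.
  have -> : [set i | P i] :\: [set i | P' i] = [set i | P i && ~~ P' i].
    by apply/setP => i; rewrite !inE andbC.
  by move/addnI.
rewrite (bigID P) [X in (_ <= X)%N](bigID P') /= -addnA.
rewrite (eq_bigl (fun i => P i && P' i)); last by move=> i; rewrite andbC.
rewrite leq_add2l; apply: (@leq_trans (#|[set i | P' i && ~~ P i]| * (b t).+1)%N).
  rewrite mulnS addnC leq_add2l -sum1dep_card big_distrl /=.
  apply: leq_sum => i /andP [_]; rewrite mul1n /P -leqNgt leq_eqVlt.
  by case/predU1P => [/val_inj ->//|/b_inc/ltnW].
rewrite cardPP' -sum1dep_card big_distrl /=.
by apply: leq_sum => i /andP [/b_inc ti _]; rewrite mul1n.
Qed.

Definition word_sum (c : 'I_d -> 'I_n) : nat := (\sum_k c k)%N.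

(** A repeated letter gives equal rows, and otherwise sorting gives alpha and the sign; both depend
    on the word only, not on the matrix. *)
Lemma minor_sort (c : 'I_d -> 'I_n) :
  (forall (R : comNzRingType) (M : 'M[R]_(n, d)), minor M c = 0) \/
  exists (alpha : grindex d n) (e : bool), word_sum c = index_sum alpha /\
    forall (R : comNzRingType) (M : 'M[R]_(n, d)),
      minor M c = (-1) ^+ e * plucker alpha M.
Proof.
have [/injectiveP c_inj|/injectivePn [k [l kl e]]] := boolP (injectiveb c); last first.
  left=> R M; apply: (determinant_alternate kl) => j.
  by rewrite !mxE e.
right; pose s := sort (relpre val leq) (codom_tuple c).
have ss : size s == d by rewrite size_sort size_tuple card_ord.
have srt : sorted ltn [seq val k | k <- Tuple ss].
  rewrite ltn_sorted_uniq_leq; apply/andP; split.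
    by rewrite (map_inj_uniq val_inj) sort_uniq; apply/injectiveP.
  rewrite sorted_map; apply: sort_sorted => x y; exact: leq_total.
have dc : size (codom_tuple c) == d by rewrite size_tuple card_ord.
have /tuple_permP [p hp] : perm_eq (Tuple ss) (Tuple dc) by rewrite perm_sort.
pose alpha := GrIndex srt; exists alpha, (p : bool).
have ap k : tnth alpha k = c (p k).
  have -> : tnth alpha k = nth (c k) s k by rewrite (tnth_nth (c k)).
  have -> : s = [tuple tnth (Tuple dc) (p i) | i < d] := hp.
  rewrite -tnth_nth tnth_mktuple (tnth_nth (c k)) /= codomE (nth_map k) ?size_enum_ord //.
  by rewrite nth_ord_enum.
split.
  by rewrite /word_sum (reindex_inj (@perm_inj _ p)); apply: eq_bigr => k _; rewrite ap.
move=> R M; have -> : plucker alpha M = minor M (c \o p).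
  by apply: eq_minor => k; rewrite ap.
by rewrite minor_perm mulrA -signr_addb addbb mul1r.
Qed.

Section Violation.

Variables (theta phi : grindex d n) (t : 'I_d).
Hypothesis phi_theta : (tnth phi t < tnth theta t)%N.

(* The strictly increasing word phi_0 < .. < phi_t < theta_t < .. < theta_(d-1). *)
Definition violation_word (j : 'I_d.+1) : 'I_n :=
  if (t < j)%N then (if unlift ord0 j is Some k then tnth theta k else tnth theta t)
  else if unlift ord_max j is Some k then tnth phi k else tnth phi t.

Local Notation b := violation_word.

Lemma violation_left (k : 'I_d) : (t <= k)%N -> b (lift ord0 k) = tnth theta k.
Proof. by move=> tk; rewrite /b /= ltnS tk liftK. Qed.

Lemma violation_right (k : 'I_d) : (k <= t)%N -> b (lift ord_max k) = tnth phi k.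
Proof. by move=> kt; rewrite /b lift_max ltnNge kt liftK. Qed.

Lemma violation_inc (i j : 'I_d.+1) : (i < j)%N -> (b i < b j)%N.
Proof.
have [[k -> tk]|[k -> kt]] := blockP t i; have [[l -> tl]|[l -> lt]] := blockP t j.
- by rewrite !violation_left // => kl; apply: tnth_ltn.
- rewrite lift_max /= /bump /= => kl.
  by move: (leq_trans kl lt); rewrite ltnNge leqW // leqW.
- move=> _; rewrite violation_left // violation_right //.
  apply: leq_ltn_trans (tnth_leq _ kt) _; apply: leq_trans phi_theta (tnth_leq _ tl).
- by rewrite !lift_max !violation_right // => kl; apply: tnth_ltn.
Qed.

Local Notation lw := (left_word theta t b).
Local Notation rw := (right_word phi t b).

Lemma violation_word1 : lw 1%g =1 tnth theta /\ rw 1%g =1 tnth phi.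
Proof.
split=> k; rewrite /left_word /right_word perm1; case: ifP => // h.
  exact: violation_left.
exact: violation_right.
Qed.

Lemma left_word_sum s : word_sum (lw s) =
  (\sum_(j : 'I_d.+1 | t < j) b (s j) + \sum_(k : 'I_d | ~~ (t <= k)) tnth theta k)%N.
Proof.
rewrite /word_sum (bigID (fun k : 'I_d => (t <= k)%N)) /=; congr (_ + _)%N.
  rewrite [RHS]big_mkcond big_ord_recl /= add0n -big_mkcond /=.
  by apply: eq_bigr => k tk; rewrite /left_word tk.
by apply: eq_bigr => k /negPf tk; rewrite /left_word tk.
Qed.

Lemma words_sum s : (word_sum (lw s) + word_sum (rw s) = index_sum theta + index_sum phi)%N.
Proof.
have E s' : (word_sum (lw s') + word_sum (rw s') =
    \sum_j b (s' j) + (\sum_(k : 'I_d | ~~ (t <= k)) tnth theta k +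
    \sum_(k : 'I_d | ~~ (k <= t)) tnth phi k))%N.
  rewrite left_word_sum (big_block _ t) /= /word_sum.
  rewrite [X in (_ + X)%N](bigID (fun k : 'I_d => (k <= t)%N)) /=.
  have -> : (\sum_(j : 'I_d.+1 | t < j) b (s' j) =
      \sum_(k : 'I_d | t <= k) b (s' (lift ord0 k)))%N.
    by rewrite big_mkcond big_ord_recl /= add0n -big_mkcond.
  rewrite -!addnA; congr (_ + _)%N; rewrite addnCA; congr (_ + _)%N.
    by apply: eq_bigr => k kt; rewrite /right_word kt.
  by congr (_ + _)%N; apply: eq_bigr => k /negPf kt; rewrite /right_word kt.
have [e1 e2] := violation_word1.
transitivity (word_sum (lw 1%g) + word_sum (rw 1%g))%N.
  rewrite !E; congr (_ + _)%N; rewrite [RHS](reindex_inj (@perm_inj _ s)).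
  by apply: eq_bigr => j _; rewrite perm1.
by congr (_ + _)%N; apply: eq_bigr => k _; rewrite ?e1 ?e2.
Qed.

(** Outside the stabilizer some position crosses t, and since the letters increase, the left word
    then loses weight. *)
Lemma left_word_lt s : s \notin block_stab t -> (word_sum (lw s) < index_sum theta)%N.
Proof.
move=> sN; have [e1 _] := violation_word1.
have -> : index_sum theta = word_sum (lw 1%g) by apply: eq_bigr => k _; rewrite e1.
rewrite !left_word_sum ltn_add2r.
have -> : (\sum_(j : 'I_d.+1 | t < j) b ((1%g : 'S_d.+1) j) =
    \sum_(j : 'I_d.+1 | t < j) b j)%N by apply: eq_bigr => j _; rewrite perm1.
have td : (t < d.+1)%N by apply: ltn_trans (ltn_ord t) _.
have := sum_top (Ordinal td) s violation_inc; apply: leq_trans.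
rewrite -addn1 leq_add2l; apply/card_gt0P; apply: contrapT => no.
case/negP: sN; pose A := [set j : 'I_d.+1 | (t < j)%N].
have sA : s @: A = A.
  apply/eqP; rewrite eqEcard card_imset ?leqnn ?andbT; last exact: perm_inj.
  apply/subsetP => _ /imsetP [j jA ->]; rewrite inE ltnNge; apply/negP => sj.
  by apply: no; exists j; rewrite inE sj andbT; move: jA; rewrite inE.
apply/block_stabP => j; apply: negb_inj; rewrite -!ltnNge.
have -> : (t < s j)%N = (s j \in s @: A) by rewrite sA inE.
by rewrite mem_imset ?inE //; exact: perm_inj.
Qed.

Lemma violation_relation (R : comNzRingType) (M : 'M[R]_(n, d)) :
  plucker theta M * plucker phi M =
  - \sum_(C in rcosets (block_stab t) [set: 'S_d.+1] | C != block_stab t)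
      exchange_term theta phi t b M (repr C).
Proof.
have := exchange_relation theta phi t b M; rewrite (bigD1 (block_stab t : {set _})) /=;
  last first.
  by apply/rcosetsP; exists 1%g; rewrite ?inE ?mulg1.
rewrite repr_group => /eqP; rewrite addr_eq0 => /eqP <-.
have [e1 e2] := violation_word1.
by rewrite /exchange_term odd_perm1 mul1r (eq_minor _ e1) (eq_minor _ e2).
Qed.

End Violation.

Definition chain_seq (T : seq (grindex d n)) : bool :=
  all (fun u => all (fun v => leI u v || leI v u) T) T.

(* Each exchange moves a pair of incomparable factors further apart, hence increases the
   sum of the squares of the index sums. *)
Lemma straighten (R : comNzRingType) (M : 'M[R]_(n, d)) (V : R -> Prop) (r : nat) :
  V 0 -> (forall x y, V x -> V y -> V (x + y)) -> (forall x, V x -> V (- x)) ->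
  (forall T, size T = r -> chain_seq T -> V (\prod_(u <- T) plucker u M)) ->
  forall T, size T = r -> V (\prod_(u <- T) plucker u M).
Proof.
move=> V0 VD VN Vchain.
pose mu (T : seq (grindex d n)) := (\sum_(u <- T) index_sum u ^ 2)%N.
have mu_le (T : seq (grindex d n)) : (mu T <= size T * (d * n) ^ 2)%N.
  rewrite /mu -sum1_size big_distrl /=; apply: leq_sum => u _; rewrite mul1n leq_exp2r //.
  exact: index_sum_le.
have Vsign (e : bool) x : V x -> V ((-1) ^+ e * x).
  by case: e => Vx; rewrite ?expr0 ?mul1r // expr1 mulN1r; apply: VN.
(* Index sums are at most d n, so [mu] is bounded on products of r factors and its increase
   terminates. *)
suff H m T : (r * (d * n) ^ 2 - mu T < m)%N -> size T = r -> V (\prod_(u <- T) plucker u M).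
  by move=> T; apply: H.
elim: m T => // m IH T; rewrite ltnS => muT sT.
have [chT|] := boolP (chain_seq T); first exact: Vchain.
case/allPn => u uT /allPn [v vT]; rewrite negb_or => /andP [uv vu].
(* The exchange takes weight from [u], so [u] must be the lighter factor for the sum of squares to
   grow. *)
wlog suv : u v uT vT uv vu / (index_sum u <= index_sum v)%N.
  by move=> h; case/orP: (leq_total (index_sum u) (index_sum v)); apply: h.
have uvN : v != u by apply: contraNneq uv => ->; apply: leI_refl.
pose T' := rem v (rem u T).
have vT' : v \in rem u T.
  by move: vT; rewrite (perm_mem (perm_to_rem uT)) inE (negPf uvN).
have pT : perm_eq T [:: u, v & T'].
  by rewrite (perm_trans (perm_to_rem uT)) // perm_cons perm_to_rem.
have [t vt] : exists t, (tnth v t < tnth u t)%N.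
  move: uv; rewrite negb_forall => /existsP [t]; rewrite -ltnNge => vt; by exists t.
rewrite (perm_big _ pT) /= !big_cons mulrA (violation_relation u v t) mulNr; apply: VN.
rewrite mulr_suml; apply: (big_ind V) => // C /andP [CH CN].
set s := repr C.
have sN : s \notin block_stab t.
  case/rcosetsP: CH CN => s0 _ eC; rewrite /s eC => CN.
  apply: contra CN => sH; apply/eqP; rewrite -[RHS](rcoset_id sH).
  by rewrite rcoset_repr.
have lt_l := left_word_lt vt sN; have sum_lr := words_sum u v t s.
have sT' : (size T').+2 = r by rewrite -sT (perm_size pT).
rewrite /exchange_term -mulrA; apply: (Vsign).
have [h0|[alpha [e1 [s1 h1]]]] := minor_sort (left_word u t (violation_word u v t) s).
  by rewrite h0 !mul0r.
have [h0|[beta [e2 [s2 h2]]]] := minor_sort (right_word v t (violation_word u v t) s).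
  by rewrite h0 mulr0 mul0r.
rewrite h1 h2.
have -> : (-1) ^+ e1 * plucker alpha M * ((-1) ^+ e2 * plucker beta M) *
     \prod_(j <- T') plucker j M =
  (-1) ^+ e1 * ((-1) ^+ e2 * \prod_(j <- [:: alpha, beta & T']) plucker j M).
  by rewrite !big_cons -!mulrA; congr (_ * _); rewrite mulrCA.
apply: (Vsign); apply: (Vsign); apply: IH; last by rewrite /= sT'.
move: muT.
have -> : mu T = (index_sum u ^ 2 + (index_sum v ^ 2 + mu T'))%N.
  by rewrite /mu (perm_big _ pT) !big_cons.
have := mu_le [:: alpha, beta & T']; rewrite /= sT' /mu !big_cons -/(mu T').
rewrite s1 in lt_l sum_lr; rewrite s2 in sum_lr.
move: sum_lr lt_l suv; clear.
move: (index_sum alpha) (index_sum beta) (index_sum u) (index_sum v) => a b x y.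
move=> e ax xy; set B := (r * _)%N => h1 h2; set m' := mu T' in h1 h2 *.
have : (x ^ 2 + y ^ 2 < a ^ 2 + b ^ 2)%N by rewrite -!mulnn; nia.
lia.
Qed.

End StandardMonomials.

(** * Richardson varieties on a chart *)

Lemma card_ord_leq m (k : 'I_m) : #|[pred j : 'I_m | (j <= k)%N]| = k.+1.
Proof.
rewrite -sum1_card (eq_bigl (fun j : 'I_m => (j < k.+1)%N)) //.
by rewrite -(big_ord_widen m (fun=> 1%N) (ltn_ord k)) sum1_card card_ord.
Qed.

Lemma card_ord_geq m (k : 'I_m) : #|[pred j : 'I_m | (rev_ord k <= j)%N]| = k.+1.
Proof.
rewrite -(card_ord_leq k) -(card_image (@rev_ord_inj m)).
apply: eq_card => j; rewrite -[j]rev_ordK mem_image; last exact: rev_ord_inj.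
rewrite !inE /=; have := ltn_ord j; have := ltn_ord k; clear; lia.
Qed.

Section ChartGeometry.

Variable K : fieldType.

Local Notation unit_cv i := (delta_mx i 0 : 'cV[K]_ _).

Definition coord_span m (P : pred 'I_m) : {vspace 'cV[K]_m} :=
  <<[seq unit_cv i | i <- enum 'I_m & P i]>>%VS.

Definition mulV m p (A : 'M[K]_(m, p)) : 'Hom('cV[K]_p, 'cV[K]_m) := linfun (mulmx A).

Lemma mulVE m p (A : 'M[K]_(m, p)) u : mulV A u = A *m u.
Proof. exact: lfunE. Qed.

Lemma cv_sum_delta m (u : 'cV[K]_m) : u = \sum_i u i 0 *: delta_mx i 0.
Proof.
apply/matrixP => i j; rewrite summxE (bigD1 i) //= !mxE (ord1 j) !eqxx mulr1.
by rewrite big1 ?addr0 // => k /negPf ki; rewrite !mxE eq_sym ki mulr0.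
Qed.

Lemma coord_spanP m (P : pred 'I_m) (u : 'cV[K]_m) :
  reflect (forall i, ~~ P i -> u i 0 = 0) (u \in coord_span P).
Proof.
apply: (iffP idP) => [uP i Pi|hu].
  pose A : 'rV[K]_m := delta_mx 0 i.
  have /subvP/(_ u uP) : (coord_span P <= lker (mulV A))%VS.
    apply/span_subvP => _ /mapP [j + ->]; rewrite mem_filter => /andP [Pj _].
    rewrite memv_ker mulVE mul_delta_mx_cond.
    by case: (i =P j) => [e|_]; [rewrite e Pj in Pi|rewrite mulr0n].
  rewrite memv_ker mulVE => /eqP /matrixP/(_ 0 0); rewrite !mxE (bigD1 i) //=.
  by rewrite !mxE !eqxx mul1r big1 ?addr0 // => k /negPf ki; rewrite !mxE ki mul0r.
rewrite [u]cv_sum_delta; apply: memv_suml => i _.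
have [Pi|Pi] := boolP (P i); last by rewrite hu // scale0r mem0v.
apply: memvZ; apply: memv_span; apply: map_f.
by rewrite mem_filter Pi mem_enum.
Qed.

Lemma dim_coord_span_le m (P : pred 'I_m) : (\dim (coord_span P) <= #|P|)%N.
Proof.
apply: leq_trans (dim_span _) _; rewrite size_map size_filter cardE size_filter.
by rewrite -enumT.
Qed.

Lemma dim_cV p : \dim {: 'cV[K]_p} = p.
Proof. by rewrite dimvf dim_matrix; exact: muln1. Qed.

Lemma dim_coord_span m (P : pred 'I_m) : \dim (coord_span P) = #|P|.
Proof.
apply/eqP; rewrite eqn_leq dim_coord_span_le /=.
(* The two spans fill the space, so their upper bounds, which add up to m, are both attained. *)
have full : (fullv <= coord_span P + coord_span (predC P))%VS.
  apply/subvP => u _; rewrite [u]cv_sum_delta (bigID P) /=.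
  apply: memv_add; apply: memv_suml => i Pi; apply: memvZ; apply/coord_spanP => j Pj.
    by rewrite mxE; case: eqP => // e; rewrite e Pi in Pj.
  by rewrite mxE; case: eqP => // e; rewrite /= e Pi in Pj.
have := leq_trans (dimvS full) (dimv_add_leqif _ _); rewrite dim_cV.
rewrite -[X in (X <= _)%N]card_ord -(cardC P) => h.
have := leq_trans h (leq_add (leqnn _) (dim_coord_span_le (predC P))).
by rewrite leq_add2r.
Qed.

Variables d n : nat.
Implicit Types (M : 'M[K]_(n, d)) (theta tau v w : grindex d n).

Lemma V_lowE t : V_low K n t = coord_span (fun i : 'I_n => (i < t)%N).
Proof. by []. Qed.

Lemma V_highE t : V_high K n t = coord_span (fun i : 'I_n => (n - t <= i)%N).
Proof. by []. Qed.

Lemma col_spanE M : col_span M = limg (mulV M).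
Proof.
apply: subv_anti; apply/andP; split.
  apply/span_subvP => _ /mapP [c _ ->]; apply/memv_imgP; exists (delta_mx c 0).
    exact: memvf.
  by rewrite mulVE -colE.
apply/subvP => _ /memv_imgP [y _ ->]; rewrite mulVE.
have -> : M *m y = \sum_c y c 0 *: col c M.
  rewrite {1}[y]cv_sum_delta mulmx_sumr; apply: eq_bigr => c _.
  by rewrite -scalemxAr -colE.
apply: memv_suml => c _; apply: memvZ; apply: memv_span; apply: map_f.
by rewrite mem_enum.
Qed.

Lemma mulV_inj M theta : plucker theta M != 0 -> lker (mulV M) == 0%VS.
Proof.
move=> pM; apply/eqP; apply/vspaceP => u; rewrite memv0 memv_ker mulVE.
apply/eqP/eqP => [Mu|->]; last by rewrite mulmx0.
have inv : rowsub (tnth theta) M \in unitmx by rewrite unitmxE unitfE.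
rewrite -[u](mulKmx inv) mul_rowsub_mx Mu.
have -> : rowsub (tnth theta) (0 : 'cV[K]_n) = 0 by apply/matrixP => i j; rewrite !mxE.
by rewrite mulmx0.
Qed.

Lemma dim_col_span M theta : plucker theta M != 0 -> \dim (col_span M) = d.
Proof.
move=> /mulV_inj /eqP kM; rewrite col_spanE limg_dim_eq ?dim_cV //.
by rewrite kM capv0.
Qed.

(** A nonzero minor makes the projection onto the rows theta injective on the column span, and the
    image of the intersection has no coordinates in Z. *)
Lemma dim_cap_le M theta (V : {vspace 'cV[K]_n}) (Z : pred 'I_d) :
  plucker theta M != 0 ->
  (forall u j, u \in V -> Z j -> u (tnth theta j) 0 = 0) ->
  (\dim (col_span M :&: V) <= #|predC Z|)%N.
Proof.
move=> pM hV; pose N : 'M[K]_(d, n) := rowsub (tnth theta) 1%:M.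
have NE m (A : 'M[K]_(n, m)) : N *m A = rowsub (tnth theta) A by rewrite mul_rowsub_mx mul1mx.
have inv : rowsub (tnth theta) M \in unitmx by rewrite unitmxE unitfE.
rewrite -(@limg_dim_eq _ _ _ (mulV N)).
  rewrite -dim_coord_span; apply: dimvS; apply/subvP => _ /memv_imgP [u uUV ->].
  rewrite mulVE NE; apply/coord_spanP => j /negPn Zj.
  by rewrite mxE; apply: hV => //; move: uUV; rewrite memv_cap => /andP[].
apply/vspaceP => u; rewrite memv0 memv_cap memv_ker mulVE NE.
apply/andP/eqP => [[]|->]; last first.
  by split; [exact: mem0v|apply/eqP/matrixP => i j; rewrite !mxE].
rewrite memv_cap col_spanE => /andP [/memv_imgP [y _ ->] _]; rewrite mulVE.
rewrite -{1}NE mulmxA NE => /eqP h.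
by rewrite -[y](mulKmx inv) h !mulmx0.
Qed.

(** If w_t < theta_t, the vectors of the flag space vanish in the rows theta_j with j >= t, and the
    intersection is one dimension too small. *)
Lemma plucker_schubert M theta w :
  schubert w (col_span M) -> plucker theta M != 0 -> leI theta w.
Proof.
move=> [_ hw] pM; apply/leIP => t; rewrite leqNgt; apply/negP => wt.
have := hw t; apply/negP; rewrite -ltnNge ltnS.
apply: leq_trans (dim_cap_le (Z := fun j : 'I_d => (t <= j)%N) pM _) _.
  move=> u j; rewrite V_lowE => /coord_spanP hu tj; apply: hu.
  by rewrite -leqNgt; apply: leq_trans wt (tnth_leq theta tj).
rewrite -[X in (_ <= X)%N](card_ord_ltn t); apply/eq_leq/eq_card => j.
by rewrite !inE -ltnNge.
Qed.

Lemma plucker_opp_schubert M theta v :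
  opp_schubert v (col_span M) -> plucker theta M != 0 -> leI v theta.
Proof.
move=> [_ hv] pM; apply/leIP => k; rewrite leqNgt; apply/negP => vk.
have := hv (rev_ord k); apply/negP; rewrite -ltnNge ltnS rev_ordK.
apply: leq_trans (dim_cap_le (Z := fun j : 'I_d => (j <= k)%N) pM _) _.
  move=> u j; rewrite V_highE => /coord_spanP hu jk; apply: hu.
  rewrite subKn; last exact: ltnW.
  by rewrite -ltnNge; apply: leq_ltn_trans (tnth_leq theta jk) vk.
rewrite -[X in (_ <= X)%N](card_ord_ltn (rev_ord k)).
rewrite -(card_preimset _ (@rev_ord_inj d)); apply/eq_leq/eq_card => j.
rewrite !inE -ltnNge /=; have := ltn_ord j; have := ltn_ord k; clear; lia.
Qed.

Lemma dim_img_inj (M : 'M[K]_(n, d)) (U : {vspace 'cV[K]_d}) :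
  lker (mulV M) == 0%VS -> \dim (mulV M @: U) = \dim U.
Proof. by move=> /eqP kM; rewrite limg_dim_eq // kM capv0. Qed.

(** Columns up to t lie in the flag space of w_t, columns from [rev_ord t] on in the opposite one,
    and M is injective. *)
Lemma band_richardson M theta w v :
  plucker theta M != 0 ->
  (forall i c, M i c != 0 -> (tnth v c <= i <= tnth w c)%N) ->
  richardson w v (col_span M).
Proof.
move=> pM band; have kM := mulV_inj pM.
have dimcap (P : pred 'I_d) (V : {vspace 'cV[K]_n}) :
    (mulV M @: coord_span P <= V)%VS -> (#|P| <= \dim (col_span M :&: V))%N.
  move=> PV; rewrite -dim_coord_span -(dim_img_inj _ kM) dimvS // subv_cap PV andbT.
  by rewrite col_spanE limgS // subvf.
have dimU := dim_col_span pM.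
split; split=> // t.
  rewrite -[X in (X <= _)%N](card_ord_leq t).
  apply: dimcap; apply/subvP => _ /memv_imgP [u /coord_spanP uP ->].
  rewrite V_lowE mulVE; apply/coord_spanP => i; rewrite -leqNgt => wi.
  rewrite mxE big1 // => c _; have [ct|tc] := leqP c t;
    last by rewrite uP ?mulr0 //= -ltnNge.
  have [->|/band /andP [_ iw]] := eqVneq (M i c) 0; first by rewrite mul0r.
  by have := leq_trans iw (tnth_leq w ct); rewrite leqNgt wi.
rewrite -[X in (X <= _)%N](card_ord_geq t).
apply: dimcap; apply/subvP => _ /memv_imgP [u /coord_spanP uP ->].
rewrite V_highE mulVE; apply/coord_spanP => i; rewrite subKn; last exact: ltnW.
rewrite -ltnNge => iv.
rewrite mxE big1 // => c _; have [tc|ct] := leqP (rev_ord t) c; last first.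
  by rewrite uP ?mulr0 //= -ltnNge.
have [->|/band /andP [vi _]] := eqVneq (M i c) 0; first by rewrite mul0r.
by have := leq_trans (tnth_leq v tc) vi; rewrite leqNgt iv.
Qed.

Lemma richardson_diag (D : 'I_n -> K) M theta w v :
  (forall i, D i != 0) -> plucker theta M != 0 ->
  richardson w v (col_span M) ->
  richardson w v (col_span (diag_mx (\row_i D i) *m M)).
Proof.
move=> DN pM [[_ hw] [_ hv]]; set DM := diag_mx _.
have DMu m (u : 'M_(n, m)) i j : (DM *m u) i j = D i * u i j.
  by rewrite mul_diag_mx !mxE.
have kD : lker (mulV DM) == 0%VS.
  apply/eqP/vspaceP => u; rewrite memv0 memv_ker mulVE.
  apply/eqP/eqP => [h|->]; last by rewrite mulmx0.
  apply/matrixP => i j; have := congr1 (fun A : 'cV_n => A i j) h.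
  by rewrite DMu !mxE => /eqP; rewrite mulf_eq0 (negPf (DN i)) => /eqP.
have pDM : plucker theta (DM *m M) != 0.
  have -> : plucker theta (DM *m M) = plucker theta M * \prod_t D (tnth theta t).
    rewrite /plucker.
    have -> : rowsub (tnth theta) (DM *m M) =
        diag_mx (\row_t D (tnth theta t)) *m rowsub (tnth theta) M.
      by apply/matrixP => i j; rewrite mxE DMu mul_diag_mx !mxE.
    rewrite det_mulmx det_diag mulrC; congr (_ * _).
    by apply: eq_bigr => t _; rewrite mxE.
  by rewrite mulf_neq0 //; apply/prodf_neq0 => t _.
have dimcap (P : pred 'I_n) m : (m <= \dim (col_span M :&: coord_span P))%N ->
    (m <= \dim (col_span (DM *m M) :&: coord_span P))%N.
  move=> h; apply: leq_trans h _.
  rewrite -(@limg_dim_eq _ _ _ (mulV DM)); last by rewrite (eqP kD) capv0.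
  apply: dimvS; apply/subvP => _ /memv_imgP [u + ->].
  rewrite !memv_cap mulVE => /andP [uM /coord_spanP uP]; apply/andP; split; last first.
    by apply/coord_spanP => i Pi; rewrite DMu uP // mulr0.
  move: uM; rewrite !col_spanE => /memv_imgP [y _ ->]; rewrite mulVE mulmxA.
  by apply/memv_imgP; exists y; rewrite ?memvf // mulVE.
have dimU := dim_col_span pDM.
by split; split=> // t; apply: dimcap; [apply: hw|apply: hv].
Qed.

Section Chart.

Variable tau : grindex d n.

Lemma chart_mx_in (R : pzRingType) (x : 'I_(chart_dim tau) -> R) a c :
  chart_mx x (tnth tau a) c = (a == c)%:R.
Proof.
rewrite mxE; case: insubP => [u|_]; first by rewrite mem_tnth.
by rewrite (inj_eq (@tnth_inj _ _ tau)).
Qed.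

Lemma chart_mx_out (R : pzRingType) (x : 'I_(chart_dim tau) -> R) i c
    (iN : i \notin (tau : seq 'I_n)) :
  chart_mx x i c = x (enum_rank ((Sub i iN, c) : chart_pos tau)).
Proof.
rewrite mxE; case: insubP => [u _ e|]; last by rewrite iN.
by congr (x (enum_rank (_, _))); apply: val_inj; rewrite /= e.
Qed.

Lemma plucker_chart (R : comNzRingType) (x : 'I_(chart_dim tau) -> R) :
  plucker tau (chart_mx x) = 1.
Proof.
rewrite /plucker -[RHS](det1 _ d); congr (\det _).
by apply/matrixP => i j; rewrite mxE chart_mx_in mxE.
Qed.

Lemma meval_plucker_poly theta (x : 'I_(chart_dim tau) -> K) :
  (plucker_poly K theta tau).@[x] = plucker theta (chart_mx x).
Proof.
rewrite /plucker_poly /plucker -(det_map_mx (meval x)); congr (\det _).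
apply/matrixP => i j; rewrite !mxE; case: insub => [u|].
  exact: mevalXU.
exact: rmorph_nat.
Qed.

Lemma plucker_mul theta M (g : 'M[K]_d) : plucker theta (M *m g) = plucker theta M * \det g.
Proof. by rewrite /plucker -det_mulmx mul_rowsub_mx. Qed.

(** Multiplying on the right by the inverse of the rows tau keeps the column span and scales all
    minors by one factor. *)
Lemma chart_of_matrix M : plucker tau M != 0 ->
  exists x : 'I_(chart_dim tau) -> K, chart x = col_span M /\
    forall theta, plucker theta (chart_mx x) = plucker theta M / plucker tau M.
Proof.
move=> pM; have inv : rowsub (tnth tau) M \in unitmx by rewrite unitmxE unitfE.
set g := invmx (rowsub (tnth tau) M).
pose x (k : 'I_(chart_dim tau)) : K :=
  let e : chart_pos tau := enum_val k in (M *m g) (val e.1) e.2.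
have ex : chart_mx x = M *m g.
  apply/matrixP => i c; have [|iN] := boolP (i \in (tau : seq 'I_n)).
    move=> /tnthP [a ->]; rewrite chart_mx_in.
    transitivity ((rowsub (tnth tau) M *m g) a c); first by rewrite mulmxV // mxE.
    by rewrite mul_rowsub_mx mxE.
  by rewrite chart_mx_out /x enum_rankK.
exists x; split.
  rewrite /chart ex !col_spanE; apply: subv_anti; apply/andP.
  split; apply/subvP => _ /memv_imgP [y _ ->]; rewrite mulVE; apply/memv_imgP.
    by exists (g *m y); rewrite ?memvf // mulVE mulmxA.
  exists (rowsub (tnth tau) M *m y); rewrite ?memvf // mulVE -!mulmxA [g *m _]mulmxA.
  by rewrite mulVmx // mul1mx.
by move=> theta; rewrite ex plucker_mul det_inv.
Qed.

(* Scaling the chart is the action of a diagonal matrix, which preserves both flags. *)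
Lemma chart_scale (s : K) (x : 'I_(chart_dim tau) -> K) w v : s != 0 ->
  richardson w v (chart x) -> richardson w v (chart (fun k => s * x k)).
Proof.
move=> sN; pose D i : K := if i \in (tau : seq 'I_n) then 1 else s.
have DN i : D i != 0 by rewrite /D; case: ifP; rewrite ?oner_neq0.
rewrite /chart => hx.
have -> : chart_mx (fun k => s * x k) = diag_mx (\row_i D i) *m chart_mx x.
  apply/matrixP => i c; rewrite mul_diag_mx [RHS]mxE [X in _ = X * _]mxE /D.
  case: ifPn => [/tnthP [a ->]|iN]; first by rewrite !chart_mx_in mul1r.
  by rewrite !chart_mx_out.
by apply: (richardson_diag (theta := tau)) => //; rewrite plucker_chart oner_neq0.
Qed.

Lemma richardson_origin w v : leI tau w -> leI v tau ->
  richardson w v (chart (fun _ : 'I_(chart_dim tau) => (0 : K))).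
Proof.
move=> /leIP tw /leIP vt; apply: (band_richardson (theta := tau)).
  by rewrite plucker_chart oner_neq0.
move=> i c; have [/tnthP [a ->]|iN] := boolP (i \in (tau : seq 'I_n)).
  by rewrite chart_mx_in; case: (a =P c) => [->|_]; rewrite ?vt ?tw // eqxx.
by rewrite chart_mx_out // eqxx.
Qed.

Lemma richardson_plucker w v theta (x : 'I_(chart_dim tau) -> K) :
  richardson w v (chart x) -> ~~ (leI v theta && leI theta w) ->
  (plucker_poly K theta tau).@[x] = 0.
Proof.
move=> [hw hv] nvw; rewrite meval_plucker_poly; apply/eqP/negPn/negP => pN.
case/negP: nvw; rewrite (plucker_opp_schubert hv pN).
exact: plucker_schubert hw pN.
Qed.

End Chart.
End ChartGeometry.

(** * Linear independence of standard monomials *)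

(** Induction on the number of variables: the coefficient [c] of a power of the last variable that
    occurs in p is nonzero at some x', and this leaves a nonzero polynomial in one variable. *)
Lemma mpoly_nonzero_eval (K : closedFieldType) N (p : {mpoly K[N]}) :
  p != 0 -> exists x : 'I_N -> K, p.@[x] != 0.
Proof.
elim: N p => [|N IH] p pN0.
  have [c pc] : exists c, p = c%:MP by exists p@_0%MM; exact: nvar0_mpolyC.
  by exists (fun=> 0); move: pN0; rewrite pc mevalC mpolyC_eq0.
pose restr (m : 'X_{1..N.+1}) : 'X_{1..N} := [multinom m (widen_ord (leqnSn N) i) | i < N].
have restr_inj (m m' : 'X_{1..N.+1}) : m ord_max = m' ord_max -> restr m = restr m' -> m = m'.
  move=> em /mnmP er; apply/mnmP => i; have [j ->|-> //] := unliftP ord_max i.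
  have := er j; rewrite !mnmE; suff -> : widen_ord (leqnSn N) j = lift ord_max j by [].
  by apply: val_inj; rewrite /= /bump leqNgt ltn_ord.
pose m0 := mlead p; have m0s : m0 \in msupp p := mlead_supp pN0.
pose c : {mpoly K[N]} := \sum_(m <- msupp p | m ord_max == m0 ord_max) p@_m *: 'X_[restr m].
have [x' cx'] : exists x' : 'I_N -> K, c.@[x'] != 0.
  apply: IH; apply: contraTneq m0s => c0; rewrite mcoeff_msupp negbK.
  have := congr1 (mcoeff (restr m0)) c0; rewrite mcoeff0 linear_sum /=.
  have [ms|ms] := boolP (m0 \in msupp p); last by rewrite mcoeff_eq0.
  rewrite big_mkcond (bigD1_seq m0) ?msupp_uniq //= eqxx mcoeffZ mcoeffX eqxx mulr1.
  rewrite big1 ?addr0 => [->//|m mm0]; case: eqP => // em.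
  rewrite mcoeffZ mcoeffX; case: eqP => [er|_]; last by rewrite mulr0.
  by rewrite (restr_inj _ _ em er) eqxx in mm0.
pose q : {poly K} := \sum_(m <- msupp p)
  (p@_m * \prod_(i < N) x' i ^+ restr m i) *: 'X^(m ord_max).
have qN0 : q != 0.
  apply: contra cx' => /eqP q0; have := congr1 (fun q : {poly K} => q`_(m0 ord_max)) q0.
  rewrite coef0 coef_sum => e; apply/eqP; rewrite -[RHS]e /c linear_sum big_mkcond /=.
  apply: eq_bigr => m _; rewrite coefZ coefXn eq_sym.
  by case: eqP => _; rewrite ?mulr0 // mulr1 mevalZ mevalX.
have [s] := closed_nonrootP q qN0.
rewrite /root => qs; exists (fun i => if unlift ord_max i is Some j then x' j else s).
apply: contra qs => /eqP p0; apply/eqP; rewrite -[RHS]p0 mevalE horner_sum.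
apply: eq_bigr => m _; rewrite hornerZ hornerXn big_ord_recr /= unlift_none -mulrA.
congr (_ * (_ * _)); apply: eq_bigr => i _; rewrite mnmE.
have -> : widen_ord (leqnSn N) i = lift ord_max i.
  by apply: val_inj; rewrite /= /bump leqNgt ltn_ord.
by rewrite liftK.
Qed.

Lemma mpoly_eval_eq0 (K : closedFieldType) N (p : {mpoly K[N]}) :
  (forall x, p.@[x] = 0) -> p = 0.
Proof.
move=> h; apply/eqP/negPn/negP => /mpoly_nonzero_eval [x]; by rewrite h eqxx.
Qed.

(** * Leading monomials with respect to a weight *)

Section LeadingWeight.

Variables (K : fieldType) (N : nat) (wgt : 'I_N -> nat).
Implicit Types (p q : {mpoly K[N]}) (m : 'X_{1..N}) (W : nat).

Definition mnm_weight m : nat := (\sum_k m k * wgt k)%N.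

Lemma mnm_weightD m m' : mnm_weight (m + m')%MM = (mnm_weight m + mnm_weight m')%N.
Proof.
by rewrite /mnm_weight -big_split; apply: eq_bigr => k _; rewrite mnmDE mulnDl.
Qed.

Definition weight_lt W p := forall m, p@_m != 0 -> (mnm_weight m < W)%N.

Lemma weight_ltD W p q : weight_lt W p -> weight_lt W q -> weight_lt W (p + q).
Proof.
move=> hp hq m; rewrite mcoeffD => h.
have [p0|/hp //] := eqVneq p@_m 0; apply: hq.
by rewrite p0 add0r in h.
Qed.

Lemma weight_lt_sum W (I : Type) (r : seq I) (P : pred I) (F : I -> {mpoly K[N]}) :
  (forall i, P i -> weight_lt W (F i)) -> weight_lt W (\sum_(i <- r | P i) F i).
Proof.
move=> h; apply: (big_ind (weight_lt W)) => //; last exact: weight_ltD.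
by move=> m; rewrite mcoeff0 eqxx.
Qed.

(** The bound [W.+1] expresses weight at most W, so that only one factor has to be strict. *)
Lemma weight_ltM W W' p q : weight_lt W.+1 p -> weight_lt W' q -> weight_lt (W + W') (p * q).
Proof.
move=> hp hq m; rewrite -mcoeff_msupp => /msuppM_le /allpairsP [[m1 m2] /= []].
rewrite !mcoeff_msupp => /hp h1 /hq h2 ->; rewrite mnm_weightD -addnS leq_add //.
Qed.

Lemma weight_ltX m : weight_lt (mnm_weight m).+1 'X_[m].
Proof. by move=> m'; rewrite mcoeffX; have [->|_] := eqVneq m m'; rewrite ?eqxx. Qed.

(* [m] is the monomial of [p] of strictly largest weight, with coefficient 1. *)
Definition leading m p := weight_lt (mnm_weight m) (p - 'X_[m]).

Lemma leading_le m p : leading m p -> weight_lt (mnm_weight m).+1 p.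
Proof.
move=> h; rewrite -[p](subrK 'X_[m]); apply: weight_ltD; last exact: weight_ltX.
by move=> m' /h /ltnW.
Qed.

Lemma leadingM m m' p q : leading m p -> leading m' q -> leading (m + m')%MM (p * q).
Proof.
move=> hp hq; rewrite /leading mnm_weightD.
have -> : p * q - 'X_[m + m'] = p * (q - 'X_[m']) + 'X_[m'] * (p - 'X_[m]).
  by rewrite mpolyXD; ring.
apply: weight_ltD; first by apply: weight_ltM hq; apply: leading_le.
by rewrite addnC; apply: weight_ltM hp; apply: weight_ltX.
Qed.

Lemma leading1 : leading 0%MM 1.
Proof. by move=> m; rewrite mpolyX0 subrr mcoeff0 eqxx. Qed.

Lemma leading_exp m p k : leading m p -> leading (m *+ k)%MM (p ^+ k).
Proof.
move=> h; elim: k => [|k IH]; first by rewrite mulm0n expr0; exact: leading1.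
by rewrite mulmS exprS; apply: leadingM.
Qed.

Lemma leading_prod (I : Type) (r : seq I) (P : pred I) (m : I -> 'X_{1..N}) F :
  (forall i, P i -> leading (m i) (F i)) ->
  leading (\big[+%MM/0%MM]_(i <- r | P i) m i) (\prod_(i <- r | P i) F i).
Proof.
move=> h; elim/big_rec2: _ => [|i m' p Pi]; first exact: leading1.
by apply: leadingM; apply: h.
Qed.

Lemma leading_coef m p : leading m p -> p@_m = 1.
Proof.
move=> h; have [e|/h] := eqVneq (p - 'X_[m])@_m 0; last by rewrite ltnn.
by move/eqP: e; rewrite mcoeffB mcoeffX eqxx subr_eq0 => /eqP.
Qed.

Lemma leading_coef0 m m' p : leading m p -> m' != m ->
  (mnm_weight m <= mnm_weight m')%N -> p@_m' = 0.
Proof.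
move=> h mm' le_mm'; have [e|/h] := eqVneq (p - 'X_[m])@_m' 0;
  last by rewrite ltnNge le_mm'.
by move/eqP: e; rewrite mcoeffB mcoeffX [m == _]eq_sym (negPf mm') subr0 => /eqP.
Qed.

(** Among the terms with nonzero coefficient take one of maximal weight: its leading monomial occurs
    in no other term, since equally heavy terms have other leading monomials and all remaining
    monomials are lighter. *)
Lemma leading_free (T : eqType) (r : seq T) (m : T -> 'X_{1..N}) (F : T -> {mpoly K[N]})
    (c : T -> K) : uniq r -> {in r &, injective m} ->
  (forall i, i \in r -> leading (m i) (F i)) ->
  \sum_(i <- r) c i *: F i = 0 -> forall i, i \in r -> c i = 0.
Proof.
move=> ur m_inj lead sum0; apply: contrapT => /existsNP [i /not_implyP [ir /eqP ci]].
pose r' := [seq j <- r | c j != 0].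
have [j [jr' maxj]] : exists j, j \in r' /\
    {in r', forall j', mnm_weight (m j') <= mnm_weight (m j)}%N.
  have ir' : i \in r' by rewrite mem_filter ci.
  have : r' != [::] by apply/eqP => e; rewrite e in ir'.
  clear ir'; elim: r' => // a [|b s] IHs _.
    by exists a; rewrite inE eqxx; split=> // j'; rewrite inE => /eqP ->.
  have [j [js maxj]] := IHs isT.
  have [le|lt] := leqP (mnm_weight (m a)) (mnm_weight (m j)).
    exists j; rewrite inE js orbT; split=> // j'; rewrite inE => /predU1P [->//|/maxj //].
  exists a; rewrite inE eqxx; split=> // j'; rewrite inE => /predU1P [->//|/maxj h].
  exact: leq_trans h (ltnW lt).
move: jr'; rewrite mem_filter => /andP [/negP cj jr]; apply: cj.
have := congr1 (mcoeff (m j)) sum0; rewrite mcoeff0 linear_sum /= (bigD1_seq j) //=.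
rewrite mcoeffZ (leading_coef (lead j jr)) mulr1 big_seq_cond.
rewrite big1 ?addr0 => [->//|j' /andP [j'r jj']].
rewrite mcoeffZ; have [->|cj'] := eqVneq (c j') 0; first by rewrite mul0r.
rewrite (leading_coef0 (lead j' j'r)) ?mulr0 //.
  by apply: contraNneq jj' => /(m_inj _ _ jr j'r) ->.
by apply: maxj; rewrite mem_filter cj'.
Qed.

End LeadingWeight.

(** * Minors of a generic band matrix *)

Section Band.

Variables (K : fieldType) (d n : nat) (v w : grindex d n).
Implicit Type theta : grindex d n.

Definition band_dim : nat := #|{: 'I_n * 'I_d}|.

Definition band_var (i : 'I_n) (c : 'I_d) : 'I_band_dim := enum_rank (i, c).

(* The column span of an evaluation of this matrix lies in the Richardson variety of
   [w] and [v], and a minor of it is nonzero iff its index lies in [[v, w]]. *)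
Definition band_mx : 'M[{mpoly K[band_dim]}]_(n, d) :=
  \matrix_(i, c) if (tnth v c <= i <= tnth w c)%N then 'X_(band_var i c) else 0.

(** The weight i c of the entry in row i and column c makes the diagonal term of each minor the
    heaviest one, by the rearrangement inequality. *)
Definition band_weight (k : 'I_band_dim) : nat :=
  let p : 'I_n * 'I_d := enum_val k in (p.1 * p.2)%N.

Lemma band_weightE i c : band_weight (band_var i c) = (i * c)%N.
Proof. by rewrite /band_weight /band_var enum_rankK. Qed.

Definition diag_mnm (theta : grindex d n) : 'X_{1..band_dim} :=
  (\sum_c U_(band_var (tnth theta c) c))%MM.

Lemma diag_mnmE theta i c : diag_mnm theta (band_var i c) = (tnth theta c == i) :> nat.
Proof.
rewrite /diag_mnm mnm_sumE (bigD1 c) //= mnm1E big1 ?addn0.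
  by rewrite (inj_eq enum_rank_inj) xpair_eqE eqxx andbT.
move=> c' /negPf cc'; rewrite mnm1E (inj_eq enum_rank_inj) xpair_eqE.
by rewrite cc' andbF.
Qed.

Lemma mnm_weight_sum (wgt : 'I_band_dim -> nat) (I : Type) (r : seq I) (P : pred I)
    (m : I -> 'X_{1..band_dim}) :
  mnm_weight wgt (\big[+%MM/0%MM]_(i <- r | P i) m i) =
  (\sum_(i <- r | P i) mnm_weight wgt (m i))%N.
Proof.
apply: (big_morph (mnm_weight wgt)); first exact: mnm_weightD.
by rewrite /mnm_weight big1 // => k _; rewrite mnm0E.
Qed.

Lemma mnm_weightU (wgt : 'I_band_dim -> nat) k : mnm_weight wgt U_(k)%MM = wgt k.
Proof.
rewrite /mnm_weight (bigD1 k) //= mnm1E eqxx mul1n big1 ?addn0 // => l.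
by rewrite mnm1E eq_sym => /negPf ->.
Qed.

Lemma mnm_weight_diag theta :
  mnm_weight band_weight (diag_mnm theta) = (\sum_c tnth theta c * c)%N.
Proof.
rewrite /diag_mnm mnm_weight_sum; apply: eq_bigr => c _.
by rewrite mnm_weightU band_weightE.
Qed.

(** Writing the factor j as the number of k < j splits both sides into sums over j > k. [sum_top]
    compares them for each k, strictly at k = [u j0], which [j0] crosses. *)
Lemma rearrangement theta (s : 'S_d) : s != 1%g ->
  (\sum_c tnth theta c * s c < \sum_c tnth theta c * c)%N.
Proof.
move=> sN1; pose u := (s^-1)%g.
have layer (f : 'I_d -> 'I_d) : (\sum_j tnth theta (f j) * j =
    \sum_(k < d) \sum_(j : 'I_d | k < j) tnth theta (f j))%N.
  rewrite (exchange_big_dep xpredT) //=; apply: eq_bigr => j _.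
  by rewrite -{1}(card_ord_ltn j) sum_nat_const cardsE mulnC.
have -> : (\sum_c tnth theta c * s c = \sum_j tnth theta (u j) * j)%N.
  rewrite [RHS](reindex_inj (@perm_inj _ s)); apply: eq_bigr => c _.
  by rewrite permK.
rewrite (layer u) (layer id).
have theta_inc (i j : 'I_d) : (i < j)%N -> (tnth theta i < tnth theta j)%N by apply: tnth_ltn.
(* If u lowered no position, equality of the total sums would make it the identity. *)
have [j0 uj0] : exists j : 'I_d, (u j < j)%N.
  apply: contrapT => no; case/negP: sN1; rewrite -invg_eq1 -/u; apply/eqP/permP => j.
  have ge (i : 'I_d) : (i <= u i)%N by rewrite leqNgt; apply/negP => h; apply: no; exists i.
  have e : (\sum_(i < d) u i = \sum_(i < d) i)%N.
    by rewrite [RHS](reindex_inj (@perm_inj _ u)).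
  rewrite perm1; apply/val_inj/eqP; rewrite eqn_leq ge andbT.
  move: e; rewrite (bigD1 j) // [RHS](bigD1 j) //= => e.
  have : (\sum_(i < d | i != j) i <= \sum_(i | i != j) u i)%N by apply: leq_sum.
  move: e; clear; move: (\sum_(i | i != j) u i)%N (\sum_(i < d | i != j) i)%N => a b.
  lia.
rewrite (bigD1 (u j0)) // [X in (_ < X)%N](bigD1 (u j0)) //= -addSn leq_add //.
  apply: leq_trans (sum_top (u j0) u theta_inc).
  rewrite -addn1 leq_add2l; apply/card_gt0P; exists j0.
  by rewrite inE uj0 leqnn.
apply: leq_sum => k _; apply: leq_trans (sum_top k u theta_inc).
exact: leq_addr.
Qed.

Lemma weight_ltN N (wgt : 'I_N -> nat) W (p : {mpoly K[N]}) :
  weight_lt wgt W p -> weight_lt wgt W (- p).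
Proof. by move=> h m; rewrite mcoeffN oppr_eq0; apply: h. Qed.

(** The diagonal lies within the band exactly because v <= theta <= w; every other term is zero or
    lighter by the rearrangement inequality. *)
Lemma leading_plucker theta : leI v theta -> leI theta w ->
  leading band_weight (diag_mnm theta) (plucker theta band_mx).
Proof.
move=> /leIP vt /leIP tw; rewrite /leading /plucker /determinant (bigD1 1%g) //=.
have -> : (-1) ^+ (1%g : 'S_d) * \prod_i rowsub (tnth theta) band_mx i ((1%g : 'S_d) i) =
    'X_[diag_mnm theta].
  rewrite odd_perm1 mul1r /diag_mnm.
  rewrite (big_morph (fun m => 'X_[m] : {mpoly K[band_dim]}) (@mpolyXD _ _) (@mpolyX0 _ _)).
  by apply: eq_bigr => c _; rewrite perm1 !mxE vt tw.
rewrite [X in weight_lt _ _ X]addrC addrA addNr add0r.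
apply: weight_lt_sum => s sN1.
suff H : weight_lt band_weight (mnm_weight band_weight (diag_mnm theta))
    (\prod_i rowsub (tnth theta) band_mx i (s i)).
  by case: (odd_perm s); rewrite ?expr1 ?mulN1r ?expr0 ?mul1r //; apply: weight_ltN.
rewrite mnm_weight_diag => m hm; apply: leq_trans (rearrangement theta sN1).
suff : weight_lt band_weight (\sum_c tnth theta c * s c).+1
    (\prod_i rowsub (tnth theta) band_mx i (s i)) by apply.
elim/big_rec2: _ => [|c p W _ IH].
  move=> m'; rewrite -mpolyX0 mcoeffX; case: (0%MM =P m') => [<-|_]; rewrite ?eqxx //.
  by rewrite /mnm_weight big1 // => k _; rewrite mnm0E.
rewrite -addnS; apply: weight_ltM IH; rewrite !mxE; case: ifP => _.
  by rewrite -band_weightE -mnm_weightU; apply: weight_ltX.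
by move=> m'; rewrite mcoeff0 eqxx.
Qed.

End Band.

(** * Recovering a multichain from its diagonal monomial *)

Section ChainRecovery.

Variables d n : nat.
Hypothesis d_gt0 : (0 < d)%N.
Implicit Types (A : {ffun grindex d n -> nat}) (theta phi : grindex d n).

Definition chain_support A := forall theta phi,
  A theta != 0%N -> A phi != 0%N -> leI theta phi \/ leI phi theta.

Definition multiset_mnm A : 'X_{1..band_dim d n} :=
  (\sum_theta diag_mnm theta *+ A theta)%MM.

Definition mass_above A phi : nat := (\sum_(theta : grindex d n | leI phi theta) A theta)%N.

(** This mass can be read off from the monomial; on a chain, its minimum over the columns is the
    mass above phi. *)
Definition column_mass A (c : 'I_d) (i : 'I_n) : nat :=
  (\sum_(theta : grindex d n | i <= tnth theta c) A theta)%N.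

Lemma column_massE A c i : column_mass A c i =
  (\sum_(j : 'I_n | i <= j) multiset_mnm A (band_var j c))%N.
Proof.
rewrite /multiset_mnm; under [RHS]eq_bigr do rewrite mnm_sumE.
rewrite exchange_big /= /column_mass big_mkcond; apply: eq_bigr => theta _.
under [RHS]eq_bigr do rewrite mulmnE diag_mnmE.
case: ifP => ti; last first.
  rewrite big1 // => j ij; case: eqP => // e; by rewrite e ij in ti.
rewrite (bigD1 (tnth theta c)) //= eqxx mul1n big1 ?addn0 // => j /andP [_].
by rewrite eq_sym => /negPf ->.
Qed.

Lemma mass_above_le A phi c : (mass_above A phi <= column_mass A c (tnth phi c))%N.
Proof.
rewrite /mass_above /column_mass big_mkcond [X in (_ <= X)%N]big_mkcond.
apply: leq_sum => theta _; case: ifP => // /leIP -> //.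
Qed.

(* [c] is a coordinate at which the largest element of the support not above [phi]
   drops below [phi]. *)
Lemma mass_above_eq A phi : chain_support A ->
  exists c, mass_above A phi = column_mass A c (tnth phi c).
Proof.
move=> chA.
have [c hc] : exists c : 'I_d, forall theta : grindex d n, A theta != 0%N ->
    (tnth phi c <= tnth theta c)%N -> leI phi theta.
  have [t0 t0P|no] :=
    pickP [pred theta : grindex d n | (A theta != 0%N) && ~~ leI phi theta]; last first.
    by exists (Ordinal d_gt0) => theta At _; have := no theta; rewrite /= At => /negbFE.
  case: (arg_maxnP (@index_sum d n) t0P) => t1 /= /andP [At1 nt1] max1.
  have [c hc] : exists c, (tnth t1 c < tnth phi c)%N.
    by move: nt1; rewrite negb_forall => /existsP [c]; rewrite -ltnNge; exists c.
  exists c => theta At phit; apply/negPn/negP => nt.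
  have tt1 : leI theta t1.
    have [//|t1t] := chA theta t1 At At1.
    have [->|tN] := eqVneq t1 theta; first exact: leI_refl.
    have h : (index_sum theta <= index_sum t1)%N by apply: max1; rewrite At nt.
    by have := index_sum_lt t1t tN; rewrite ltnNge h.
  by have /leIP/(_ c) := tt1; rewrite leqNgt (leq_trans hc phit).
exists c; rewrite /mass_above /column_mass big_mkcond [RHS]big_mkcond.
apply: eq_bigr => theta _; case: ifP => [/leIP -> //|nt]; case: ifP => // ct.
have [->//|At] := eqVneq (A theta) 0%N.
by rewrite (hc theta At ct) in nt.
Qed.

Lemma multiset_mnm_inj A A' : chain_support A -> chain_support A' ->
  multiset_mnm A = multiset_mnm A' -> A = A'.
Proof.
move=> chA chA' e.
have colE c i : column_mass A c i = column_mass A' c i by rewrite !column_massE e.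
have massE phi : mass_above A phi = mass_above A' phi.
  apply/eqP; rewrite eqn_leq; apply/andP; split.
    by have [c ->] := mass_above_eq phi chA'; rewrite -colE mass_above_le.
  by have [c ->] := mass_above_eq phi chA; rewrite colE mass_above_le.
apply/ffunP => theta0; apply/eqP/negPn/negP => ne0.
(* At a phi of maximal index sum where A and A' differ, the masses above phi differ only in the term
   of phi itself. *)
case: (@arg_maxnP _ theta0 (fun theta : grindex d n => A theta != A' theta)
  (@index_sum d n) ne0).
move=> phi /eqP ne max_phi; apply: ne; have := massE phi.
rewrite /mass_above (bigD1 phi) ?leI_refl //= [RHS](bigD1 phi) ?leI_refl //=.
rewrite [X in (_ + X = _)%N](eq_bigr A'); first exact: addIn.
move=> theta /andP [pt tp]; apply/eqP/negPn/negP => ne.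
have h : (index_sum theta <= index_sum phi)%N by apply: max_phi.
by have := index_sum_lt pt; rewrite eq_sym tp => /(_ isT); rewrite ltnNge h.
Qed.

End ChainRecovery.

(** * The coordinate ring of a chart *)

Lemma dhomog_prod_fin (R : comNzRingType) N (I : Type) (r : seq I) (P : pred I)
    (F : I -> {mpoly R[N]}) (e : I -> nat) :
  (forall i, P i -> F i \is (e i).-homog) ->
  \prod_(i <- r | P i) F i \is (\sum_(i <- r | P i) e i)%N.-homog.
Proof.
move=> h; elim/big_rec2: _ => [|i k p Pi]; first exact: dhomog1.
by apply: dhomogM; apply: h.
Qed.

Lemma prod_count (R : comNzRingType) (T : finType) (F : T -> R) (S : seq T) :
  \prod_(u <- S) F u = \prod_u F u ^+ count_mem u S.
Proof.
elim: S => [|x S IH]; first by rewrite big_nil big1.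
rewrite big_cons IH; under [RHS]eq_bigr do rewrite /= exprD.
rewrite big_split /=; congr (_ * _); rewrite (bigD1 x) //= eqxx expr1.
by rewrite big1 ?mulr1 // => u; rewrite eq_sym => /negPf ->.
Qed.

Lemma sum_count (T : finType) (F : T -> nat) (S : seq T) :
  (\sum_(u <- S) F u = \sum_u count_mem u S * F u)%N.
Proof.
elim: S => [|x S IH]; first by rewrite big_nil big1.
rewrite big_cons IH; under [RHS]eq_bigr do rewrite /= mulnDl.
rewrite big_split /=; congr (_ + _)%N; rewrite (bigD1 x) //= eqxx mul1n.
by rewrite big1 ?addn0 // => u; rewrite eq_sym => /negPf ->.
Qed.

Lemma mevalXn (R : comNzRingType) N (x : 'I_N -> R) (q : {mpoly R[N]}) k :
  (q ^+ k).@[x] = q.@[x] ^+ k.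
Proof. exact: rmorphXn. Qed.

Section ChartRing.

Variables (K : closedFieldType) (d n : nat) (tau : grindex d n).
Implicit Types (theta v w u : grindex d n) (a : {ffun grindex d n -> nat}).

Local Notation N := (chart_dim tau).
Local Notation f := (fun u : grindex d n => plucker_poly K u tau).

(** The degree of f_theta when it is nonzero: rows in tau are constant and the others linear in the
    coordinates. *)
Definition index_defect theta : nat := #|[pred t | tnth theta t \notin (tau : seq 'I_n)]|.

Lemma index_defect_gt0 theta : theta != tau -> (0 < index_defect theta)%N.
Proof.
apply: contraNT; rewrite lt0n negbK => /eqP d0.
have sub : {subset (theta : seq 'I_n) <= (tau : seq 'I_n)}.
  move=> i /tnthP [t ->]; apply/negPn/negP => it.
  by have /eqP := d0; rewrite eqn0Ngt; case/negP; apply/card_gt0P; exists t.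
have [|_ mem] := uniq_min_size (index_uniq theta) sub; first by rewrite !size_tuple.
apply/eqP/val_inj/val_inj/(inj_map val_inj) => /=.
apply: (irr_sorted_eq ltn_trans ltnn (valP theta) (valP tau)).
by move=> i; apply/mapP/mapP => -[j jt ->]; exists j => //; rewrite ?mem // -mem.
Qed.

Lemma index_defect_tau : index_defect tau = 0%N.
Proof. by apply: eq_card0 => t; rewrite inE mem_tnth. Qed.

Lemma plucker_poly_homog theta : f theta \is (index_defect theta).-homog.
Proof.
rewrite /plucker_poly /plucker /determinant; apply: rpred_sum => s _.
suff h : \prod_i rowsub (tnth theta) (generic_mx K tau) i (s i) \is (index_defect theta).-homog.
  by case: (odd_perm s); rewrite ?expr1 ?mulN1r ?expr0 ?mul1r // dhomogN.
have -> : index_defect theta = (\sum_t (tnth theta t \notin (tau : seq 'I_n)))%N.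
  by rewrite /index_defect -sum1_card big_mkcond; apply: eq_bigr => t _; rewrite inE;
    case: (_ \notin _).
apply: dhomog_prod_fin => t _.
rewrite mxE /generic_mx; have [iN|/negPn/tnthP [c e]] := boolP (_ \notin _).
  by rewrite chart_mx_out dhomogX /= mdeg1.
rewrite e chart_mx_in; case: (c == _); [exact: dhomog1|exact: dhomog0].
Qed.

Lemma plucker_poly_tau : f tau = 1.
Proof. exact: plucker_chart. Qed.

Definition plucker_mono a : {mpoly K[N]} := \prod_u f u ^+ a u.

Local Notation wt := (weight index_defect).

Lemma plucker_mono_homog a : plucker_mono a \is (wt a).-homog.
Proof.
rewrite /plucker_mono /weight; apply: dhomog_prod_fin => u _.
by rewrite mulnC dhomogMn // plucker_poly_homog.
Qed.

(** Replacing the c-th entry of tau by the row i of the variable gives a minor with the variable as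
    its only nonzero term; sorting adds the sign. *)
Lemma variable_plucker (k : 'I_N) : exists theta (e : bool), 'X_k = (-1) ^+ e * f theta.
Proof.
case ek : (enum_val k) => [[i iN] c].
pose h t := if t == c then i else tnth tau t.
have hX : minor (generic_mx K tau) h = 'X_k.
  rewrite /minor /determinant (bigD1 1%g) //= odd_perm1 mul1r.
  rewrite [X in _ + X]big1 ?addr0 => [|s sN1].
    rewrite (bigD1 c) //= big1 ?mulr1 => [|t /negPf tc]; last first.
      by rewrite mxE perm1 /h tc chart_mx_in eqxx.
    rewrite mxE perm1 /h eqxx chart_mx_out; congr 'X__.
    by rewrite -[RHS]enum_valK ek; congr enum_rank; congr (_, _); apply: val_inj.
  have [t [tc st]] : exists t, t != c /\ s t != t.
    apply: contrapT => no; case/eqP: sN1; apply/permP => t; rewrite perm1.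
    have fix_t t' : t' != c -> s t' = t'.
      by move=> tc; apply/eqP/negPn/negP => st; apply: no; exists t'.
    have [->|/fix_t //] := eqVneq t c.
    apply/eqP/negPn/negP => /[dup] sc /fix_t /perm_inj /eqP.
    by rewrite (negPf sc).
  rewrite (bigD1 t) //= mxE /h (negPf tc) chart_mx_in eq_sym (negPf st).
  by rewrite mul0r mulr0.
have [h0|[theta [e [_ he]]]] := minor_sort h.
  have := congr1 (mcoeff U_(k)%MM) hX; rewrite h0 mcoeff0 mcoeffX eqxx => /esym/eqP.
  by rewrite oner_eq0.
by exists theta, e; rewrite -hX he.
Qed.

Lemma monomial_plucker (m : 'X_{1..N}) :
  exists S (e : bool), 'X_[m] = (-1) ^+ e * \prod_(u <- S) f u.
Proof.
rewrite mpolyXE_id.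
pose Q (q : {mpoly K[N]}) := exists S (e : bool), q = (-1) ^+ e * \prod_(u <- S) f u.
have prodP p q : Q p -> Q q -> Q (p * q).
  move=> [S [e ->]] [S' [e' ->]]; exists (S ++ S'), (e (+) e').
  by rewrite big_cat signr_addb /=; ring.
have oneP : Q 1 by exists [::], false; rewrite big_nil mulr1.
apply: (big_ind Q) => // k _; elim: (m k) => [|j IH]; first by rewrite expr0.
rewrite exprS; apply: prodP IH; have [theta [e ->]] := variable_plucker k.
by exists [:: theta], e; rewrite big_seq1.
Qed.

(** * The standard monomial basis on the chart *)

Section Richardson.

Variables v w : grindex d n.
Hypotheses (tau_w : leI tau w) (v_tau : leI v tau).

Local Notation Y := (fun x : 'I_N -> K => richardson w v (chart x)).
Local Notation chains := (multichains (@leI d n) tau (leI v) index_defect w).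

Lemma mem_chains k a : (a \in chains k) =
  multichain (@leI d n) tau (leI v) w a && (wt a == k).
Proof. exact/mem_multichains/index_defect_gt0. Qed.

Lemma chains_bounds k a u : a \in chains k -> a u != 0%N ->
  [/\ u != tau, leI v u, leI u w & leI u tau \/ leI tau u].
Proof.
rewrite mem_chains => /andP [/multichainP [h _] _] /h [uN [[ut vu]|[tu uw]]].
  by split=> //; [exact: leI_trans ut tau_w|left].
by split=> //; [exact: leI_trans v_tau tu|right].
Qed.

(** Looking at the degree k component makes the property linear in g and trivial for homogeneous g
    of another degree, so [straighten] applies to it. *)
Definition chart_spanned k (g : {mpoly K[N]}) := exists c : {ffun grindex d n -> nat} -> K,
  vanishing Y (pihomog mdeg k g - \sum_(a <- chains k) c a *: plucker_mono a).

Lemma chart_spanned0 k : chart_spanned k 0.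
Proof.
exists (fun=> 0) => z _; rewrite pihomog0 big1 ?subr0 ?meval0 // => a _.
exact: scale0r.
Qed.

Lemma chart_spannedD k g h :
  chart_spanned k g -> chart_spanned k h -> chart_spanned k (g + h).
Proof.
move=> [c hc] [c' hc']; exists (fun a => c a + c' a) => z Yz.
under eq_bigr do rewrite scalerDl.
by rewrite pihomogD big_split opprD addrACA mevalD hc // hc' // addr0.
Qed.

Lemma chart_spannedZ k s g : chart_spanned k g -> chart_spanned k (s *: g).
Proof.
move=> [c hc]; exists (fun a => s * c a) => z Yz.
under eq_bigr do rewrite -scalerA.
by rewrite linearZ -scaler_sumr -scalerBr mevalZ hc // mulr0.
Qed.

Lemma chart_spanned_chain k S : chain_seq S -> (k < size S)%N ->
  chart_spanned k (\prod_(u <- S) f u).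
Proof.
move=> chS kS; pose a : {ffun grindex d n -> nat} :=
  [ffun u => if u == tau then 0 else count_mem u S]%N.
have Sa : \prod_(u <- S) f u = plucker_mono a.
  rewrite prod_count; apply: eq_bigr => u _; rewrite ffunE.
  by case: eqP => // ->; rewrite plucker_poly_tau !expr1n.
have aS u : a u != 0%N -> u \in S.
  by rewrite ffunE -has_pred1 has_count lt0n; case: ifP.
have [wa|wa] := eqVneq (wt a) k; last first.
  exists (fun=> 0) => z _; rewrite Sa (pihomog_ne0 wa (plucker_mono_homog a)).
  by rewrite big1 ?subr0 ?meval0 // => b _; apply: scale0r.
(* Without tau, each of the more than k factors would have positive degree. *)
have tauS : tau \in S.
  apply/negPn/negP => tN; move: kS; rewrite ltnNge -wa; case/negP.
  have -> : wt a = (\sum_(u <- S) index_defect u)%N.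
    rewrite sum_count; apply: eq_bigr => u _; rewrite ffunE; case: eqP => // ->.
    by rewrite (count_memPn tN).
  rewrite -sum1_size !big_seq; apply: leq_sum => u uS.
  by rewrite index_defect_gt0 //; apply: contraNneq tN => <-.
have [inside|] := boolP (all (fun u => leI v u && leI u w) S); last first.
  case/allPn => u uS nu; exists (fun=> 0) => z Yz.
  rewrite pihomog_dE; last by rewrite Sa -wa plucker_mono_homog.
  rewrite [X in _ - X]big1 ?subr0 => [|b _]; last exact: scale0r.
  rewrite (perm_big _ (perm_to_rem uS)) big_cons mevalM.
  by rewrite (richardson_plucker Yz nu) mul0r.
have aE : a \in chains k.
  rewrite mem_chains wa eqxx andbT; apply/multichainP; split=> [u au|u u' au au'].
    have uS := aS u au; have /allP/(_ u uS)/andP [vu uw] := inside.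
    split; first by apply: contraNneq au => ->; rewrite ffunE eqxx.
    have /allP/(_ u uS)/allP/(_ tau tauS)/orP [ut|tu] := chS; by [left|right].
  by have /allP/(_ u (aS u au))/allP/(_ u' (aS u' au'))/orP := chS.
exists (fun b => (b == a)%:R) => z _; rewrite pihomog_dE;
  last by rewrite Sa -wa plucker_mono_homog.
have -> : \sum_(b <- chains k) (b == a)%:R *: plucker_mono b = plucker_mono a.
  rewrite (bigD1_seq a) ?multichains_uniq //= eqxx scale1r big1 ?addr0 // => b /negPf ->.
  by rewrite scale0r.
by rewrite Sa subrr meval0.
Qed.

(* As p_tau = 1 on the chart, k + 1 factors p_tau can be added before straightening;
   then every standard monomial of degree k contains p_tau. *)
Lemma chart_spanned_all k g : chart_spanned k g.
Proof.
rewrite [g]mpolyE; apply: (big_ind (chart_spanned k)).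
- exact: chart_spanned0.
- exact: chart_spannedD.
move=> m _; apply: chart_spannedZ; have [S [e ->]] := monomial_plucker m.
have -> : (-1) ^+ e * \prod_(u <- S) f u = (-1) ^+ e *: \prod_(u <- S) f u.
  by case: e; rewrite ?expr1 ?mulN1r ?scaleN1r ?expr0 ?mul1r ?scale1r.
apply: chart_spannedZ.
have -> : \prod_(u <- S) f u = \prod_(u <- S ++ nseq k.+1 tau) f u.
  rewrite big_cat -[LHS]mulr1; congr (_ * _); rewrite big1_seq // => u.
  by rewrite mem_nseq => /andP [_ /eqP ->]; exact: plucker_poly_tau.
apply: (straighten (M := generic_mx K tau) (V := chart_spanned k)
  (r := (size S + k.+1)%N)).
- exact: chart_spanned0.
- exact: chart_spannedD.
- by move=> x hx; rewrite -scaleN1r; apply: chart_spannedZ.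
- move=> T sT chT; apply: chart_spanned_chain => //.
  by rewrite sT addnS ltnS leq_addl.
by rewrite size_cat size_nseq.
Qed.

Hypothesis d_gt0 : (0 < d)%N.

(* Homogenizes a monomial of total degree at most [k] by powers of p_tau. *)
Definition complete k a : {ffun grindex d n -> nat} :=
  [ffun u => if u == tau then k - \sum_u a u else a u]%N.

Lemma chains_tau k a : a \in chains k -> a tau = 0%N.
Proof. by move=> ak; apply/eqP/negPn/negP => /(chains_bounds ak) [/eqP]. Qed.

Lemma chains_size k a : a \in chains k -> (\sum_u a u <= k)%N.
Proof.
move=> ak; have := ak; rewrite mem_chains => /andP [_ /eqP <-].
apply: leq_sum => u _; have [->//|au] := eqVneq (a u) 0%N.
have [uN _ _ _] := chains_bounds ak au; by rewrite leq_pmulr // index_defect_gt0.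
Qed.

Lemma complete_inj k : {in chains k &, injective (complete k)}.
Proof.
move=> a b ak bk /ffunP e; apply/ffunP => u; have := e u; rewrite !ffunE.
by case: (u =P tau) => [-> _|//]; rewrite (chains_tau ak) (chains_tau bk).
Qed.

Lemma complete_chain k a : a \in chains k -> chain_support (complete k a).
Proof.
move=> ak u u'; rewrite !ffunE; have := ak;
  rewrite mem_chains => /andP [/multichainP [_ ch] _].
case: (u =P tau) => [->|_]; case: (u' =P tau) => [->|_].
- by left; apply: leI_refl.
- by move=> _ /(chains_bounds ak) [_ _ _ [|]]; [right|left].
- by move=> /(chains_bounds ak) [_ _ _ [|]]; [left|right].
- exact: ch.
Qed.

Local Notation B := (band_mx K v w).
Local Notation p := (fun u : grindex d n => plucker u B).

Definition band_mono k a : {mpoly K[band_dim d n]} := \prod_u p u ^+ complete k a u.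

Lemma leading_band_mono k a : a \in chains k ->
  leading (@band_weight d n) (multiset_mnm (complete k a)) (band_mono k a).
Proof.
move=> ak; apply: leading_prod => u _; rewrite ffunE; case: eqP => [->|_].
  by apply: leading_exp; apply: leading_plucker.
have [->|au] := eqVneq (a u) 0%N; first by rewrite mulm0n expr0; apply: leading1.
have [_ vu uw _] := chains_bounds ak au.
by apply: leading_exp; apply: leading_plucker.
Qed.

(** A relation on Y is transported to band matrices with p_tau != 0, whose column spans are points
    of Y in the chart; there distinct multichains have distinct leading monomials. *)
Lemma chart_free k (c : {ffun grindex d n -> nat} -> K) :
  vanishing Y (\sum_(a <- chains k) c a *: plucker_mono a) ->
  forall a, a \in chains k -> c a = 0.
Proof.
move=> van; suff F0 : \sum_(a <- chains k) c a *: band_mono k a = 0.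
  apply: (leading_free (wgt := @band_weight d n) (multichains_uniq _ _ _ _ _ _)) F0.
    move=> a b ak bk.
    move/(multiset_mnm_inj d_gt0 (complete_chain ak) (complete_chain bk)).
    exact: complete_inj.
  by move=> a; apply: leading_band_mono.
(* Multiplying by p_tau disposes of the matrices outside the chart. *)
have ptauN0 : p tau != 0.
  apply/eqP => p0; have := leading_coef (leading_plucker (K := K) v_tau tau_w).
  by rewrite p0 mcoeff0 => /eqP; rewrite eq_sym oner_eq0.
apply/eqP; rewrite -(mulrI_eq0 _ (lregP ptauN0)); apply/eqP.
apply: mpoly_eval_eq0 => y; rewrite mevalM.
pose M := map_mx (meval y) B.
have pM u : (p u).@[y] = plucker u M.
  by rewrite /plucker -(det_map_mx (meval y)); congr (\det _); apply/matrixP => i j;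
    rewrite !mxE.
have [p0|pN0] := eqVneq (plucker tau M) 0; first by rewrite pM p0 mul0r.
have [x [ex hx]] := chart_of_matrix pN0.
have Yx : richardson w v (chart x).
  rewrite ex; apply: (band_richardson pN0) => i j; rewrite !mxE.
  by case: ifP => // _; rewrite meval0 eqxx.
(* Each [band_mono k a] has exactly k Plücker factors, so normalizing the matrix divides it by the
   k-th power of p_tau. *)
suff -> : (\sum_(a <- chains k) c a *: band_mono k a).@[y] =
    plucker tau M ^+ k * (\sum_(a <- chains k) c a *: plucker_mono a).@[x].
  by rewrite (van x Yx) !mulr0.
rewrite (raddf_sum (meval y)) (raddf_sum (meval x)) /=.
rewrite mulr_sumr big_seq [RHS]big_seq; apply: eq_bigr => a ak.
rewrite !mevalZ mulrCA; congr (_ * _).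
have [q qE] : exists q : grindex d n -> K, forall u, plucker u M = q u.
  by exists (fun u => plucker u M).
have -> : (band_mono k a).@[y] = \prod_u q u ^+ complete k a u.
  rewrite [LHS](rmorph_prod (meval y)); apply: eq_bigr => u _.
  by rewrite -qE -pM; exact: mevalXn.
have -> : (plucker_mono a).@[x] = \prod_u (q u / q tau) ^+ a u.
  rewrite [LHS](rmorph_prod (meval x)); apply: eq_bigr => u _.
  by rewrite -!qE -hx -meval_plucker_poly; exact: mevalXn.
rewrite qE; rewrite qE in pN0.
rewrite (bigD1 tau) //= [in RHS](bigD1 tau) //= (chains_tau ak) expr0 mul1r ffunE eqxx.
have -> : \prod_(u | u != tau) q u ^+ complete k a u = \prod_(u | u != tau) q u ^+ a u.
  by apply: eq_bigr => u /negPf uN; rewrite ffunE uN.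
have -> : \prod_(u | u != tau) (q u / q tau) ^+ a u =
    (\prod_(u | u != tau) q u ^+ a u) * \prod_(u | u != tau) (q tau)^-1 ^+ a u.
  by rewrite -big_split; apply: eq_bigr => u _ /=; rewrite exprMn.
rewrite prodrXr; have -> : (\sum_(u | u != tau) a u = \sum_u a u)%N.
  by rewrite [RHS](bigD1 tau) //= (chains_tau ak).
rewrite -[in RHS](subnK (chains_size ak)) exprD exprVn.
set P := \prod_(_ | _) _; set z := _ ^+ (\sum_u a u); set z' := _ ^+ (k - _).
have zN0 : z != 0 by rewrite expf_neq0.
by rewrite -!mulrA [P * _]mulrC [z * _]mulrA mulfV // mul1r.
Qed.

End Richardson.
End ChartRing.

(** * The multiplicity formula *)

Lemma quotient_dim_seq (K : fieldType) (E : lmodType K) (V W : E -> Prop)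
    (T : eqType) (r : seq T) (F : T -> E) :
  uniq r -> (forall a, a \in r -> V (F a)) ->
  (forall x, V x -> exists c : T -> K, W (x - \sum_(a <- r) c a *: F a)) ->
  (forall c : T -> K, W (\sum_(a <- r) c a *: F a) -> forall a, a \in r -> c a = 0) ->
  quotient_dim V W (size r).
Proof.
case: r => [|a0 r] ur Vr span_r free_r.
  exists (fun=> 0); split=> [[]//|x /span_r [c hc]|c _ []//].
  by exists (fun=> 0); rewrite big_ord0; rewrite big_nil in hc.
set s := a0 :: r in ur Vr span_r free_r *.
exists (fun i => F (nth a0 s i)); split=> [i|x /span_r [c hc]|c hc i].
- by apply: Vr; apply: mem_nth.
- by exists (fun i => c (nth a0 s i)); rewrite (big_nth a0) big_mkord in hc.
pose c' a := if insub (index a s) is Some j then c j else 0.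
have c'E (j : 'I_(size s)) : c' (nth a0 s j) = c j.
  by rewrite /c' seq.index_uniq // valK.
rewrite -c'E; apply: free_r; last exact: mem_nth.
rewrite (big_nth a0) big_mkord; move: hc; congr W.
by apply: eq_bigr => j _; rewrite c'E.
Qed.

Section RichardsonMultiplicity.

Variables (K : closedFieldType) (d n : nat) (tau : grindex d n).
Hypothesis d_gt0 : (0 < d)%N.
Implicit Types v w u : grindex d n.

Lemma richardson_quotient_dim v w k : leI tau w -> leI v tau ->
  quotient_dim (fun g : {mpoly K[chart_dim tau]} => g \is k.-homog)
    (vanishing (fun x => richardson w v (chart x)))
    (multichain_count (@leI d n) tau (leI v) (index_defect tau) w k).
Proof.
move=> tw vt; apply: (quotient_dim_seq (F := @plucker_mono K d n tau)).
- exact: multichains_uniq.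
- by move=> a; rewrite mem_chains => /andP [_ /eqP <-]; apply: plucker_mono_homog.
- move=> g gk; have [c hc] := @chart_spanned_all K d n tau v w k g.
  by exists c; rewrite pihomog_dE in hc.
- exact: chart_free.
Qed.

Lemma mult_at_cumulative v w : leI tau w -> leI v tau -> exists2 q,
  cumulative (multichain_count (@leI d n) tau (leI v) (index_defect tau) w) q
  & mult_at tau (richardson (K := K) w v) = cumulative_degree q.
Proof.
move=> tw vt; pose X (x : 'I_(chart_dim tau) -> K) := richardson w v (chart x).
have X0 : X (fun=> 0) := richardson_origin K tw vt.
have Xc t z : t != 0 -> X z -> X (fun i => t * z i) by apply: chart_scale.
have qd k := richardson_quotient_dim k tw vt.
have [q hq] := cumulative_exists (cone_eventually_poly Xc qd).
exists q => //; apply: (mult_cone X0 Xc qd).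
exact: graded_degree_cumulative.
Qed.

(** Comparable with tau and different from it, theta alone is a multichain, so f_theta is one of the
    independent monomials and hence nonzero. *)
Lemma plucker_degE theta : leI tau theta || leI theta tau ->
  plucker_deg K tau theta = index_defect tau theta.
Proof.
move=> cmp; have [->|thN] := eqVneq theta tau.
  by rewrite /plucker_deg plucker_poly_tau index_defect_tau msize1.
suff fN0 : plucker_poly K theta tau != 0.
  apply: (dhomog_uniq fN0 _ (plucker_poly_homog K tau theta)).
  exact: dhomog_msize (plucker_poly_homog K tau theta).
have [v [w [tw vt vth thw]]] : exists v w, [/\ leI tau w, leI v tau, leI v theta & leI theta w].
  case/orP: cmp => h; [exists tau, theta|exists theta, tau]; split=> //; exact: leI_refl.
pose a : {ffun grindex d n -> nat} := [ffun u => (u == theta) : nat].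
pose chains := multichains (@leI d n) tau (leI v) (index_defect tau) w (index_defect tau theta).
have aE : a \in chains.
  rewrite mem_chains; apply/andP; split.
    have supp u : a u != 0%N -> u = theta by rewrite ffunE eqb0 negbK => /eqP.
    apply/multichainP; split=> [u /supp ->|u u' /supp -> /supp ->]; last by left;
      apply: leI_refl.
    by split=> //; case/orP: cmp => h; [right|left].
  rewrite /weight (bigD1 theta) //= ffunE eqxx mul1n big1 ?addn0 // => u /negPf uN.
  by rewrite ffunE uN.
have ma : plucker_mono K tau a = plucker_poly K theta tau.
  rewrite -[RHS](big_pred1_eq *%R theta (fun u => plucker_poly K u tau)) big_mkcond.
  apply: eq_bigr => u _; rewrite ffunE.
  by case: (u == theta); [exact: expr1|exact: expr0].
apply/eqP => f0.
have van : vanishing (fun x => richardson w v (chart x))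
    (\sum_(b <- chains) ((b == a)%:R : K) *: plucker_mono K tau b).
  move=> x _;
    rewrite (bigD1_seq a) ?multichains_uniq //= ma f0 scaler0 big1 ?addr0 ?meval0 //.
  by move=> b /negPf ->; rewrite scale0r.
have /eqP := chart_free tw vt d_gt0 van aE.
by rewrite eqxx oner_eq0.
Qed.

Lemma mult_at_upper_rec v w : leI tau w -> tau != w -> leI v tau ->
  mult_at tau (richardson (K := K) w v) * (plucker_deg K tau w)%:R =
    \sum_(w' in bdry_plus w tau v) mult_at tau (richardson (K := K) w' v).
Proof.
move=> tw wN vt; rewrite plucker_degE ?tw //.
have exQ u : exists q, leI tau u ->
    cumulative (multichain_count (@leI d n) tau (leI v) (index_defect tau) u) q /\
    mult_at tau (richardson (K := K) u v) = cumulative_degree q.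
  case tu : (leI tau u); last by exists 0.
  by have [q hq mq] := mult_at_cumulative tu vt; exists q.
have [Q hQ] := choice exQ.
rewrite (hQ w tw).2.
rewrite (multichain_degree_rec (@leI_refl d n) (@leI_anti d n) (@leI_trans d n)
  (@index_sum_lt d n) (@index_lower_cover d n) (@index_defect_gt0 d n tau)
  (low := leI v)) //; last 2 first.
- by move=> u /hQ [].
- by rewrite eq_sym.
apply: eq_big => [w'|w']; last by rewrite inE => /and4P [_ _ /hQ [_ ->]].
rewrite !inE /ltI vt /=; have [w'w|] := boolP (leI w' w); rewrite ?andbF //= andbT.
have [->|w'N] := eqVneq w' w; rewrite //=; congr (_ && _).
(* Length and index sum differ by a constant, and w' < w keeps [index_length w - 1] from being
   truncated. *)
have := index_sum_lt w'w w'N; rewrite -!index_lengthE; clear; lia.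
Qed.

(** Reversing the order exchanges the bounds, so the recursion in the upper bound becomes one in v
    for the same multichains. *)
Lemma multichain_rev v w a :
  multichain (fun x y => leI y x) tau (fun u => leI u w) v a =
  multichain (@leI d n) tau (leI v) w a.
Proof.
rewrite /multichain; congr (_ && _); apply: eq_forallb => u.
  by rewrite orbC [leI tau u && _]andbC andbC [leI u tau && _]andbC andbC.
by apply: eq_forallb => u'; rewrite orbC.
Qed.

Lemma multichain_count_rev v w k :
  multichain_count (fun x y => leI y x) tau (fun u => leI u w) (index_defect tau) v k =
  multichain_count (@leI d n) tau (leI v) (index_defect tau) w k.
Proof. by congr size; apply: eq_filter => a; rewrite multichain_rev. Qed.

Lemma mult_at_lower_rec v w : leI tau w -> leI v tau -> v != tau ->
  mult_at tau (richardson (K := K) w v) * (plucker_deg K tau v)%:R =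
    \sum_(v' in bdry_minus w tau v) mult_at tau (richardson (K := K) w v').
Proof.
move=> tw vt vN; rewrite plucker_degE ?vt ?orbT //.
pose ge (x y : grindex d n) := leI y x.
have exQ u : exists q, ge tau u ->
    cumulative (multichain_count ge tau (fun u => leI u w) (index_defect tau) u) q /\
    mult_at tau (richardson (K := K) w u) = cumulative_degree q.
  case ut : (leI u tau); last by exists 0; rewrite /ge ut.
  have [q [k0 hq] mq] := mult_at_cumulative tw ut; exists q => _; split=> //.
  exists k0 => k /hq ->; congr (_%:R); apply: eq_bigr => i _.
  by rewrite multichain_count_rev.
have [Q hQ] := choice exQ.
rewrite (hQ v vt).2.
have ge_refl : reflexive ge by move=> x; apply: leI_refl.
have ge_anti : antisymmetric ge by move=> x y; rewrite andbC => /leI_anti.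
have ge_trans : transitive ge by move=> y x z xy yz; apply: leI_trans yz xy.
(* A rank function for the reversed order; [index_sum_le] keeps the subtraction exact. *)
pose rk u := (d * n - index_sum u)%N.
have rk_mono u u' : ge u u' -> u != u' -> (rk u < rk u')%N.
  rewrite /ge eq_sym => u'u /(index_sum_lt u'u).
  have := index_sum_le u; rewrite /rk; clear; lia.
have ge_cover u u' : ge u u' -> u != u' ->
    exists u1, [/\ ge u u1, ge u1 u', u1 != u' & (rk u1).+1 = rk u'].
  rewrite /ge eq_sym => u'u uN; have [u1 [h1 h2 h3 h4]] := index_upper_cover u'u uN.
  exists u1; split=> //; have := index_sum_le u1; rewrite /rk h4; clear; lia.
rewrite (multichain_degree_rec ge_refl ge_anti ge_trans
  rk_mono ge_cover (@index_defect_gt0 d n tau) (low := fun u => leI u w)) //; last first.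
  by move=> u /hQ [].
apply: eq_big => [v'|v']; last by rewrite inE => /and4P [_ _ /hQ [_ ->]].
rewrite !inE /ltI tw /= /ge [v == v']eq_sym.
have [vv'|] := boolP (leI v v'); rewrite ?andbF //=.
have [_|v'N] := eqVneq v' v; rewrite /= ?andbF //; congr (_ && _); have := index_sum_le v';
  rewrite eq_sym in v'N.
have := index_sum_lt vv' v'N; rewrite /rk -!index_lengthE; clear; lia.
Qed.

Lemma mult_at_point : mult_at tau (richardson (K := K) tau tau) = 1.
Proof.
have [q hq ->] := mult_at_cumulative (leI_refl tau) (leI_refl tau).
have a0 k a : a \in multichains (@leI d n) tau (leI tau) (index_defect tau) tau k ->
    a = [ffun=> 0%N] /\ k = 0%N.
  move=> ak; have a0 : a = [ffun=> 0%N].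
    apply/ffunP => u; rewrite ffunE; apply/eqP/negPn/negP => au.
    have [/eqP uN tu ut _] := chains_bounds (leI_refl tau) (leI_refl tau) ak au.
    by apply: uN; apply: leI_anti; rewrite tu ut.
  split=> //; move: ak; rewrite mem_chains => /andP [_ /eqP <-].
  by rewrite a0 /weight big1 // => u _; rewrite ffunE.
(* Only the empty multichain remains, in weight 0, so every cumulative sum is 1. *)
suff hq1 : cumulative (multichain_count (@leI d n) tau (leI tau) (index_defect tau) tau) 1.
  by rewrite (cumulative_uniq hq hq1) /cumulative_degree lead_coef1 size_poly1 mul1r.
exists 0%N => k _; rewrite hornerC big_ord_recl big1 ?addn0 => [|i _]; last first.
  rewrite /multichain_count; case e : multichains => [//|a s].
  by have [] := a0 i.+1 a; rewrite // e inE eqxx.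
have : (0 < multichain_count (@leI d n) tau (leI tau) (index_defect tau) tau 0)%N.
  by apply: multichain_count0; apply: index_defect_gt0.
rewrite /multichain_count;
  have := multichains_uniq (@leI d n) tau (leI tau) (index_defect tau) tau 0.
case e : multichains => [|a [|b s]] //= /andP [+ _] _.
have [|-> _] := a0 0%N a; first by rewrite e inE eqxx.
have [|-> _] := a0 0%N b; first by rewrite e !inE eqxx orbT.
by rewrite inE eqxx.
Qed.

End RichardsonMultiplicity.

Theorem theorem7p6p2 (K : closedFieldType) (d n : nat)
    (d_ge1 : (1 <= d)%N) (d_lt_n : (d < n)%N) (w tau v : grindex d n) :
  [/\ ltI tau w -> leI v tau ->
        mult_at tau (richardson (K:=K) w v) * (plucker_deg K tau w)%:R =
          \sum_(w' in bdry_plus w tau v)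
             mult_at tau (richardson (K:=K) w' v),
      leI tau w -> ltI v tau ->
        mult_at tau (richardson (K:=K) w v) * (plucker_deg K tau v)%:R =
          \sum_(v' in bdry_minus w tau v)
             mult_at tau (richardson (K:=K) w v')
    & mult_at tau (richardson (K:=K) tau tau) = 1].
Proof.
split.
- by move=> /andP [tN tw] vt; apply: mult_at_upper_rec.
- by move=> tw /andP [vN vt]; apply: mult_at_lower_rec.
- exact: mult_at_point.
Qed.
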